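(* Let $\rho_{\min}=\inf_{x\in\mathbb{R}}\rho^0(x)$ and $\rho_{\max}=\sup_{x\in\mathbb{R}}\rho^0(x)$, and assume $\rho_{\min}>0$. Let $d_M>0$ be such that $0\le x_{i+1}(t)-x_i(t)\le d_M$ for all $t\ge 0$ and all $i\in\{1,\dots,N-1\}$. For $\xi,\beta,p_0>0$, $p_1\in\mathbb{R}$ and $\bar\rho\in\mathbb{R}$ define the symmetric $2\times 2$ matrix $$\Psi_{\xi}(\bar\rho)=\begin{bmatrix}\Psi_{11}(\bar\rho)+2\xi\beta & p_1-2v_f\bar\rho\\ p_1-2v_f\bar\rho & -2+p_0\,\dfrac{d_M^2}{\gamma\pi^2}\,e^{\xi\gamma^{-1}d_M}\end{bmatrix},$$ $$\Psi_{11}(\bar\rho)=v_f\left(\rho_{\max}-\tfrac{8}{3}\bar\rho-\tfrac{4}{3}\rho_{\min}\right)\xi+p_1\xi+\xi^2-\gamma p_0 .$$ If there exist $\beta,\xi,p_0>0$ and $p_1\in\mathbb{R}$ such that $$\Psi_{\xi}(\rho_{\max})\preceq 0\quad\text{and}\quad \Psi_{\xi}(\rho_{\min})\preceq 0,$$ then the estimation error $\varepsilon=\rho_\gamma-\hat\rho$ is exponentially stable, i.e. for every $i\in\{1,\dots,N-1\}$ there exist $\alpha>0$ and $K\ge 1$ such that $$\|\varepsilon(t,\cdot)\|_i\le K\,\|\varepsilon(0,\cdot)\|_i\,e^{-\alpha t}\qquad\text{for all } t\ge 0 .$$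
   Context: Fix constants $v_f>0$ (free flow speed) and $\gamma>0$ (diffusion coefficient), and an initial density $\rho^0\in L^\infty(\mathbb{R},\mathbb{R})$ with values in $[0,1]$ (point values of $\rho^0$ are used below). Traffic model: $\rho_\gamma$ is the unique classical solution, $\rho_\gamma\in C^\infty((0,\infty)\times\mathbb{R},\mathbb{R})\cap C([0,\infty),L^\infty(\mathbb{R},\mathbb{R}))$, of the viscous Burgers equation $$\partial_t\rho_\gamma+v_f(1-2\rho_\gamma)\,\partial_x\rho_\gamma=\gamma\,\partial_{xx}\rho_\gamma,\qquad \rho_\gamma(0,\cdot)=\rho^0 .$$ Probe vehicles: for $i\in\{1,\dots,N\}$, the position $x_i$ satisfies $\dot x_i(t)=v_f\bigl(1-\rho_\gamma(t,x_i(t))\bigr)$, $x_i(0)=x_i^0$, where $x_1^0<x_2^0<\dots<x_N^0$. Observer: for each $i\in\{1,\dots,N-1\}$, $\hat\rho_i\in H^1([0,\infty),H^2(x_i,x_{i+1}))$ is the unique solution of $$\partial_t\hat\rho_i+v_f(1-2\hat\rho_i)\,\partial_x\hat\rho_i=\gamma\,\partial_{xx}\hat\rho_i,\quad t>0,\ x\in(x_i(t),x_{i+1}(t)),$$ $$\hat\rho_i(t,x_i(t))=\rho_\gamma(t,x_i(t)),\quad \hat\rho_i(t,x_{i+1}(t))=\rho_\gamma(t,x_{i+1}(t)),\quad \hat\rho_i(0,\cdot)=\rho^0(x_i^0)\ \text{(constant)},$$ and $\hat\rho(t,x)=\hat\rho_i(t,x)$ for $x\in[x_i(t),x_{i+1}(t)]$.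 Error: $\varepsilon=\rho_\gamma-\hat\rho$ satisfies, on each $(x_i(t),x_{i+1}(t))$, $$\partial_t\varepsilon=-v_f(1-2\rho_\gamma)\,\partial_x\varepsilon+2v_f\,\varepsilon\,\partial_x\hat\rho+\gamma\,\partial_{xx}\varepsilon,\quad \varepsilon(t,x_i(t))=\varepsilon(t,x_{i+1}(t))=0,\quad \varepsilon(0,x)=\rho^0(x)-\rho^0(x_i^0).$$ Notation: $\|\varepsilon(t,\cdot)\|_i^2=\int_{x_i(t)}^{x_{i+1}(t)}\varepsilon^2(t,x)\,dx$; for symmetric matrices, $A\preceq 0$ means $A$ is negative semidefinite. *)

(* Defs.v *)
From HB Require Import structures.
From mathcomp Require Import all_boot all_order all_algebra.
From mathcomp Require Import all_classical all_reals all_analysis.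

Set Implicit Arguments.
Unset Strict Implicit.
Unset Printing Implicit Defensive.
Import Order.TTheory GRing.Theory Num.Theory.
Import numFieldNormedType.Exports.
Local Open Scope classical_set_scope.
Local Open Scope ring_scope.

Section Definitions.
Context {R : realType}.
Implicit Types (l r : R -> R) (f g rho u : R -> R -> R).

Local Notation mu := (@lebesgue_measure R).
Local Notation mu2 := (mu \x mu)%E.

(* Functions of time and space are curried, time first. *)
Definition Dt f : R -> R -> R := fun t x => derive1 (fun s => f s x) t.
Definition Dx f : R -> R -> R := fun t x => derive1 (f t) x.

(* In the word w, [true] stands for time; its head is differentiated last. *)
Definition pderiv (w : seq bool) f : R -> R -> R :=
  foldr (fun b g => if b then Dt g else Dx g) f w.

(* C^oo on the open set Q: [derive1] is total, so the existence of the partial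
   derivatives of every order is required on top of their joint continuity. *)
Definition smooth_on (Q : set (R * R)) f : Prop :=
  forall (w : seq bool) (t x : R), Q (t, x) ->
    [/\ derivable (fun s => pderiv w f s x) t 1,
        derivable (pderiv w f t) x 1 &
        {for (t, x), continuous (fun p : R * R => pderiv w f p.1 p.2)}].

Definition Linfty (h : R -> R) : Prop :=
  measurable_fun setT h /\ ('N[mu]_+oo[EFin \o h] < +oo)%E.

Definition continuous_in_Linfty f : Prop :=
  (forall t : R, 0 <= t -> Linfty (f t)) /\
  (forall t : R, 0 <= t ->
    ('N[mu]_+oo[EFin \o (f s \- f t)%R])%E
      @[s --> within [set s : R | 0 <= s] (nbhs t)] --> 0%E).

Definition traffic_solution (vf gamma : R) (rho0 : R -> R) rho : Prop :=
  [/\ smooth_on [set p : R * R | 0 < p.1] rho,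
      continuous_in_Linfty rho,
      forall t x, 0 < t ->
        Dt rho t x + vf * (1 - 2 * rho t x) * Dx rho t x
          = gamma * Dx (Dx rho) t x &
      forall x, rho 0 x = rho0 x].

(* When rho0 is discontinuous the velocity need not have a limit at t = 0,
   hence a differential equation on t > 0 and continuity on t >= 0. *)
Definition probe_trajectory (vf : R) rho (x0 : R) (x : R -> R) : Prop :=
  [/\ {within [set t : R | 0 <= t], continuous x},
      forall t : R, 0 < t -> is_derive t (1 : R) x (vf * (1 - rho t (x t))) &
      x 0 = x0].

Definition tube l r : set (R * R) :=
  [set p | 0 < p.1 /\ l p.1 < p.2 < r p.1].

Definition L2 d (T : measurableType d) (m : {measure set T -> \bar R})
    (D : set T) (h : T -> R) : Prop :=
  measurable_fun D h /\ (\int[m]_(z in D) ((h z) ^+ 2)%:E < +oo)%E.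

Definition L2loc_tube l r f : Prop :=
  forall T : R, 0 < T ->
    L2 mu2 (tube l r `&` [set p | p.1 < T]) (fun p => f p.1 p.2).

(* H^2(a, b), for the representative that is C^1 up to the endpoints: h and
   its first weak derivative h1 are absolutely continuous on [a, b], and the
   second weak derivative h2 is square integrable. *)
Definition H2 (a b : R) (h h1 h2 : R -> R) : Prop :=
  [/\ L2 mu `]a, b[ h, L2 mu `]a, b[ h1, L2 mu `]a, b[ h2,
      forall y z : R, a <= y -> y <= z -> z <= b ->
        h z - h y = (\int[mu]_(s in `[y, z]) h1 s)%R &
      forall y z : R, a <= y -> y <= z -> z <= b ->
        h1 z - h1 y = (\int[mu]_(s in `[y, z]) h2 s)%R].

(* u in H^1([0, T], H^2(l, r)) for every T > 0, with weak derivatives ut, ux,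
   uxx: u(t) is in H^2(l(t), r(t)) and is a primitive in time of ut, both u and
   ut being square integrable in time with values in H^2.  The domain moves, so
   the primitive is taken along time segments that stay inside it. *)
Definition H1loc_H2 l r u (ut ux uxx : R -> R -> R) : Prop :=
  exists utx utxx : R -> R -> R,
  [/\ [/\ L2loc_tube l r u, L2loc_tube l r ux & L2loc_tube l r uxx],
      [/\ L2loc_tube l r ut, L2loc_tube l r utx & L2loc_tube l r utxx],
      forall t : R, 0 < t -> H2 (l t) (r t) (u t) (ux t) (uxx t),
      {ae mu, forall t : R, 0 < t -> H2 (l t) (r t) (ut t) (utx t) (utxx t)} &
      forall s t y : R, 0 <= s -> s <= t ->
        (forall tau, s <= tau -> tau <= t -> l tau < y < r tau) ->
        u t y - u s y = (\int[mu]_(tau in `[s, t]) ut tau y)%R].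

Definition observer_solution (vf gamma : R) rho (c : R) l r u : Prop :=
  exists ut ux uxx : R -> R -> R,
  [/\ H1loc_H2 l r u ut ux uxx,
      {ae mu2, forall p, tube l r p ->
        ut p.1 p.2 + vf * (1 - 2 * u p.1 p.2) * ux p.1 p.2
          = gamma * uxx p.1 p.2},
      forall t : R, 0 < t -> u t (l t) = rho t (l t),
      forall t : R, 0 < t -> u t (r t) = rho t (r t) &
      forall y, l 0 < y < r 0 -> u 0 y = c].

Definition L2norm (a b : R) (h : R -> R) : \bar R :=
  sqrte (\int[mu]_(y in `[a, b]) ((h y) ^+ 2)%:E)%E.

Definition neg_semidefinite n (A : 'M[R]_n) : Prop :=
  A^T = A /\ forall v : 'cV[R]_n, (v^T *m A *m v) 0 0 <= 0.

Definition Psi11 (vf gamma rho_min rho_max p0 p1 xi rb : R) : R :=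
  vf * (rho_max - 8 / 3 * rb - 4 / 3 * rho_min) * xi
    + p1 * xi + xi ^+ 2 - gamma * p0.

Definition Psi (vf gamma rho_min rho_max dM beta p0 p1 xi rb : R) : 'M[R]_2 :=
  let diag0 := Psi11 vf gamma rho_min rho_max p0 p1 xi rb + 2 * xi * beta in
  let off := p1 - 2 * vf * rb in
  let diag1 :=
    - 2 + p0 * (dM ^+ 2 / (gamma * pi ^+ 2)) * expR (xi * gamma^-1 * dM) in
  \matrix_(i, j) if i == j then (if i == 0 then diag0 else diag1) else off.

End Definitions.

(* Main.v *)
(* The error is measured by the weighted energy
     V(t) = exp(kappa t) int exp(s (y - l(t))) (rho - rhohat)^2 dy,
   with s = xi / gamma and kappa = 2 s beta, over the interval (l(t), r(t))
   between two consecutive probes.  Up to an exact space derivative, which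
   integrates to 0 by the boundary conditions, and a Wirtinger term of constant
   ((r(t) - l(t)) / pi)^2, the integrand of V' is the quadratic form of the LMI
   at the density rho(t, y), hence V' <= 0.  The LMI is affine in the density,
   so it suffices that rho and rhohat take values in [rho_min, rho_max]: for
   rho this is the maximum principle on the line, applied from small times on
   because of the L^oo continuity at t = 0; for rhohat it is a truncation
   argument with the bounded test function theta((k - rhohat)_+).

   Since rhohat is only weakly regular, both energy estimates are made by
   extending the density by 0 outside (l(t), r(t)), integrating in time on
   almost every horizontal slice, and applying Fubini.  The probes move to the
   right, so that every slice is a time interval.  The lateral traces are
   reached along a sequence of times: |rhohat(t, y) - rho(t, l(t))|^2 is at most
   (y - l(t)) int (d_x rhohat)^2, where y - l(t) is at most linear in time and
   the integral is integrable in time.  Finally V(t) <= V(0) follows from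
   V(t) <= V(t_n), t_n -> 0, by dominated convergence. *)

Require Import Defs.
From HB Require Import structures.
From mathcomp Require Import all_boot all_order all_algebra.
From mathcomp Require Import all_classical all_reals all_analysis.
From mathcomp Require Import measurable_realfun ess_sup_inf.
From mathcomp Require Import ring lra.
Import Order.TTheory GRing.Theory Num.Theory.
Import numFieldNormedType.Exports.
Local Open Scope classical_set_scope.
Local Open Scope ring_scope.
Set Implicit Arguments.
Unset Strict Implicit.
Unset Printing Implicit Defensive.

(** Each parameter of the LMI is a multiplier. [xi] is the growth rate of the weight [w] and [beta]
    the decay rate; [p1] multiplies the exact derivative [(w e^2)'], added for free since the error
    [e] vanishes at both ends; [p0] multiplies Wirtinger's inequality. The one cubic term left, a
    multiple of [w e^3], is made quadratic by [e <= r - rm], which is where the maximum principle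
    for the observer enters and where 8/3 and 4/3 come from.

    Two estimates share one energy argument but not their starting time. The truncation estimate
    starts at time 0: its test function is bounded and the time derivative of the observer is square
    integrable down to 0. The Lyapunov estimate starts at a time [S > 0]: the time derivative of the
    traffic density is controlled only away from 0, where the initial datum may be discontinuous.
    This is why the comparison with time 0 needs a limit.

    The weak derivatives are used only through integral identities, so calculus is done on
    absolutely continuous functions, with a chain rule that never differentiates them pointwise. *)

Section RealIntegrable.
Context d (T : measurableType d) (R : realType).
Variables (m : {measure set T -> \bar R}) (D : set T) (mD : measurable D).
Implicit Types (f g h : T -> R) (k : R).

Lemma integrableRZ k f : m.-integrable D (EFin \o f) ->
  m.-integrable D (EFin \o (fun x => k * f x)).
Proof. by move=> fi; have := integrableZl mD k fi; apply: eq_integrable. Qed.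

Lemma integrableRD f g : m.-integrable D (EFin \o f) ->
  m.-integrable D (EFin \o g) ->
  m.-integrable D (EFin \o (fun x => f x + g x)).
Proof. by move=> fi gi; have := integrableD mD fi gi; apply: eq_integrable. Qed.

Lemma integrableRB f g : m.-integrable D (EFin \o f) ->
  m.-integrable D (EFin \o g) ->
  m.-integrable D (EFin \o (fun x => f x - g x)).
Proof. by move=> fi gi; have := integrableB mD fi gi; apply: eq_integrable. Qed.

Lemma integrableRM h f : measurable_fun D h -> [bounded h x | x in D] ->
  m.-integrable D (EFin \o f) ->
  m.-integrable D (EFin \o (fun x => h x * f x)).
Proof. by move=> mh bh fi; have := integrableMr mD mh bh fi; apply: eq_integrable. Qed.

Lemma eq_integrableR f g : (forall x, D x -> f x = g x) ->
  m.-integrable D (EFin \o f) -> m.-integrable D (EFin \o g).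
Proof. by move=> fg; apply: eq_integrable => // x /[!inE] Dx /=; rewrite fg. Qed.

End RealIntegrable.

(** * Calculus of absolutely continuous functions *)

Section Primitive.
Context {R : realType}.
Implicit Types (a b x y z : R) (f g F G : R -> R).
Local Notation mu := (@lebesgue_measure R).

Lemma integrable_itvS a b y z f : a <= y -> z <= b ->
  mu.-integrable `[a, b] (EFin \o f) -> mu.-integrable `[y, z] (EFin \o f).
Proof.
move=> ay zb; apply: integrableS => //; apply: subset_itv; exact.
Qed.

Lemma Rintegral_itv_split y z w f : y <= z -> z <= w ->
  mu.-integrable `[y, w] (EFin \o f) ->
  \int[mu]_(s in `[y, w]) f s
    = \int[mu]_(s in `[y, z]) f s + \int[mu]_(s in `[z, w]) f s.
Proof.
move=> yz zw fi; have := @Rintegral_itvB R f (BLeft y) (BRight w) z fi.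
rewrite !bnd_simp => /(_ yz zw) /eqP; rewrite subr_eq => /eqP ->.
rewrite addrC; congr (_ + _); apply: Rintegral_itv_obnd_cbnd.
apply: integrableS fi => //; apply: subset_itv => //; exact/ltW.
Qed.

(** Absolute continuity with a chosen representative of the derivative. Increments over all
    subintervals are the form in which both the weak space derivatives and the time derivative of
    the observer are given. *)
Definition primitive a b F f :=
  mu.-integrable `[a, b] (EFin \o f) /\
  forall y z, a <= y -> y <= z -> z <= b ->
    F z - F y = \int[mu]_(s in `[y, z]) f s.

Lemma eq_primitive a b F G f g : (forall x, a <= x -> x <= b -> F x = G x) ->
  (forall x, a <= x -> x <= b -> f x = g x) ->
  primitive a b F f -> primitive a b G g.
Proof.
move=> FG fg [fi FE]; split.
  apply: eq_integrableR fi => // x; rewrite /= in_itv/= => /andP[ax xb].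
  by rewrite fg.
move=> y z ay yz zb; rewrite -!FG //.
- rewrite FE //; apply: eq_Rintegral => x; rewrite inE/= in_itv/=.
  by move=> /andP[yx xz]; rewrite fg//; [exact: le_trans yx|exact: le_trans zb].
- exact: le_trans zb.
- exact: le_trans yz.
Qed.

Lemma primitive_continuous a b F f : a <= b ->
  primitive a b F f -> {within `[a, b], continuous F}.
Proof.
move=> ab [fi FE].
have H := parameterized_integral_continuous ab fi.
have : {within `[a, b], continuous
   (fun x => F a + \int[mu]_(t in `[a, x]) f t)}.
  move=> x; apply: (@cvgD _ _ _ (nbhs x)); [exact: cvg_cst|exact: H].
apply: subspace_eq_continuous => x; rewrite /from_subspace inE/= in_itv/=.
by move=> /andP[ax xb]; rewrite -FE // subrKC.
Qed.

Lemma within_itv_dist a b f x : a <= x <= b ->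
  {within `[a, b], continuous f} ->
  forall e : R, 0 < e -> exists2 d : R, 0 < d &
    forall y, a <= y <= b -> `|x - y| < d -> `|f x - f y| < e.
Proof.
move=> xab cf e e0.
have := cf x; rewrite /continuous_at /=.
move=> /cvgrPdist_lt /(_ e e0).
rewrite /nbhs /= /nbhs_subspace mem_set; last by rewrite /= in_itv.
rewrite /within /= /prop_near1 nbhs_simpl /= => -[d /= d0 dP].
by exists d => // y yab xy; apply: dP => //=; rewrite in_itv.
Qed.

(* Creeping argument at the supremum of the points up to which the bound
   holds. *)
Lemma increment_le_local a b (D V : R -> R) : a <= b ->
  (forall x, a <= x <= b -> exists2 d : R, 0 < d & forall s t,
     a <= s -> s <= x -> x <= t -> t <= b -> x - s < d -> t - x < d ->
     `|D t - D s| <= V t - V s) ->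
  `|D b - D a| <= V b - V a.
Proof.
move=> ab loc.
pose S := [set x | a <= x <= b /\ `|D x - D a| <= V x - V a].
have Sa : S a by split; [rewrite lexx|rewrite !subrr normr0].
have Sub : has_ubound S by exists b => x -[/andP[]].
have supS : has_sup S by split; first exists a.
have cab : a <= sup S <= b.
  apply/andP; split; first exact: ub_le_sup.
  by apply: ge_sup; [exists a|move=> x [/andP[]]].
have [d d0 dP] := loc _ cab.
have [s [/andP[as_ sb] sS] sd] := sup_adherent d0 supS.
have sc : s <= sup S by apply: ub_le_sup => //; split => //; rewrite as_.
have key t : sup S <= t -> t <= b -> t - sup S < d -> S t.
  move=> ct tb td; split; first by rewrite tb andbT (le_trans _ ct)//; case/andP: cab.
  have := dP s t as_ sc ct tb; rewrite ltrBlDr -ltrBlDl => /(_ sd td) H.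
  have -> : D t - D a = (D t - D s) + (D s - D a) by ring.
  by apply: le_trans (ler_normD _ _) _; lra.
have [cb|cb] := ltP (sup S) b; last first.
  have : S b by apply: key => //; [case/andP: cab|rewrite (le_lt_trans _ d0)// subr_le0].
  by case.
pose t := Num.min b (sup S + d / 2).
have : S t.
  apply: key; rewrite /t.
  - by rewrite le_min (ltW cb)/=; lra.
  - by rewrite ge_min lexx.
  - by rewrite ltrBlDr gt_min; apply/orP; right; lra.
move=> /(ub_le_sup Sub); rewrite /t ge_min leNgt cb/= => ?; lra.
Qed.

Lemma continuous_bounded_itv a b f : {within `[a, b], continuous f} ->
  [bounded f x | x in `[a, b]%classic].
Proof.
move=> cf; have /compact_bounded := continuous_compact cf (@segment_compact R a b).
by move=> [M [Mr HM]]; exists M; split => // y /HM Hy x ?; apply: Hy; exists x.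
Qed.

Lemma primitiveM_bounded a b f g : {within `[a, b], continuous g} ->
  mu.-integrable `[a, b] (EFin \o f) ->
  mu.-integrable `[a, b] (EFin \o (fun x => g x * f x)).
Proof.
move=> cg; apply: integrableRM => //.
- exact: subspace_continuous_measurable_fun.
- exact: continuous_bounded_itv.
Qed.

(** Chain rule without differentiating [F]. Near each point the mean value theorem turns an
    increment of [Phi \o F] into [phi v] times the increment of [F], so the defect [D] moves by at
    most [e] times the integral of [|f|]; [increment_le_local] makes this global, and [e] is
    arbitrary. *)
Lemma primitive_comp a b F f (Phi phi : R -> R) : a <= b ->
  (forall v, is_derive v (1:R) Phi (phi v)) -> continuous phi ->
  primitive a b F f ->
  primitive a b (Phi \o F) (fun x => phi (F x) * f x).
Proof.
move=> ab dPhi cphi pF; have [fi FE] := pF.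
have cF := primitive_continuous ab pF.
have cphiF : {within `[a, b], continuous (phi \o F)}.
  by move=> x; apply: (@continuous_comp (subspace `[a, b]) R R); [exact: cF|exact: cphi].
have gi := primitiveM_bounded cphiF fi.
have nfi : mu.-integrable `[a, b] (EFin \o (fun x => `|f x|)).
  exact: integrable_norm fi.
split => // y z ay yz zb.
have cut p q (k : R -> R) : mu.-integrable `[a, b] (EFin \o k) ->
   y <= p -> p <= q -> q <= z ->
   \int[mu]_(s in `[p, q]) k s = \int[mu]_(s in `[y, q]) k s -
     \int[mu]_(s in `[y, p]) k s.
  move=> ki yp pq qz; rewrite (@Rintegral_itv_split y p q)//.
    by rewrite addrAC subrr add0r.
  by apply: integrable_itvS ki => //; exact: le_trans zb.
pose D t := Phi (F t) - \int[mu]_(s in `[y, t]) (phi (F s) * f s).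
suff H (e : R) : 0 < e -> `|D z - D y| <= e * \int[mu]_(s in `[y, z]) `|f s|.
  have D0 : `|D z - D y| <= 0.
    have [I0|I0] := leP (\int[mu]_(s in `[y, z]) `|f s|) 0.
      by apply: le_trans (H _ ltr01) _; rewrite mul1r.
    apply/ler_addgt0Pr => e e0; rewrite add0r.
    apply: le_trans (H _ (divr_gt0 e0 I0)) _.
    by rewrite divfK ?gt_eqF.
  move: D0; rewrite normr_le0 /D set_itv1 Rintegral_set1 subr0.
  by rewrite subr_eq0 subr_eq addrC -subr_eq => /eqP.
move=> e0.
pose V t := e * \int[mu]_(s in `[y, t]) `|f s|.
have -> : e * \int[mu]_(s in `[y, z]) `|f s| = V z - V y.
  by rewrite /V set_itv1 Rintegral_set1 mulr0 subr0.
apply: increment_le_local => // x /andP[yx xz].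
have [d1 d10 d1P] : exists2 d : R, 0 < d & forall v, `|F x - v| < d ->
    `|phi (F x) - phi v| < e / 2.
  have := cphi (F x) => /cvgrPdist_lt /(_ (e/2)).
  by rewrite divr_gt0// => /(_ isT) [d /= d0 dP]; exists d.
have xab : a <= x <= b by rewrite (le_trans ay yx) (le_trans xz zb).
have [d2 d20 d2P] := within_itv_dist xab cF d10.
exists d2 => // s t ys sx xt tz xs tx.
have near_x w : s <= w -> w <= t -> `|F x - F w| < d1.
  move=> sw wt; apply: d2P.
    by rewrite (le_trans ay (le_trans ys sw)) (le_trans wt (le_trans tz zb)).
  rewrite ltr_norml; apply/andP; split; lra.
have st : s <= t by exact: le_trans xt.
have [v vst dv] : exists2 v, `|F x - v| < d1 &
    Phi (F t) - Phi (F s) = phi v * (F t - F s).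
  have cPhi (p q : R) : {within `[p, q], continuous Phi}.
    by apply: derivable_within_continuous => v _; exact: ex_derive.
  have Fs := near_x s (lexx _) st; have Ft := near_x t st (lexx _).
  have [le|le] := leP (F s) (F t).
    have [c] := MVT_segment le (fun v _ => dPhi v) (cPhi _ _).
    rewrite in_itv/= => /andP[? ?] ->; exists c => //.
    move: Fs Ft; rewrite !ltr_norml => /andP[? ?] /andP[? ?].
    by apply/andP; split; lra.
  have [c] := MVT_segment (ltW le) (fun v _ => dPhi v) (cPhi _ _).
  rewrite in_itv/= => /andP[? ?] Ec; exists c; last first.
    by rewrite -opprB Ec -mulrN opprB.
  move: Fs Ft; rewrite !ltr_norml => /andP[? ?] /andP[? ?].
  by apply/andP; split; lra.
have sub (k : R -> R) : mu.-integrable `[a, b] (EFin \o k) ->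
    mu.-integrable `[s, t] (EFin \o k).
  by apply: integrable_itvS; [exact: le_trans ys|exact: le_trans zb].
have fst := sub _ fi.
have cst_i c : mu.-integrable `[s, t] (EFin \o (fun w => c * f w)).
  exact: integrableRZ.
have -> : D t - D s = \int[mu]_(w in `[s, t]) ((phi v - phi (F w)) * f w).
  have -> : \int[mu]_(w in `[s, t]) ((phi v - phi (F w)) * f w)
     = \int[mu]_(w in `[s, t]) (phi v * f w - phi (F w) * f w).
    by apply: eq_Rintegral => w _; rewrite mulrBl.
  rewrite RintegralB //; [|exact: sub].
  rewrite RintegralZl // -FE //; [|exact: le_trans ys|exact: le_trans zb].
  rewrite -dv /D (cut s t) //.
  ring.
have di : mu.-integrable `[s, t] (EFin \o (fun w => (phi v - phi (F w)) * f w)).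
  have : mu.-integrable `[s, t] (EFin \o (fun w => phi v * f w - phi (F w) * f w)).
    by apply: integrableRB => //; exact: sub.
  by apply: eq_integrableR => // w _ /=; rewrite mulrBl.
apply: le_trans (le_normr_Rintegral _ di) _ => //.
rewrite /V -mulrBr -cut // -RintegralZl //; last exact: sub.
apply: le_Rintegral => //.
- exact: integrable_norm di.
- by apply: integrableRZ => //; exact: sub.
- move=> w /=; rewrite in_itv/= => /andP[sw wt].
  rewrite normrM ler_wpM2r//.
  have H1 := d1P _ (near_x w sw wt); have H2 := d1P _ vst.
  have -> : phi v - phi (F w) = (phi (F x) - phi (F w)) - (phi (F x) - phi v).
    ring.
  by apply: le_trans (ler_normB _ _) _; lra.
Qed.

Lemma primitiveD a b F f G g : primitive a b F f -> primitive a b G g ->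
  primitive a b (fun x => F x + G x) (fun x => f x + g x).
Proof.
move=> [fi FE] [gi GE]; split.
  exact: integrableRD.
move=> y z ay yz zb; rewrite RintegralD //; last 2 first.
- exact: integrable_itvS fi.
- exact: integrable_itvS gi.
by rewrite -FE// -GE//; ring.
Qed.

Lemma primitiveZ a b (k : R) F f : primitive a b F f ->
  primitive a b (fun x => k * F x) (fun x => k * f x).
Proof.
move=> [fi FE]; split; first exact: integrableRZ.
move=> y z ay yz zb; rewrite RintegralZl //; last exact: integrable_itvS fi.
by rewrite -FE//; ring.
Qed.

Lemma primitiveB a b F f G g : primitive a b F f -> primitive a b G g ->
  primitive a b (fun x => F x - G x) (fun x => f x - g x).
Proof.
move=> pF pG; have := primitiveD pF (primitiveZ (-1) pG).
by apply: eq_primitive => x _ _; rewrite mulN1r.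
Qed.

Lemma primitive_sqr a b F f : a <= b -> primitive a b F f ->
  primitive a b (fun x => F x ^+ 2) (fun x => 2 * F x * f x).
Proof.
move=> ab pF; have d v : is_derive v (1:R) (fun v : R => v ^+ 2) (2 * v).
  by apply: is_derive_eq; rewrite /= ?scaler1; ring.
have c : continuous (fun v : R => 2 * v).
  by move=> v; apply: cvgM; [exact: cvg_cst|exact: cvg_id].
exact: (primitive_comp ab d c pF).
Qed.

(** Polarization: a product is a quarter of the difference of the squares of the sum and of the
    difference. *)
Lemma primitiveM a b F f G g : a <= b ->
  primitive a b F f -> primitive a b G g ->
  primitive a b (fun x => F x * G x) (fun x => f x * G x + F x * g x).
Proof.
move=> ab pF pG.
have := primitiveZ (1/4) (primitiveB (primitive_sqr ab (primitiveD pF pG))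
  (primitive_sqr ab (primitiveB pF pG))).
by apply: eq_primitive => x _ _; field.
Qed.

Lemma primitive_C1 a b F f : a <= b ->
  (forall x, a <= x <= b -> is_derive x (1:R) F (f x)) ->
  (forall x, a <= x <= b -> {for x, continuous f}) ->
  primitive a b F f.
Proof.
move=> ab dF cf.
have cfw y z : a <= y -> z <= b -> {within `[y, z], continuous f}.
  move=> ay zb; apply: continuous_in_subspaceT => x; rewrite inE/= in_itv/=.
  move=> /andP[yx xz]; apply: cf.
  by rewrite (le_trans ay yx) (le_trans xz zb).
split.
  apply: continuous_compact_integrable; first exact: segment_compact.
  exact: cfw.
move=> y z ay; rewrite le_eqVlt => /predU1P[<- _|yz zb].
  by rewrite subrr set_itv1 Rintegral_set1.
have dF' x : y <= x <= z -> is_derive x (1:R) F (f x).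
  move=> /andP[yx xz]; apply: dF.
  by rewrite (le_trans ay yx) (le_trans xz zb).
have cFx x : y <= x <= z -> F w @[w --> x] --> F x.
  move=> xyz; apply: differentiable_continuous; apply/derivable1_diffP.
  by have [] := dF' x xyz.
rewrite /Rintegral (@continuous_FTC2 R f F y z) //.
- exact: cfw.
- split.
  + move=> x; rewrite in_itv/= => /andP[/ltW yx /ltW xz].
    by have [] := dF' x _; rewrite ?yx.
  + by apply: cvg_at_right_filter; apply: cFx; rewrite lexx ltW.
  + by apply: cvg_at_left_filter; apply: cFx; rewrite lexx ltW.
- move=> x; rewrite in_itv/= => /andP[/ltW yx /ltW xz].
  by rewrite derive1E; have [] := dF' x _; rewrite ?yx.
Qed.

Lemma primitive_le0 a b F f (h : R -> R) : a <= b -> primitive a b F f ->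
  F b = F a -> (forall x, a <= x <= b -> h x <= f x) ->
  mu.-integrable `[a, b] (EFin \o h) -> \int[mu]_(s in `[a, b]) h s <= 0.
Proof.
move=> ab [fi FE] FF hf hi.
have -> : 0 = \int[mu]_(s in `[a, b]) f s by rewrite -FE// FF subrr.
by apply: le_Rintegral => // x; rewrite /= in_itv/=; exact: hf.
Qed.

End Primitive.

(** * Wirtinger's inequality *)

Section Spatial.
Context {R : realType}.
Local Notation mu := (@lebesgue_measure R).

Lemma continuous_integrable_itv (a b : R) (f : R -> R) :
  {within `[a, b], continuous f} -> mu.-integrable `[a, b] (EFin \o f).
Proof.
by move=> cf; apply: continuous_compact_integrable => //; exact: segment_compact.
Qed.

Lemma within_continuousM (A : set R) (f g : R -> R) :
  {within A, continuous f} -> {within A, continuous g} ->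
  {within A, continuous (fun x => f x * g x)}.
Proof. by move=> cf cg x; apply: (@cvgM _ _ (nbhs x)); [exact: cf|exact: cg]. Qed.

Lemma is_derive_continuous (f : R -> R) (x df : R) :
  is_derive x (1:R) f df -> {for x, continuous f}.
Proof.
by case=> dfx _; apply: differentiable_continuous; apply/derivable1_diffP.
Qed.

(* Completing the square: with c = k cot(k (x - a + h)), one has
   c' + c^2 = - k^2, so that k^2 e^2 - e1^2 <= - (c e^2)'. *)
Lemma wirtinger_gap (a b h : R) (e e1 : R -> R) : a <= b -> 0 < h ->
  primitive a b e e1 -> {within `[a, b], continuous e1} ->
  e a = 0 -> e b = 0 ->
  \int[mu]_(x in `[a, b]) e x ^+ 2
    <= ((b - a + h + h) / pi) ^+ 2 * \int[mu]_(x in `[a, b]) e1 x ^+ 2.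
Proof.
move=> ab h0 pe ce1 ea eb.
have pi0 : 0 < (pi : R) by exact: pi_gt0.
(* The margin [h] on both sides keeps [th] strictly between 0 and [pi] on the closed interval, so
   that the cotangent is C^1 up to the ends. *)
pose L := b - a + h + h.
have L0 : 0 < L by rewrite /L -addrA ltr_wpDl ?subr_ge0// addr_gt0.
pose k := pi / L.
have k0 : 0 < k by rewrite divr_gt0.
pose th x := k * (x - a + h).
pose c x := k * (cos (th x) / sin (th x)).
have sin0 x : a <= x <= b -> 0 < sin (th x).
  move=> /andP[ax xb]; apply: sin_gt0_pi.
  have xah : 0 < x - a + h by rewrite ltr_wpDl// subr_ge0.
  apply/andP; split; first by rewrite /th mulr_gt0.
  rewrite /th /k mulrAC ltr_pdivrMr// ltr_pM2l// /L; lra.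
have dth x : is_derive x (1:R) th k.
  by apply: is_derive_eq; rewrite /= ?scaler1; rewrite /GRing.scale/=; ring.
have ds x : is_derive x (1:R) (fun x => sin (th x)) (k * cos (th x)).
  by apply: is_derive_eq; rewrite mulrC.
have dc x : a <= x <= b -> is_derive x (1:R) c (- k ^+ 2 / sin (th x) ^+ 2).
  move=> xab; have s0 := sin0 x xab.
  have dco : is_derive x (1:R) (fun x => cos (th x)) (k * - sin (th x)).
    by apply: is_derive_eq; rewrite mulrC.
  have ns : sin (th x) != 0 by rewrite gt_eqF.
  have dV := is_deriveV ns (ds x).
  have dM := is_deriveM dco dV.
  have dZ := is_deriveZ k dM.
  apply: (is_derive_eq dZ).
  rewrite /GRing.scale /=.
  have : sin (th x) ^+ 2 + cos (th x) ^+ 2 = 1 by rewrite addrC cos2Dsin2.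
  move: (sin _) (cos _) ns => S C ns SC.
  rewrite -[- k ^+ 2]mulr1 -SC /=.
  by field.
have cc x : a <= x <= b -> {for x, continuous (fun x => - k ^+ 2 / sin (th x) ^+ 2)}.
  move=> xab; apply: cvgM; first exact: cvg_cst.
  apply: cvgV; first by rewrite expf_neq0// gt_eqF// sin0.
  apply: (@continuous_comp _ _ _ (fun x => sin (th x)) (fun v => v ^+ 2)).
    exact: is_derive_continuous (ds x).
  exact: exprn_continuous.
have pc := primitive_C1 ab dc cc.
have pA := primitiveZ (-1) (primitiveM ab pc (primitive_sqr ab pe)).
have ce := primitive_continuous ab pe.
have ie : mu.-integrable `[a, b] (EFin \o (fun x => e x ^+ 2)).
  by apply: continuous_integrable_itv; exact: within_continuousM.
have ie1 : mu.-integrable `[a, b] (EFin \o (fun x => e1 x ^+ 2)).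
  by apply: continuous_integrable_itv; exact: within_continuousM.
have ike : mu.-integrable `[a, b] (EFin \o (fun x => k ^+ 2 * e x ^+ 2)).
  exact: integrableRZ.
have H : \int[mu]_(x in `[a, b]) (k ^+ 2 * e x ^+ 2 - e1 x ^+ 2) <= 0.
  apply: (primitive_le0 ab pA).
  - by rewrite ea eb expr0n/= !mulr0.
  - move=> x xab; have s0 := sin0 x xab.
    have ns : sin (th x) != 0 by rewrite gt_eqF.
    have -> : - k ^+ 2 / sin (th x) ^+ 2 = - k ^+ 2 - c x ^+ 2.
      have : sin (th x) ^+ 2 + cos (th x) ^+ 2 = 1 by rewrite addrC cos2Dsin2.
      rewrite /c; move: (sin _) (cos _) ns => S C ns SC.
      by rewrite -[X in X / _]mulr1 -SC; field.
    by rewrite -subr_ge0; have := sqr_ge0 (e1 x - c x * e x); nra.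
  - exact: integrableRB.
move: H; rewrite RintegralB// RintegralZl// subr_le0 => H.
have -> : (L / pi) ^+ 2 = (k ^+ 2)^-1.
  by rewrite /k -exprVn invf_div.
by rewrite ler_pdivlMl// exprn_gt0.
Qed.

(** The sharp constant is recovered by letting the gap tend to 0; bounding the length by [d] gives
    one constant for all times. *)
Lemma wirtinger (a b d : R) (e e1 : R -> R) : a <= b -> b - a <= d ->
  primitive a b e e1 -> {within `[a, b], continuous e1} ->
  e a = 0 -> e b = 0 ->
  \int[mu]_(x in `[a, b]) e x ^+ 2
    <= d ^+ 2 / pi ^+ 2 * \int[mu]_(x in `[a, b]) e1 x ^+ 2.
Proof.
move=> ab bad pe ce1 ea eb.
have pi0 : 0 < (pi : R) by exact: pi_gt0.
set X := \int[mu]_(x in _) e x ^+ 2; set Y := \int[mu]_(x in _) e1 x ^+ 2.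
have Y0 : 0 <= Y by apply: Rintegral_ge0 => x _; exact: sqr_ge0.
have d0 : 0 <= d by rewrite (le_trans _ bad)// subr_ge0.
pose Z := Y / pi ^+ 2.
have Z0 : 0 <= Z by rewrite divr_ge0// exprn_ge0// ltW.
have -> : d ^+ 2 / pi ^+ 2 * Y = d ^+ 2 * Z by rewrite /Z mulrAC mulrA.
apply/ler_addgt0Pr => n n0.
(* For [0 <= g <= 1] one has [(d + g)^2 <= d^2 + (2 d + 1) g], so that a total gap [g <= n / B]
   costs at most [n]. *)
pose B := (2 * d + 1) * Z + 1.
have B0 : 0 < B by rewrite ltr_wpDl// mulr_ge0// addr_ge0// mulr_ge0.
pose g := Num.min 1 (n / B).
have g0 : 0 < g by rewrite lt_min ltr01 divr_gt0.
have g1 : g <= 1 by rewrite ge_min lexx.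
have gB : g * B <= n by rewrite -ler_pdivlMr// ge_min lexx orbT.
have h0 : 0 < g / 2 by rewrite divr_gt0.
have := wirtinger_gap ab h0 pe ce1 ea eb; rewrite -/X -/Y => H.
apply: le_trans H _.
have -> : ((b - a + g / 2 + g / 2) / pi) ^+ 2 * Y = (b - a + g) ^+ 2 * Z.
  by rewrite /Z -addrA -splitr expr_div_n mulrAC mulrA.
have : (b - a + g) ^+ 2 <= (d + g) ^+ 2.
  by apply: lerXn2r; rewrite ?nnegrE; lra.
move=> /(ler_wpM2r Z0) H; apply: le_trans H _.
have : (d + g) ^+ 2 <= d ^+ 2 + (2 * d + 1) * g by nra.
move=> /(ler_wpM2r Z0) H; apply: le_trans H _.
rewrite mulrDl lerD2l (le_trans _ gB)// /B.
by rewrite mulrAC mulrC mulrDr mulr1 lerDl ltW.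
Qed.

End Spatial.

(** * The Lyapunov inequality at a fixed time *)

Section LyapunovSpatial.
Context {R : realType}.
Local Notation mu := (@lebesgue_measure R).

Lemma is_derive_exp_affine (c s a x : R) :
  is_derive x (1:R) (fun y => c * expR (s * (y - a)))
    (s * (c * expR (s * (x - a)))).
Proof.
have dth : is_derive x (1:R) (fun y : R => s * (y - a)) s.
  by apply: is_derive_eq; rewrite /= /GRing.scale/=; ring.
have de : is_derive x (1:R) (fun y => expR (s * (y - a))) (expR (s * (x - a)) * s).
  by apply: is_derive_eq; rewrite mulrC.
apply: (is_derive_eq (is_deriveZ c de)).
by rewrite /GRing.scale/=; ring.
Qed.

Lemma primitive_exp_affine (p q c s a : R) : p <= q ->
  primitive p q (fun y => c * expR (s * (y - a)))
    (fun y => s * (c * expR (s * (y - a)))).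
Proof.
move=> pq; apply: primitive_C1 => // x _; first exact: is_derive_exp_affine.
apply: cvgM; first exact: cvg_cst.
exact: is_derive_continuous (is_derive_exp_affine _ _ _ _).
Qed.

Lemma one_le_expR (x : R) : 0 <= x -> 1 <= expR x.
Proof. by move=> x0; rewrite -[leLHS]expR0 ler_expR. Qed.

(* The integrand below is the time derivative of w (r - u)^2 once the two
   evolution equations are used.  Subtracting the derivative of
     2 g w e e' - (p1 + vf + g s) w e^2 + 4 vf w r e^2 - (4/3) vf w e^3,
   which vanishes at both ends, leaves the quadratic form of the LMI. *)
Lemma lyapunov_integrand_le0 (a b dM vf gamma xi beta p0 p1 rm rM c0 : R)
    (r r1 r2 u u1 u2 : R -> R) :
  let s := xi * gamma^-1 in
  let w := fun y => c0 * expR (s * (y - a)) in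
  0 < vf -> 0 < gamma -> 0 < xi -> 0 < p0 -> 0 < c0 ->
  (forall rb, rm <= rb <= rM -> forall p q : R,
     (Psi11 vf gamma rm rM p0 p1 xi rb + 2 * xi * beta) * p ^+ 2
     + 2 * (p1 - 2 * vf * rb) * p * q
     + (- 2 + p0 * (dM ^+ 2 / (gamma * pi ^+ 2)) * expR (xi * gamma^-1 * dM))
       * q ^+ 2 <= 0) ->
  a <= b -> b - a <= dM ->
  primitive a b r r1 -> primitive a b r1 r2 ->
  primitive a b u u1 -> primitive a b u1 u2 ->
  (forall y, a <= y <= b -> rm <= r y <= rM) ->
  (forall y, a <= y <= b -> rm <= u y) ->
  u a = r a -> u b = r b ->
  let J := fun y =>
    (2 * xi * gamma^-1 * beta - s * (vf * (1 - r a))) * w y * (r y - u y) ^+ 2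
    + 2 * w y * (r y - u y) * ((gamma * r2 y - vf * (1 - 2 * r y) * r1 y)
        - (gamma * u2 y - vf * (1 - 2 * u y) * u1 y)) in
  mu.-integrable `[a, b] (EFin \o J) /\ \int[mu]_(y in `[a, b]) J y <= 0.
Proof.
move=> s w vf0 g0 xi0 p00 c00 lmi ab bad pr pr1 pu pu1 rI uI ua ub J.
have pw : primitive a b w (fun y => s * w y) by exact: primitive_exp_affine.
pose e y := r y - u y; pose e1 y := r1 y - u1 y.
have pe : primitive a b e e1 := primitiveB pr pu.
have pe1 := primitiveB pr1 pu1.
have pe2 := primitive_sqr ab pe.
have pwe2 := primitiveM ab pw pe2.
have pA1 := primitiveZ (2 * gamma) (primitiveM ab pw (primitiveM ab pe pe1)).
have pA2 := primitiveZ (- (p1 + vf + gamma * s)) pwe2.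
have pA3 := primitiveZ (4 * vf) (primitiveM ab pwe2 pr).
have pA4 := primitiveZ (- (4 / 3 * vf)) (primitiveM ab pwe2 pe).
have pA := primitiveD (primitiveD pA1 pA2) (primitiveD pA3 pA4).
set A := (fun x => _ + _) in pA; set A1 := (fun x => _ + _) in pA.
have ea : e a = 0 by rewrite /e ua subrr.
have eb : e b = 0 by rewrite /e ub subrr.
have ce := primitive_continuous ab pe.
have ce1 := primitive_continuous ab pe1.
have cw := primitive_continuous ab pw.
have cr := primitive_continuous ab pr.
have cu := primitive_continuous ab pu.
have cr1 := primitive_continuous ab pr1.
have cu1 := primitive_continuous ab pu1.
have ie : mu.-integrable `[a, b] (EFin \o (fun x => e x ^+ 2)).
  by apply: continuous_integrable_itv; exact: within_continuousM.
have ie1 : mu.-integrable `[a, b] (EFin \o (fun x => e1 x ^+ 2)).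
  by apply: continuous_integrable_itv; exact: within_continuousM.
pose D2 := dM ^+ 2 / pi ^+ 2.
pose E := expR (s * dM).
have E1 : 1 <= E.
  by rewrite one_le_expR// mulr_ge0// ?(le_trans _ bad) ?subr_ge0// mulr_ge0// ltW// invr_gt0.
have D20 : 0 <= D2 by rewrite divr_ge0// sqr_ge0.
(* Wirtinger's inequality carries no weight. Since [c0 <= w <= c0 E], bounding [w] above in front of
   [e^2] and below in front of [e1^2] costs the factor [E], which is the exponential in the lower
   right entry of the LMI. *)
pose C := p0 * c0 * E.
have C0 : 0 < C by rewrite !mulr_gt0// (lt_le_trans _ E1).
have key y : a <= y <= b -> J y <= A1 y + C * (e y ^+ 2 - D2 * e1 y ^+ 2).
  move=> yab; have /andP[ay yb] := yab.
  have wy0 : c0 <= w y.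
    rewrite /w ler_peMr ?(ltW c00)// one_le_expR// mulr_ge0 ?subr_ge0//.
    by rewrite /s mulr_ge0// ltW// invr_gt0.
  have wyE : w y <= c0 * E.
    rewrite /w ler_wpM2l ?(ltW c00)// ler_expR ler_wpM2l//.
      by rewrite /s mulr_ge0// ltW// invr_gt0.
    by rewrite (le_trans _ bad)// lerB.
  have w0 : 0 < w y by rewrite (lt_le_trans c00).
  (* The vector [(e, gamma e1)] matches the quadratic form multiplied by [gamma]. *)
  have := lmi _ (rI y yab) (e y) (gamma * e1 y).
  have -> : dM ^+ 2 / (gamma * pi ^+ 2) = D2 / gamma.
    by rewrite /D2 invfM mulrCA mulrC.
  rewrite -/s -/E => H.
  pose q11 := s * (p1 + gamma * s + 2 * beta
     + vf * (r a - 4 * r y + 4 / 3 * e y)).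
  have -> : J y = A1 y + w y * (q11 * e y ^+ 2
      + 2 * (p1 - 2 * vf * r y) * e y * e1 y - 2 * gamma * e1 y ^+ 2).
    rewrite /J /A1 /q11 /e /e1 /s.
    by field; rewrite gt_eqF.
  rewrite lerD2l.
  have H2 : q11 * e y ^+ 2 + 2 * (p1 - 2 * vf * r y) * e y * e1 y
      - 2 * gamma * e1 y ^+ 2 <= p0 * e y ^+ 2 - p0 * D2 * E * e1 y ^+ 2.
    rewrite -(ler_pM2l g0).
    have /andP[_ raM] : rm <= r a <= rM by apply: rI; rewrite lexx.
    have uy := uI y yab.
    (* From [r a <= rM] and [u >= rm]: [- 4 r + 4/3 e = - 8/3 r - 4/3 u <= - 8/3 r - 4/3 rm]. *)
    have q11le : gamma * q11 <= Psi11 vf gamma rm rM p0 p1 xi (r y)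
        + 2 * xi * beta + gamma * p0.
      have -> : gamma * q11 = xi * (p1 + xi + 2 * beta
          + vf * (r a - 4 * r y + 4 / 3 * e y)).
        by rewrite /q11 /s; field; rewrite gt_eqF.
      have -> : Psi11 vf gamma rm rM p0 p1 xi (r y) + 2 * xi * beta + gamma * p0
        = xi * (p1 + xi + 2 * beta + vf * (rM - 8 / 3 * r y - 4 / 3 * rm)).
        by rewrite /Psi11; field.
      rewrite ler_pM2l// lerD2l ler_pM2l// /e; lra.
    have H3 := ler_wpM2r (sqr_ge0 (e y)) q11le.
    set P11 := Psi11 _ _ _ _ _ _ _ _ in H H3.
    have H4 : (P11 + 2 * xi * beta) * e y ^+ 2 +
      2 * (p1 - 2 * vf * r y) * e y * (gamma * e1 y) - 2 * gamma ^+ 2 * e1 y ^+ 2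
      + gamma * (p0 * D2 * E * e1 y ^+ 2) <= 0.
      apply: le_trans H; rewrite le_eqVlt; apply/orP; left; apply/eqP.
      by field; rewrite gt_eqF.
    lra.
  apply: le_trans (ler_wpM2l (ltW w0) H2) _.
  have H5 : w y * (p0 * e y ^+ 2) <= c0 * E * (p0 * e y ^+ 2).
    by rewrite ler_wpM2r// mulr_ge0 ?sqr_ge0// ltW.
  have H6 : c0 * (p0 * D2 * E * e1 y ^+ 2) <= w y * (p0 * D2 * E * e1 y ^+ 2).
    apply: ler_wpM2r => //; apply: mulr_ge0; last exact: sqr_ge0.
    by apply: mulr_ge0; [apply: mulr_ge0 => //; exact: ltW|exact: expR_ge0].
  rewrite /C; lra.
have iq : mu.-integrable `[a, b] (EFin \o (fun y => C * (e y ^+ 2 - D2 * e1 y ^+ 2))).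
  by apply: integrableRZ => //; apply: integrableRB => //; exact: integrableRZ.
have iJ : mu.-integrable `[a, b] (EFin \o J).
  have [ir2 _] := pr1; have [iu2 _] := pu1.
  apply: integrableRD => //.
    apply: (@eq_integrableR _ _ _ mu _ (measurable_itv _) (fun y =>
      (2 * xi * gamma^-1 * beta - s * (vf * (1 - r a))) * (w y * e y ^+ 2))) => //.
      by move=> y _; rewrite mulrA.
    apply: integrableRZ => //; apply: continuous_integrable_itv.
    exact: (within_continuousM cw (within_continuousM ce ce)).
  have cwe : {within `[a, b], continuous (fun y => w y * e y)}.
    exact: within_continuousM.
  have i1 (k : R) (f : R -> R) : {within `[a, b], continuous f} ->
      mu.-integrable `[a, b] (EFin \o (fun y => k * ((w y * e y) * f y))).
    move=> cf; apply: integrableRZ => //; apply: continuous_integrable_itv.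
    exact: within_continuousM.
  have i2 (k : R) (f : R -> R) : mu.-integrable `[a, b] (EFin \o f) ->
      mu.-integrable `[a, b] (EFin \o (fun y => k * ((w y * e y) * f y))).
    by move=> fi; apply: integrableRZ => //; apply: primitiveM_bounded.
  have iD (f g : R -> R) : mu.-integrable `[a, b] (EFin \o f) ->
      mu.-integrable `[a, b] (EFin \o g) ->
      mu.-integrable `[a, b] (EFin \o (fun y => f y + g y)).
    exact: integrableRD.
  (* The second derivatives are merely integrable, so [J] is regrouped into terms with the
     continuous factor [w e]. *)
  have I := iD _ _
    (iD _ _ (i2 (2 * gamma) _ ir2) (i2 (- (2 * gamma)) _ iu2))
    (iD _ _
       (iD _ _ (i1 (- (2 * vf)) _ cr1) (i1 (2 * vf) _ cu1))
       (iD _ _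
         (i1 (4 * vf) _ (within_continuousM cr cr1))
         (i1 (- (4 * vf)) _ (within_continuousM cu cu1)))).
  apply: eq_integrableR I => // y _ /=.
  by rewrite /e; ring.
split => //.
have [iA1 AE] := pA.
apply: (@le_trans _ _ (\int[mu]_(y in `[a, b]) (A1 y + C * (e y ^+ 2 - D2 * e1 y ^+ 2)))).
  apply: le_Rintegral; [exact: measurable_itv|exact: iJ|exact: integrableRD|].
  by move=> y; rewrite /= in_itv; exact: key.
rewrite RintegralD// -AE// /A ea eb expr0n/= !(mul0r, mulr0, addr0) subrr add0r.
rewrite RintegralZl//; last by apply: integrableRB => //; exact: integrableRZ.
rewrite pmulr_rle0// RintegralB//; last exact: integrableRZ.
by rewrite RintegralZl// subr_le0; exact: wirtinger.
Qed.

End LyapunovSpatial.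

(** * The truncation inequality at a fixed time *)

Section Truncation.
Context {R : realType}.
Local Notation mu := (@lebesgue_measure R).

Definition pos (v : R) : R := Num.max 0 v.

Lemma pos_ge0 v : 0 <= pos v. Proof. by rewrite le_max lexx. Qed.

Lemma posE v : 0 <= v -> pos v = v.
Proof. by move=> v0; rewrite /pos; case: ltgtP v0. Qed.

Lemma pos0 v : v <= 0 -> pos v = 0.
Proof. by move=> v0; rewrite /pos; case: ltgtP v0. Qed.

Lemma continuous_pos : continuous pos.
Proof. by move=> v; apply: continuous_max; [exact: cvg_cst|exact: cvg_id]. Qed.

(** The kink of [pos] at 0 is flattened by [t 0 = 0]: there the Caratheodory slope of [T], cut to 0
    on the negative side, remains continuous. *)
Lemma is_derive_pos (T t : R -> R) (v : R) :
  (forall z, is_derive z (1:R) T (t z)) -> t 0 = 0 ->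
  is_derive v (1:R) (T \o pos) (t (pos v)).
Proof.
move=> dT t0; have [v0|v0|->] := ltgtP v 0.
- rewrite pos0 ?ltW// t0.
  have := is_derive_cst (T 0) v (1:R); apply: near_eq_is_derive.
  by near=> w => /=; rewrite pos0// ltW//; near: w; exact: lt_nbhsl.
- rewrite posE ?ltW//.
  have := dT v; apply: near_eq_is_derive.
  by near=> w => /=; rewrite posE// ltW//; near: w; exact: lt_nbhsr.
- rewrite pos0// t0.
  have /is_derive1_caratheodory [g [gE gc g0]] := dT 0.
  apply/is_derive1_caratheodory.
  exists (fun z => if 0 < z then g z else 0); split; last by rewrite ltxx.
    move=> z /=; rewrite (pos0 (lexx 0)) subr0.
    have [z0|z0] := ltP 0 z; first by rewrite posE ?ltW// gE subr0.
    by rewrite pos0// subrr mul0r.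
  rewrite /prop_for /continuous_at /= ltxx; apply/cvgrPdist_lt => e e0.
  have := gc; rewrite /prop_for /continuous_at g0 t0 => /cvgrPdist_lt /(_ e e0).
  apply: filterS => z; rewrite !sub0r !normrN.
  by case: ifP => // _ _; rewrite normr0.
Unshelve. all: by end_near. Qed.

(* The test function and two of its antiderivatives; theta is bounded, so that
   theta(u) u_t stays integrable, and theta'(0) = 0 makes theta o pos C^1. *)
Definition theta (z : R) := 1 - (1 + z) * expR (- z).
Definition Theta (z : R) := z + (2 + z) * expR (- z) - 2.
Definition zTheta (z : R) := z ^+ 2 / 2 + (z ^+ 2 + 3 * z + 3) * expR (- z) - 3.

Lemma is_derive_expRN (z : R) : is_derive z (1:R) (fun z => expR (- z)) (- expR (- z)).
Proof. by apply: is_derive_eq; rewrite mulrN1. Qed.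

Lemma is_derive_theta (z : R) : is_derive z (1:R) theta (z * expR (- z)).
Proof.
have d1 : is_derive z (1:R) (fun z : R => 1 + z) 1.
  by apply: is_derive_eq; ring.
apply: (is_derive_eq (is_deriveB (is_derive_cst (1:R) z (1:R))
  (is_deriveM d1 (is_derive_expRN z)))).
by rewrite /GRing.scale/=; ring.
Qed.

Lemma is_derive_Theta (z : R) : is_derive z (1:R) Theta (theta z).
Proof.
have d1 : is_derive z (1:R) (fun z : R => 2 + z) 1.
  by apply: is_derive_eq; ring.
apply: (is_derive_eq (is_deriveB (is_deriveD (is_derive_id z (1:R))
  (is_deriveM d1 (is_derive_expRN z))) (is_derive_cst (2:R) z (1:R)))).
by rewrite /GRing.scale/= /theta; ring.
Qed.

Lemma is_derive_zTheta (z : R) : is_derive z (1:R) zTheta (z * theta z).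
Proof.
have d1 : is_derive z (1:R) (fun z : R => z ^+ 2 / 2) z.
  by apply: is_derive_eq; rewrite /GRing.scale/=; field.
have d2 : is_derive z (1:R) (fun z : R => z ^+ 2 + 3 * z + 3) (2 * z + 3).
  by apply: is_derive_eq; rewrite /GRing.scale/=; ring.
apply: (is_derive_eq (is_deriveB (is_deriveD d1
  (is_deriveM d2 (is_derive_expRN z))) (is_derive_cst (3:R) z (1:R)))).
by rewrite /GRing.scale/= /theta; ring.
Qed.

Lemma theta0 : theta 0 = 0.
Proof. by rewrite /theta oppr0 expR0; ring. Qed.

Lemma Theta0 : Theta 0 = 0.
Proof. by rewrite /Theta oppr0 expR0; ring. Qed.

Lemma theta_gt0 z : 0 < z -> 0 < theta z.
Proof.
move=> z0; have [||c] := @MVT R theta (fun z => z * expR (- z)) 0 z z0.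
- by move=> x _; exact: is_derive_theta.
- by apply: derivable_within_continuous => x _; case: (is_derive_theta x).
rewrite in_itv/= theta0 !subr0 => /andP[c0 _] ->.
by rewrite !mulr_gt0// expR_gt0.
Qed.

Lemma theta_le1 z : 0 <= z -> theta z <= 1.
Proof.
by move=> z0; rewrite /theta gerBl mulr_ge0 ?expR_ge0// addr_ge0.
Qed.

Lemma Theta_gt0 z : 0 < z -> 0 < Theta z.
Proof.
move=> z0; have [||c] := @MVT R Theta theta 0 z z0.
- by move=> x _; exact: is_derive_Theta.
- by apply: derivable_within_continuous => x _; case: (is_derive_Theta x).
rewrite in_itv/= Theta0 !subr0 => /andP[c0 _] ->.
by rewrite !mulr_gt0// theta_gt0.
Qed.

Variables (k sg : R).
Hypothesis sg2 : sg ^+ 2 = 1.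

(** The sign [sg] treats both bounds at once: the excess vanishes when [v >= k] for [sg = 1], and
    when [v <= k] for [sg = -1]. *)
Definition excess (v : R) := pos (sg * (k - v)).

Lemma is_derive_excess (T t : R -> R) (v : R) :
  (forall z, is_derive z (1:R) T (t z)) -> t 0 = 0 ->
  is_derive v (1:R) (T \o excess) (- sg * t (excess v)).
Proof.
move=> dT t0.
have dz : is_derive v (1:R) (fun v => sg * (k - v)) (- sg).
  by apply: is_derive_eq; rewrite /GRing.scale/=; ring.
have dp := is_derive_pos (sg * (k - v)) dT t0.
have dc : is_derive v (1:R) (T \o excess) (t (excess v) * - sg).
  exact: (@is_derive1_comp R (T \o pos) (fun v => sg * (k - v)) v _ _ dp dz).
by apply: (is_derive_eq dc); rewrite mulrC.
Qed.

Lemma continuous_excess : continuous excess.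
Proof.
move=> v.
apply: (@continuous_comp R R R (fun v => sg * (k - v)) pos); last exact: continuous_pos.
by apply: cvgM; [exact: cvg_cst|apply: cvgB; [exact: cvg_cst|exact: cvg_id]].
Qed.

(** [J] is the time derivative of [Theta (excess u)] along the equation. The transport term is the
    exact derivative of [Q u], and integrating the diffusion by parts leaves
    [- gamma theta'(excess u) u1^2 <= 0]. The boundary terms vanish because the excess does at both
    ends. *)
Lemma truncation_integrand_le0 (a b vf gamma : R) (u u1 u2 : R -> R) :
  0 < gamma -> a <= b -> primitive a b u u1 -> primitive a b u1 u2 ->
  sg * (k - u a) <= 0 -> sg * (k - u b) <= 0 ->
  let J := fun y => - sg * theta (excess (u y))
    * (gamma * u2 y - vf * (1 - 2 * u y) * u1 y) in
  mu.-integrable `[a, b] (EFin \o J) /\ \int[mu]_(y in `[a, b]) J y <= 0.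
Proof.
move=> g0 ab pu pu1 ua ub J.
pose TH := theta \o excess.
have dTH v : is_derive v (1:R) TH (- sg * (excess v * expR (- excess v))).
  by apply: (is_derive_excess (t := fun z => z * expR (- z)) v is_derive_theta); rewrite mul0r.
(* Where the excess [z] is positive, [v = k - sg z], hence [1 - 2 v = (1 - 2 k) + 2 sg z]; the two
   summands are antiderivatives for the two parts. *)
pose Q v := - vf * ((1 - 2 * k) * Theta (excess v) + 2 * sg * zTheta (excess v)).
have dQ v : is_derive v (1:R) Q (sg * vf * (TH v * (1 - 2 * v))).
  have d1 := is_derive_excess v is_derive_Theta theta0.
  have d2 : is_derive v (1:R) (zTheta \o excess) (- sg * (excess v * theta (excess v))).
    by apply: (is_derive_excess (t := fun z => z * theta z) v is_derive_zTheta); rewrite mul0r.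
  apply: (is_derive_eq (is_deriveZ (- vf)
    (is_deriveD (is_deriveZ (1 - 2 * k) d1) (is_deriveZ (2 * sg) d2)))).
  rewrite /GRing.scale/= /TH /= /excess.
  have [z0|z0] := leP (sg * (k - v)) 0.
    by rewrite pos0// theta0; ring.
  rewrite posE ?ltW//; set th := theta _.
  have -> : 1 - 2 * v = 1 - 2 * k + 2 * (sg ^+ 2 * (k - v)) by rewrite sg2; ring.
  by ring.
have cTH : continuous TH by move=> v; exact: is_derive_continuous (dTH v).
have cdTH : continuous (fun v => - sg * (excess v * expR (- excess v))).
  move=> v; apply: cvgM; first exact: cvg_cst.
  apply: cvgM; first exact: continuous_excess.
  apply: (@continuous_comp R R R (fun v => - excess v) expR); last exact: continuous_expR.
  by apply: cvgN; exact: continuous_excess.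
have cdQ : continuous (fun v => sg * vf * (TH v * (1 - 2 * v))).
  move=> v; apply: cvgM; first exact: cvg_cst.
  apply: cvgM; first exact: cTH.
  apply: cvgB; first exact: cvg_cst.
  by apply: cvgM; [exact: cvg_cst|exact: cvg_id].
have pQ := primitive_comp ab dQ cdQ pu.
have pTH := primitive_comp ab dTH cdTH pu.
have pF := primitiveD pQ (primitiveZ (- sg * gamma) (primitiveM ab pTH pu1)).
have cu := primitive_continuous ab pu.
have cu1 := primitive_continuous ab pu1.
have cTHu : {within `[a, b], continuous (TH \o u)}.
  by move=> x; apply: (@continuous_comp (subspace `[a, b]) R R); [exact: cu|exact: cTH].
have [iu2 _] := pu1.
have ex0 v : sg * (k - v) <= 0 -> excess v = 0 by exact: pos0.
have i2 := primitiveM_bounded cTHu iu2.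
have [i1 _] := pQ.
have iJ : mu.-integrable `[a, b] (EFin \o J).
  apply: (@eq_integrableR _ _ _ mu _ (measurable_itv _) (fun y =>
    sg * vf * (TH (u y) * (1 - 2 * u y)) * u1 y
    + - sg * gamma * ((TH \o u) y * u2 y))).
    by move=> y _; rewrite /J /TH /=; ring.
  by apply: integrableRD => //; exact: integrableRZ.
split => //.
apply: (primitive_le0 ab pF) => //.
- by rewrite /= /Q /TH /= !ex0 ?theta0// !mul0r.
- move=> y yab; rewrite -subr_ge0 /J /TH /=.
  set z := excess _; set th := theta _; set E := expR _.
  have -> : sg * vf * (th * (1 - 2 * u y)) * u1 y + - sg * gamma *
      (- sg * (z * E) * u1 y * u1 y + th * u2 y)
      - (- sg * th * (gamma * u2 y - vf * (1 - 2 * u y) * u1 y))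
    = sg ^+ 2 * gamma * (z * E * u1 y ^+ 2) by ring.
  rewrite sg2 mul1r mulr_ge0 ?(ltW g0)// mulr_ge0 ?sqr_ge0// mulr_ge0 ?expR_ge0//.
  exact: pos_ge0.
Qed.

End Truncation.

Lemma integrable_cst d (T : measurableType d) (R : realType)
    (m : {measure set T -> \bar R}) (D : set T) (c : R) :
  measurable D -> (m D < +oo)%E -> m.-integrable D (EFin \o (fun=> c)).
Proof.
move=> mD fD; apply: measurable_bounded_integrable => //.
by exists `|c|; split => // x cx y _; exact: ltW.
Qed.

(** * Time integration along a horizontal slice of a moving domain *)

Section Slices.
Context {R : realType}.
Local Notation mu := (@lebesgue_measure R).
Implicit Types (a b c s t y S T : R).

Lemma Rintegral_itv0 a b (h : R -> R) : (forall t, a <= t <= b -> h t = 0) ->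
  \int[mu]_(t in `[a, b]) h t = 0.
Proof.
move=> h0; rewrite (@eq_Rintegral _ _ _ mu _ (cst 0)); last first.
  by move=> t; rewrite inE/= in_itv; exact: h0.
by rewrite Rintegral_cst ?mul0r.
Qed.

Lemma integral_primitive a b (h : R -> R) :
  mu.-integrable `[a, b] (EFin \o h) ->
  primitive a b (fun t => \int[mu]_(s in `[a, t]) h s) h.
Proof.
move=> ih; split => // p q ap pq qb.
rewrite (@Rintegral_itv_split R a p q)//; first by rewrite addrC addKr.
exact: integrable_itvS ih.
Qed.

(** After [t0] the slice can end only by being overtaken by [l], at a time [b]. The zero extension
    of [G] has no jump there, since [lat] makes [G] small at times arbitrarily close to [b], while
    the integral of [h] is continuous. *)
Lemma slice_right (t0 T : R) (P : R -> Prop) (l G h : R -> R) (y : R) :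
  t0 <= T ->
  (forall s t, t0 <= s -> s <= t -> t <= T -> l s <= l t) ->
  {within `[t0, T], continuous l} ->
  (forall t, t0 <= t <= T -> P t <-> l t < y) ->
  mu.-integrable `[t0, T] (EFin \o h) ->
  (forall t, t0 <= t <= T -> ~ P t -> h t = 0) ->
  (forall p q, t0 <= p -> p <= q -> q <= T ->
     (forall t, p <= t <= q -> P t) ->
     G q - G p = \int[mu]_(t in `[p, q]) h t) ->
  (forall a b, t0 <= a -> a < b -> b <= T -> ~ P b ->
     (forall t, a < t < b -> P t) ->
     forall e : R, 0 < e -> exists2 t, a < t < b & `|G t| <= e) ->
  P t0 ->
  (if `[< P T >] then G T else 0) - G t0 = \int[mu]_(t in `[t0, T]) h t.
Proof.
move=> t0T lm lc PE ih h0 ftc lat Pt0.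
case: asboolP => [PT|nPT].
  apply: ftc => // t /andP[t0t tT]; apply/PE; first by rewrite t0t.
  by apply: le_lt_trans (lm _ _ t0t tT (lexx _)) _; apply/PE => //; rewrite t0T lexx.
pose A := [set t | t0 <= t <= T /\ l t < y].
have At0 : A t0 by split; [rewrite lexx|apply/PE => //; rewrite lexx].
have Aub : has_ubound A by exists T => x -[/andP[]].
have supA : has_sup A by split => //; exists t0.
set b := sup A.
have t0b : t0 <= b by exact: ub_le_sup.
have bT : b <= T by apply: ge_sup; [exists t0|move=> x [/andP[]]].
have Pb t : t0 <= t -> t < b -> P t.
  move=> t0t tb; have bt0 : 0 < b - t by rewrite subr_gt0.
  have [t' [/andP[t0t' t'T] lt'] tt'] := sup_adherent bt0 supA.
  move: tt'; rewrite -/b opprB subrKC => tt'.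
  apply/PE; first by rewrite t0t (le_trans (ltW tt')).
  by apply: le_lt_trans lt'; apply: lm => //; exact: ltW.
have nPb : ~ P b.
  move=> /PE; rewrite t0b bT => /(_ isT) lb.
  have bT' : b < T.
    rewrite lt_neqAle bT andbT; apply/eqP => E; apply: nPT; apply/PE.
      by rewrite t0T lexx.
    by rewrite -E.
  have [||d d0 dP] := within_itv_dist _ lc (x := b) (e := y - l b).
  - by rewrite t0b bT.
  - by rewrite subr_gt0.
  pose t := Num.min T (b + d / 2).
  have bt : b < t by rewrite lt_min bT' ltrDl divr_gt0.
  have : t <= b.
    apply: ub_le_sup => //; split.
      by rewrite (le_trans t0b (ltW bt)) ge_min lexx.
    have := dP t; rewrite (le_trans t0b (ltW bt)) ge_min lexx => /(_ isT).
    have -> : `|b - t| < d.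
      rewrite ltr0_norm ?subr_lt0// opprB ltrBlDr gt_min; apply/orP; right; lra.
    by move=> /(_ isT); rewrite ltr_norml => /andP[? _]; lra.
  by rewrite leNgt bt.
have t0b' : t0 < b.
  by rewrite lt_neqAle t0b andbT; apply/eqP => E; apply: nPb; rewrite -E.
have hz t : b <= t <= T -> h t = 0.
  move=> /andP[bt tT]; apply: h0; first by rewrite (le_trans t0b bt).
  move=> /PE; rewrite (le_trans t0b bt) tT => /(_ isT) lt.
  apply: nPb; apply/PE; first by rewrite t0b.
  by apply: le_lt_trans lt; exact: lm.
rewrite (Rintegral_itv_split t0b bT ih) (Rintegral_itv0 hz) addr0 sub0r.
have ihb : mu.-integrable `[t0, b] (EFin \o h) by exact: integrable_itvS ih.
pose H t := \int[mu]_(s in `[t0, t]) h s.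
have pH : primitive t0 b H h := integral_primitive ihb.
have cH := primitive_continuous t0b pH.
apply/esym/eqP; rewrite -subr_eq0 opprK -normr_le0; apply/ler_addgt0Pr => e e0.
rewrite add0r.
have [||d d0 dP] := within_itv_dist _ cH (x := b) (e := e / 2).
- by rewrite t0b lexx.
- by rewrite divr_gt0.
(* Within [d] of [b] the integral has come to within [e / 2] of its final value, so one time at
   which [G] is small suffices. *)
have [||||||t tI Gt] := lat (Num.max t0 (b - d)) b _ _ _ _ _ (e / 2).
- by rewrite le_max lexx.
- by rewrite gt_max t0b' ltrBlDr ltrDl.
- by [].
- by [].
- move=> t; rewrite gt_max => /andP[/andP[t0t _] tb]; exact/Pb/tb/ltW.
- by rewrite divr_gt0.
move: tI; rewrite gt_max => /andP[/andP[t0t bdt] tb].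
have := ftc t0 t (lexx _) (ltW t0t) (le_trans (ltW tb) bT).
have PP s : t0 <= s <= t -> P s by move=> /andP[? st]; apply: Pb => //; exact: le_lt_trans tb.
move=> /(_ PP) GE.
have := dP t; rewrite (ltW t0t) (ltW tb) => /(_ isT).
have -> : `|b - t| < d by rewrite gtr0_norm ?subr_gt0//; lra.
move=> /(_ isT); rewrite /H -GE => HH.
have -> : \int[mu]_(s in `[t0, b]) h s + G t0 =
  (\int[mu]_(s in `[t0, b]) h s - (G t - G t0)) + G t by ring.
by apply: le_trans (ler_normD _ _) _; rewrite [leRHS]splitr lerD// ltW.
Qed.

(** The mirror image in time: going back from [t0], the slice can end only where [r] has not yet
    passed [y]. *)
Lemma slice_left (S t0 : R) (P : R -> Prop) (r G h : R -> R) (y : R) :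
  S <= t0 ->
  (forall s t, S <= s -> s <= t -> t <= t0 -> r s <= r t) ->
  {within `[S, t0], continuous r} ->
  (forall t, S <= t <= t0 -> P t <-> y < r t) ->
  mu.-integrable `[S, t0] (EFin \o h) ->
  (forall t, S <= t <= t0 -> ~ P t -> h t = 0) ->
  (forall p q, S <= p -> p <= q -> q <= t0 ->
     (forall t, p <= t <= q -> P t) ->
     G q - G p = \int[mu]_(t in `[p, q]) h t) ->
  (forall a b, S <= a -> a < b -> b <= t0 -> ~ P a ->
     (forall t, a < t < b -> P t) ->
     forall e : R, 0 < e -> exists2 t, a < t < b & `|G t| <= e) ->
  P t0 ->
  G t0 - (if `[< P S >] then G S else 0) = \int[mu]_(t in `[S, t0]) h t.
Proof.
move=> St0 rm rc PE ih h0 ftc lat Pt0.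
case: asboolP => [PS|nPS].
  apply: ftc => // t /andP[St tt0]; apply/PE; first by rewrite St.
  by apply: lt_le_trans (rm _ _ (lexx _) St tt0); apply/PE => //; rewrite lexx.
pose A := [set t | S <= t <= t0 /\ y < r t].
have At0 : A t0 by split; [rewrite lexx andbT|apply/PE => //; rewrite lexx andbT].
have Alb : has_lbound A by exists S => x -[/andP[]].
have infA : has_inf A by split => //; exists t0.
set a := inf A.
have at0 : a <= t0 by exact: ge_inf.
have Sa : S <= a by apply: lb_le_inf; [exists t0|move=> x [/andP[]]].
have Pa t : a < t -> t <= t0 -> P t.
  move=> at_ tt0; have ta0 : 0 < t - a by rewrite subr_gt0.
  have [t' [/andP[St' t't0] lt'] tt'] := inf_adherent ta0 infA.
  move: tt'; rewrite -/a subrKC => tt'.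
  apply/PE; first by rewrite tt0 (le_trans St' (ltW tt')).
  by apply: lt_le_trans lt' _; apply: rm => //; exact: ltW.
have nPa : ~ P a.
  move=> /PE; rewrite at0 Sa => /(_ isT) lb.
  have Sa' : S < a.
    rewrite lt_neqAle Sa andbT; apply/eqP => E; apply: nPS; apply/PE.
      by rewrite St0 lexx.
    by rewrite E.
  have [||d d0 dP] := within_itv_dist _ rc (x := a) (e := r a - y).
  - by rewrite at0 Sa.
  - by rewrite subr_gt0.
  pose t := Num.max S (a - d / 2).
  have ta : t < a by rewrite gt_max Sa' ltrBlDr ltrDl divr_gt0.
  have : a <= t.
    apply: ge_inf => //; split.
      by rewrite le_max lexx (le_trans (ltW ta) at0).
    have := dP t; rewrite le_max lexx (le_trans (ltW ta) at0) => /(_ isT).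
    have -> : `|a - t| < d.
      rewrite gtr0_norm ?subr_gt0// ltrBlDr -ltrBlDl lt_max; apply/orP; right; lra.
    by move=> /(_ isT); rewrite ltr_norml => /andP[_ ?]; lra.
  by rewrite leNgt ta.
have at0' : a < t0.
  by rewrite lt_neqAle at0 andbT; apply/eqP => E; apply: nPa; rewrite E.
have hz t : S <= t <= a -> h t = 0.
  move=> /andP[St ta]; apply: h0; first by rewrite St (le_trans ta at0).
  move=> /PE; rewrite (le_trans ta at0) St => /(_ isT) lt.
  apply: nPa; apply/PE; first by rewrite Sa.
  by apply: lt_le_trans lt _; exact: rm.
rewrite (Rintegral_itv_split Sa at0 ih) (Rintegral_itv0 hz) add0r subr0.
have iha : mu.-integrable `[a, t0] (EFin \o h) by exact: integrable_itvS ih.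
pose H t := \int[mu]_(s in `[a, t]) h s.
have pH : primitive a t0 H h := integral_primitive iha.
have cH := primitive_continuous at0 pH.
apply/esym/eqP; rewrite -subr_eq0 -normr_le0; apply/ler_addgt0Pr => e e0.
rewrite add0r.
have [||d d0 dP] := within_itv_dist _ cH (x := a) (e := e / 2).
- by rewrite at0 lexx.
- by rewrite divr_gt0.
have [||||||t tI Gt] := lat a (Num.min t0 (a + d)) _ _ _ _ _ (e / 2).
- by [].
- by rewrite lt_min at0' ltrDl.
- by rewrite ge_min lexx.
- by [].
- move=> t; rewrite lt_min => /andP[at_ /andP[tt0 _]]; exact/Pa/ltW.
- by rewrite divr_gt0.
move: tI; rewrite lt_min => /andP[at_ /andP[tt0 tad]].
have := ftc t t0 (le_trans Sa (ltW at_)) (ltW tt0) (lexx _).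
have PP s : t <= s <= t0 -> P s by move=> /andP[ts ?]; apply: Pa => //; exact: lt_le_trans ts.
move=> /(_ PP) GE.
have := dP t; rewrite (ltW tt0) (ltW at_) => /(_ isT).
have -> : `|a - t| < d by rewrite ltr0_norm ?subr_lt0//; lra.
move=> /(_ isT); rewrite /H set_itv1 Rintegral_set1 sub0r normrN => HH.
rewrite (Rintegral_itv_split (ltW at_) (ltW tt0) iha) -GE.
have -> : \int[mu]_(s in `[a, t]) h s + (G t0 - G t) - G t0 =
  \int[mu]_(s in `[a, t]) h s - G t by ring.
by apply: le_trans (ler_normB _ _) _; rewrite [leRHS]splitr lerD// ltW.
Qed.

(* The slice is an interval because both boundaries are nondecreasing. *)
Lemma slice_increment (S T : R) (l r G h : R -> R) (y : R) :
  let P := fun t => l t < y < r t in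
  S <= T ->
  (forall s t, S <= s -> s <= t -> t <= T -> l s <= l t) ->
  (forall s t, S <= s -> s <= t -> t <= T -> r s <= r t) ->
  {within `[S, T], continuous l} -> {within `[S, T], continuous r} ->
  mu.-integrable `[S, T] (EFin \o h) ->
  (forall t, S <= t <= T -> ~~ P t -> h t = 0) ->
  (forall p q, S <= p -> p <= q -> q <= T ->
     (forall t, p <= t <= q -> P t) ->
     G q - G p = \int[mu]_(t in `[p, q]) h t) ->
  (forall a b, S <= a -> a < b -> b <= T -> r a <= y ->
     (forall t, a < t < b -> P t) ->
     forall e : R, 0 < e -> exists2 t, a < t < b & `|G t| <= e) ->
  (forall a b, S <= a -> a < b -> b <= T -> y <= l b ->
     (forall t, a < t < b -> P t) ->
     forall e : R, 0 < e -> exists2 t, a < t < b & `|G t| <= e) ->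
  (if P T then G T else 0) - (if P S then G S else 0)
    = \int[mu]_(t in `[S, T]) h t.
Proof.
move=> P ST lm rm lc rc ih h0 ftc latl latr.
have [[t0 /andP[St0 t0T] Pt0]|noP] := pselect (exists2 t, S <= t <= T & P t); last first.
  have nP t : S <= t <= T -> ~~ P t by move=> tI; apply/negP => Pt; apply: noP; exists t.
  rewrite (negbTE (nP T _)) ?ST ?lexx// (negbTE (nP S _)) ?lexx// subrr.
  by rewrite Rintegral_itv0// => t tI; apply: h0 => //; exact: nP.
rewrite (Rintegral_itv_split St0 t0T ih).
have /andP[lt0 rt0] := Pt0.
have <- : G t0 - (if P S then G S else 0) = \int[mu]_(t in `[S, t0]) h t.
  have := @slice_left S t0 P r G h y St0; rewrite asboolb; apply => //.
  - by move=> s t Ss st tt0; apply: rm => //; exact: le_trans t0T.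
  - by apply: continuous_subspaceW rc; exact: subset_itvl.
  - move=> t /andP[St tt0]; split => [/andP[]//|yt]; rewrite /P yt andbT.
    by apply: le_lt_trans lt0; exact: lm.
  - exact: integrable_itvS ih.
  - move=> t /andP[St tt0] /negP; apply: h0; by rewrite St (le_trans tt0).
  - move=> p q Sp pq qt0; apply: ftc => //; exact: le_trans t0T.
  - move=> a b Sa ab bt0 nPa Pab; apply: latl => //; first exact: le_trans t0T.
    rewrite leNgt; apply/negP => yr; apply: nPa; rewrite /P yr andbT.
    by apply: le_lt_trans lt0; apply: lm => //; exact: le_trans (ltW ab) bt0.
have <- : (if P T then G T else 0) - G t0 = \int[mu]_(t in `[t0, T]) h t.
  have := @slice_right t0 T P l G h y t0T; rewrite asboolb; apply => //.
  - by move=> s t t0s; apply: lm; exact: le_trans t0s.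
  - by apply: continuous_subspaceW lc; exact: subset_itvr.
  - move=> t /andP[t0t tT]; split => [/andP[]//|yt]; rewrite /P yt/=.
    by apply: lt_le_trans rt0 _; exact: rm.
  - exact: integrable_itvS ih.
  - move=> t /andP[t0t tT] /negP; apply: h0; by rewrite tT (le_trans St0).
  - move=> p q t0p pq qT; apply: ftc => //; exact: le_trans t0p.
  - move=> a b t0a ab bT nPb Pab; apply: latr => //; first exact: le_trans t0a.
    rewrite leNgt; apply/negP => yr; apply: nPb; rewrite /P yr/=.
    by apply: lt_le_trans rt0 _; apply: rm => //; exact: le_trans t0a (ltW ab).
by ring.
Qed.

Lemma le_Rintegral_cst (p q c : R) (X : R -> R) : p < q ->
  mu.-integrable `[p, q] (EFin \o X) ->
  (forall t, p < t < q -> c / (q - p) <= X t) ->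
  c <= \int[mu]_(t in `[p, q]) X t.
Proof.
move=> pq iX Xc.
have iX' : mu.-integrable `]p, q[ (EFin \o X).
  by apply: integrableS iX => //; exact: subset_itv_oo_cc.
have -> : \int[mu]_(t in `[p, q]) X t = \int[mu]_(t in `]p, q[) X t.
  rewrite -Rintegral_itv_obnd_cbnd ?Rintegral_itv_bndo_bndc//.
  by apply: integrableS iX => //; exact: subset_itv_oc_cc.
have mI : (mu `]p, q[ = (q - p)%:E)%E.
  by rewrite lebesgue_measure_itv/= lte_fin pq -EFinB.
have -> : c = \int[mu]_(t in `]p, q[) (c / (q - p)).
  by rewrite Rintegral_cst//= mI/= divfK// subr_eq0 gt_eqF.
apply: le_Rintegral => //.
apply: integrable_cst => //.
by have : (mu `]p, q[ < +oo)%E by rewrite mI ltry.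
Qed.

(* [(t - a)^-1] is not integrable at [a]: an integrable X leaves room for
   (t - a) X(t) to be small along a sequence. *)
Lemma small_near_left (a b K : R) (X d : R -> R) : a < b -> 0 < K ->
  mu.-integrable `[a, b] (EFin \o X) ->
  (forall t, a < t < b -> 0 <= d t) ->
  (forall t, a < t < b -> d t ^+ 2 <= K * (t - a) * X t) ->
  forall e : R, 0 < e -> exists2 t, a < t < b & d t <= e.
Proof.
move=> ab K0 iX d0 dX e e0; apply: contrapT => nex.
have dgt t : a < t < b -> e < d t.
  by move=> tab; rewrite ltNge; apply/negP => dt; apply: nex; exists t.
have cH := primitive_continuous (ltW ab) (integral_primitive iX).
have c0 : 0 < e ^+ 2 / K by rewrite divr_gt0// exprn_gt0.
(* If [d > e] throughout, then [X t >= (e^2 / K) / (q - a)] on []a, q[], so the integral of [X] over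
   [[a, q]] is at least [e^2 / K] however close [q] is to [a]. *)
have [|del del0 dP] := within_itv_dist _ cH (x := a) c0.
  by rewrite lexx ltW.
pose q := Num.min b (a + del / 2).
have aq : a < q by rewrite lt_min ab ltrDl divr_gt0.
have qb : q <= b by rewrite ge_min lexx.
have := dP q; rewrite (ltW aq) qb => /(_ isT).
have -> : `|a - q| < del.
  rewrite ltr0_norm ?subr_lt0// opprB ltrBlDr gt_min; apply/orP; right; lra.
move=> /(_ isT); rewrite set_itv1 Rintegral_set1 sub0r normrN ltNge => /negP; apply.
apply: le_trans (ler_norm _); apply: le_Rintegral_cst => //.
  exact: integrable_itvS iX.
move=> t /andP[at_ tq].
have tab : a < t < b by rewrite at_ (lt_le_trans tq).
have ta0 : 0 < K * (t - a) by rewrite mulr_gt0// subr_gt0.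
have H : e ^+ 2 <= K * (t - a) * X t.
  apply: le_trans (dX t tab); rewrite lerXn2r ?nnegrE ?(ltW e0) ?d0//.
  exact/ltW/dgt.
have X0 : 0 < X t.
  by rewrite -(pmulr_rgt0 _ ta0) (lt_le_trans _ H)// exprn_gt0.
rewrite ler_pdivrMr ?subr_gt0// ler_pdivrMr//.
apply: le_trans H _; rewrite mulrAC [leRHS]mulrC mulrA.
by rewrite ler_pM2l ?mulr_gt0// lerB// ltW.
Qed.

Lemma small_near_right (a b K : R) (X d : R -> R) : a < b -> 0 < K ->
  mu.-integrable `[a, b] (EFin \o X) ->
  (forall t, a < t < b -> 0 <= d t) ->
  (forall t, a < t < b -> d t ^+ 2 <= K * (b - t) * X t) ->
  forall e : R, 0 < e -> exists2 t, a < t < b & d t <= e.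
Proof.
move=> ab K0 iX d0 dX e e0; apply: contrapT => nex.
have dgt t : a < t < b -> e < d t.
  by move=> tab; rewrite ltNge; apply/negP => dt; apply: nex; exists t.
have pH := integral_primitive iX.
have cH := primitive_continuous (ltW ab) pH.
have c0 : 0 < e ^+ 2 / K by rewrite divr_gt0// exprn_gt0.
have [|del del0 dP] := within_itv_dist _ cH (x := b) c0.
  by rewrite lexx ltW.
pose p := Num.max a (b - del / 2).
have pb : p < b by rewrite gt_max ab ltrBlDr ltrDl divr_gt0.
have ap : a <= p by rewrite le_max lexx.
have := dP p; rewrite (ltW pb) ap => /(_ isT).
have -> : `|b - p| < del.
  rewrite gtr0_norm ?subr_gt0// ltrBlDr -ltrBlDl lt_max; apply/orP; right; lra.
move=> /(_ isT); have [_ HE] := pH; rewrite HE ?(ltW pb)// ltNge => /negP; apply.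
apply: le_trans (ler_norm _); apply: le_Rintegral_cst => //.
  exact: integrable_itvS iX.
move=> t /andP[pt tb].
have tab : a < t < b by rewrite tb (le_lt_trans ap).
have ta0 : 0 < K * (b - t) by rewrite mulr_gt0// subr_gt0.
have H : e ^+ 2 <= K * (b - t) * X t.
  apply: le_trans (dX t tab); rewrite lerXn2r ?nnegrE ?(ltW e0) ?d0//.
  exact/ltW/dgt.
have X0 : 0 < X t.
  by rewrite -(pmulr_rgt0 _ ta0) (lt_le_trans _ H)// exprn_gt0.
rewrite ler_pdivrMr ?subr_gt0// ler_pdivrMr//.
apply: le_trans H _; rewrite mulrAC [leRHS]mulrC mulrA.
by rewrite ler_pM2l ?mulr_gt0// lerB// ltW.
Qed.

Lemma sqr_Rintegral_le (p q : R) (f : R -> R) : p <= q ->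
  mu.-integrable `[p, q] (EFin \o f) ->
  mu.-integrable `[p, q] (EFin \o (fun x => f x ^+ 2)) ->
  (\int[mu]_(x in `[p, q]) f x) ^+ 2
    <= (q - p) * \int[mu]_(x in `[p, q]) f x ^+ 2.
Proof.
rewrite le_eqVlt => /predU1P[->|pq] fi f2i.
  by rewrite set_itv1 !Rintegral_set1 expr0n mulr0.
set I := \int[mu]_(x in _) f x; set J := \int[mu]_(x in _) f x ^+ 2.
pose L := q - p; have L0 : 0 < L by rewrite subr_gt0.
(* The mean of [f]: the integral of [(f - c)^2] being nonnegative is the Cauchy-Schwarz inequality
   against the constant 1. *)
pose c := I / L.
have mI : (mu `[p, q] = L%:E)%E.
  by rewrite lebesgue_measure_itv/= lte_fin pq -EFinB.
have ic : mu.-integrable `[p, q] (EFin \o (fun=> c ^+ 2)).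
  apply: integrable_cst => //.
  by have : (mu `[p, q] < +oo)%E by rewrite mI ltry.
have icf : mu.-integrable `[p, q] (EFin \o (fun x => 2 * c * f x)).
  exact: integrableRZ.
have : 0 <= \int[mu]_(x in `[p, q]) (f x ^+ 2 - 2 * c * f x + c ^+ 2).
  apply: Rintegral_ge0 => x _.
  by have := sqr_ge0 (f x - c); rewrite sqrrB; lra.
rewrite RintegralD//; last exact: integrableRB.
rewrite RintegralB// RintegralZl// Rintegral_cst//= mI/= -/I -/J.
have -> : J - 2 * c * I + c ^+ 2 * L = J - I ^+ 2 / L.
  by rewrite /c; field; rewrite gt_eqF.
by rewrite subr_ge0 ler_pdivrMr// mulrC.
Qed.

End Slices.

#[global] Instance ae_lebesgue_filter (R : realType) :
  Filter (nbhs (almost_everywhere (@lebesgue_measure R))) :=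
  ae_filter_ringOfSetsType _.

Lemma integrable_fubini_G d1 d2 (T1 : measurableType d1)
    (T2 : measurableType d2) (R : realType)
    (m1 : {sigma_finite_measure set T1 -> \bar R})
    (m2 : {sigma_finite_measure set T2 -> \bar R}) (f : T1 * T2 -> \bar R) :
  (m1 \x m2)%E.-integrable setT f -> m2.-integrable setT (fubini_G m1 f).
Proof.
move=> fi; have mf := measurable_int _ fi.
apply/integrableP; split; first exact: measurable_fubini_G fi.
apply: le_lt_trans ((integrable21ltyP _ _ mf).1 fi).
apply: ge0_le_integral => //.
- by apply: measurableT_comp => //; exact: measurable_fubini_G fi.
- apply: (measurable_fun_fubini_tonelli_G (abse \o f)).
    exact: measurableT_comp.
  by move=> x; exact: abse_ge0.
- by move=> y _; apply: le_abse_integral => //; exact: measurableT_comp.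
Qed.

(** * The energy inequality, Fubini and measurability in the plane *)

Section Energy.
Context {R : realType}.
Local Notation mu := (@lebesgue_measure R).
Local Notation mu2 := (mu \x mu)%E.

Lemma integral_le0_ae (F : R -> \bar R) : mu.-integrable setT F ->
  {ae mu, forall t, (F t <= 0)%E} -> (\int[mu]_t F t <= 0)%E.
Proof.
move=> iF F0; have mF := measurable_int mu iF.
have E : ae_eq mu setT F (fun t => Order.min (F t) 0%E).
  by apply: filterS F0 => t Ft _; rewrite min_l.
have -> : (\int[mu]_t F t = \int[mu]_t Order.min (F t) 0)%E.
  by apply: ae_eq_integral => //; exact: measurable_mine.
rewrite -[leRHS](integral0 mu setT).
apply: le_integral => //.
- apply: le_integrable iF => //; first exact: measurable_mine.
  move=> t _; rewrite /Order.min; case: ifPn => // _.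
  by rewrite abse0 abse_ge0.
- exact: integrable0.
- by move=> t _; rewrite ge_min lexx orbT.
Qed.

Lemma Rintegral_setT_patch (D : set R) (h g : R -> R) : measurable D ->
  (forall x, D x -> h x = g x) -> (forall x, ~ D x -> h x = 0) ->
  \int[mu]_x h x = \int[mu]_(x in D) g x.
Proof.
move=> mD hg h0; rewrite [RHS]Rintegral_mkcond.
apply: eq_Rintegral => x _; rewrite patchE.
by case: ifPn => [/set_mem/hg //|/negP xD]; apply: h0 => Dx; apply: xD; rewrite inE.
Qed.

(** Common to both estimates: [G] is a density and [g] its time derivative. Only the integral of [g]
    over almost every time section has a sign, so the slice identities are integrated in [y] before
    the order of integration is exchanged. Integrability is asked at time [S] and transported to [T]
    by the identity. *)
Lemma energy_le (S T : R) (l r : R -> R) (G g : R -> R -> R) :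
  let hh := fun p : R * R =>
    if (S < p.1 <= T) && (l p.1 < p.2 < r p.1) then g p.1 p.2 else 0 in
  let Gz := fun t y => if l t < y < r t then G t y else 0 in
  S <= T ->
  (forall s t, S <= s -> s <= t -> t <= T -> l s <= l t) ->
  (forall s t, S <= s -> s <= t -> t <= T -> r s <= r t) ->
  {within `[S, T], continuous l} -> {within `[S, T], continuous r} ->
  mu2.-integrable setT (EFin \o hh) ->
  {ae mu, forall y,
    [/\ forall p q, S <= p -> p <= q -> q <= T ->
          (forall t, p <= t <= q -> l t < y < r t) ->
          G q y - G p y = \int[mu]_(t in `[p, q]) hh (t, y),
        forall a b, S <= a -> a < b -> b <= T -> r a <= y ->
          (forall t, a < t < b -> l t < y < r t) ->
          forall e : R, 0 < e -> exists2 t, a < t < b & `|G t y| <= e &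
        forall a b, S <= a -> a < b -> b <= T -> y <= l b ->
          (forall t, a < t < b -> l t < y < r t) ->
          forall e : R, 0 < e -> exists2 t, a < t < b & `|G t y| <= e]} ->
  {ae mu, forall t, S < t -> t <= T ->
    \int[mu]_(y in `]l t, r t[) g t y <= 0} ->
  mu.-integrable setT (EFin \o Gz S) -> measurable_fun setT (Gz T) ->
  (\int[mu]_y (Gz T y)%:E <= \int[mu]_y (Gz S y)%:E)%E.
Proof.
move=> hh Gz ST lm rm lc rc ih slices inner iS mT.
pose D y := (\int[mu]_t (hh (t, y))%:E)%E.
have iD : mu.-integrable setT D.
  rewrite (_ : D = fubini_G mu (EFin \o hh))//; exact: integrable_fubini_G.
have GE : ae_eq mu setT (EFin \o Gz T) (fun y => (Gz S y)%:E + D y)%E.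
  have ihy := ae_integrable2 ih.
  apply: filterS2 slices ihy => y [ftc latl latr] ihy _.
  have iST : mu.-integrable `[S, T] (EFin \o (fun t => hh (t, y))).
    exact: integrableS ihy.
  have := @slice_increment R S T l r (G^~ y) (fun t => hh (t, y)) y ST lm rm lc rc iST _ ftc latl latr.
  have h0 t : S <= t <= T -> ~~ (l t < y < r t) -> hh (t, y) = 0.
    by move=> _ nP; rewrite /hh/= (negbTE nP) andbF.
  move=> /(_ h0) H; rewrite /comp.
  have -> : D y = (\int[mu]_(t in `[S, T]) hh (t, y))%:E.
    rewrite -(@Rintegral_setT_patch `[S, T] (fun t => hh (t, y)))//.
      by rewrite /Rintegral fineK//; exact: integrable_fin_num.
    move=> t; rewrite /= in_itv/= => /negP tST; rewrite /hh/=.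
    case: ifPn => // /andP[/andP[St tT] _]; move: tST.
    by rewrite (ltW St) tT.
  by rewrite -EFinD -H /Gz addrC subrK.
have mG : measurable_fun setT (EFin \o Gz T) by exact/measurable_EFinP.
have iGD : mu.-integrable setT (fun y => (Gz S y)%:E + D y)%E.
  exact: integrableD iS iD.
have -> : (\int[mu]_y (Gz T y)%:E = \int[mu]_y ((Gz S y)%:E + D y))%E.
  by apply: ae_eq_integral => //; exact: measurable_int iGD.
rewrite integralD//; rewrite -[leRHS]adde0; apply: leeD => //.
rewrite (_ : \int[mu]_y D y = \int[mu]_t \int[mu]_y (hh (t, y))%:E)%E; last first.
  by rewrite /D -(Fubini ih).
have iF : mu.-integrable setT (fun t => \int[mu]_y (hh (t, y))%:E)%E.
  have := integrable_fubini_F ih; exact.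
apply: integral_le0_ae => //.
have ihx := ae_integrable1 ih.
apply: filterS2 inner ihx => t inn iht.
have -> : (\int[mu]_y (hh (t, y))%:E)%E = (\int[mu]_y hh (t, y))%:E.
  by rewrite /Rintegral fineK//; exact: integrable_fin_num.
rewrite lee_fin.
have [/andP[St tT]|nST] := boolP (S < t <= T); last first.
  rewrite (@Rintegral_setT_patch set0 _ (cst 0))//.
    by rewrite Rintegral_set0.
  by move=> y _; rewrite /hh/= (negbTE nST).
rewrite (@Rintegral_setT_patch `]l t, r t[ _ (g t))//.
- exact: inn.
- by move=> y; rewrite /= in_itv/= => yI; rewrite /hh/= St tT yI.
- by move=> y; rewrite /= in_itv/= => /negP/negbTE yI; rewrite /hh/= yI andbF.
Qed.

(** The measure of a null set of the plane is the integral of the measures of its sections, which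
    are therefore almost all null. *)
Lemma ae_section (P : R -> R -> Prop) :
  {ae mu2, forall p, P p.1 p.2} -> {ae mu, forall t, {ae mu, forall y, P t y}}.
Proof.
move=> [N [mN N0 PN]].
have mx : measurable_fun setT (fun t => mu (xsection N t)).
  exact: measurable_fun_xsection.
have H := ae_eq_integral_abs mu measurableT mx.
have : (\int[mu]_t `|mu (xsection N t)| = 0)%E.
  rewrite -[RHS]N0; apply: eq_integral => t _; rewrite gee0_abs//.
move=> /H; apply: filterS => t /(_ I) Nt.
exists (xsection N t); split => //; first exact: measurable_xsection.
move=> y /= nP; rewrite /xsection/= inE; exact: (PN (t, y)).
Qed.

(** The plane carries the product sigma-algebra, so an open set is written as a countable union of
    squares with rational centres and radii [1 / (n + 1)]. *)
Lemma open_measurable_prod (A : set (R * R)) : open A -> measurable A.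
Proof.
move=> oA.
pose B (q : rat * rat * nat) : set (R * R) :=
  ball (ratr q.1.1 : R) (q.2.+1%:R^-1) `*` ball (ratr q.1.2 : R) (q.2.+1%:R^-1).
have -> : A = \bigcup_(q in [set q | B q `<=` A]) B q.
  apply/seteqP; split => [[x y] Axy|p [q qA]]; last exact: qA.
  have := oA _ Axy; rewrite /interior /= => -[/= [U V] [/= [e1 /= e10 U1] [e2 /= e20 V1]] UVA].
  pose e := Num.min e1 e2.
  have e0 : 0 < e by rewrite lt_min e10.
  (* Half of [e]: a ball containing [x] whose radius is below [e / 2] lies within [e] of [x]. *)
  have [n _ /(_ n (leqnn n)) /= ne] := near_infty_natSinv_lt (PosNum (divr_gt0 e0 (ltr0n R 2))).
  have n0 : 0 < n.+1%:R^-1 :> R by rewrite invr_gt0.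
  have rat_near (z : R) : exists q : rat, ball (ratr q : R) (n.+1%:R^-1) z.
    have [|q] := @rat_in_itvoo R (z - n.+1%:R^-1) (z + n.+1%:R^-1).
      by rewrite ltrBlDr -addrA ltrDl addr_gt0.
    rewrite in_itv/= => /andP[q1 q2]; exists q.
    by rewrite /ball/= ltr_distl q1 q2.
  have [q1 q1x] := rat_near x; have [q2 q2y] := rat_near y.
  exists (q1, q2, n) => //=.
  move=> [x' y'] [/= x'q y'q]; apply: UVA; split => /=.
    apply: U1; rewrite /ball/=.
    have := ball_triangle (ball_sym q1x) x'q; rewrite /ball/= => H.
    apply: lt_le_trans H _; rewrite (le_trans (ltW (ltrD ne ne)))// -splitr.
    by rewrite ge_min lexx.
  apply: V1; rewrite /ball/=.
  have := ball_triangle (ball_sym q2y) y'q; rewrite /ball/= => H.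
  apply: lt_le_trans H _; rewrite (le_trans (ltW (ltrD ne ne)))// -splitr.
  by rewrite ge_min lexx orbT.
rewrite bigcup_mkcond; apply: countable_bigcupT_measurable => // q.
case: ifPn => // _; apply: measurableX; exact: measurable_ball.
Qed.

Lemma continuous_measurable_prod (D : set (R * R)) (f : R * R -> R) :
  open D -> (forall p, D p -> {for p, continuous f}) -> measurable_fun D f.
Proof.
move=> oD cf; apply: (measurability _ (RGenOpens.measurableE R)).
move=> _ [_ [a [b ->] <-]]; apply: open_measurable_prod.
rewrite openE => p [Dp fp].
rewrite /interior; apply: filterI; first exact: open_nbhs_nbhs.
apply: cf => //; apply: open_nbhs_nbhs; split => //.
Qed.

End Energy.

(** * The maximum principle on the line *)

Section MaximumPrinciple.
Context {R : realType}.
Local Notation mu := (@lebesgue_measure R).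

(** If [f2] were positive, [f1], which vanishes at [c], would be positive just to the right, and [f]
    would exceed its maximum by the mean value theorem. *)
Lemma second_derivative_at_max (f f1 : R -> R) (f2 p q c : R) :
  p < c < q -> (forall y, p < y < q -> is_derive y (1:R) f (f1 y)) ->
  is_derive c (1:R) f1 f2 -> (forall y, p < y < q -> f y <= f c) ->
  f1 c = 0 /\ f2 <= 0.
Proof.
move=> /andP[pc cq] df df1 fmax.
have f10 : f1 c = 0.
  have pq : p <= q by rewrite ltW// (lt_trans pc).
  have [||| _ d0] := @derive1_at_max R f p q c pq.
  - by move=> t; rewrite in_itv/= => tI; have [] := df t tI.
  - by rewrite in_itv/= pc.
  - by move=> t; rewrite in_itv/=; exact: fmax.
  by have [_ <-] : is_derive c (1:R) f (f1 c) by apply: df; rewrite pc.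
split => //; rewrite leNgt; apply/negP => f20.
have /is_derive1_caratheodory [g [gE gc g0]] := df1.
have : \forall z \near c, 0 < g z.
  by have := gc; rewrite /prop_for /continuous_at g0 => /cvgr_gt; apply.
move=> [d /= d0 dP].
pose z := Num.min ((c + q) / 2) (c + d / 2).
have cz : c < z by rewrite lt_min midf_lt//= ltrDl divr_gt0.
have zq : z < q by rewrite gt_min midf_lt.
have zd : z - c < d.
  by rewrite ltrBlDr gt_min; apply/orP; right; lra.
have sub y : c <= y <= z -> p < y < q.
  by move=> /andP[cy yz]; rewrite (lt_le_trans pc cy) (le_lt_trans yz zq).
have [||w wI fE] := @MVT R f f1 c z cz.
- move=> y; rewrite in_itv/= => /andP[/ltW cy /ltW yz]; apply: df; apply: sub.
  by rewrite cy.
- apply: derivable_within_continuous => y; rewrite in_itv/= => yI.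
  by have [] := df y (sub y yI).
move: wI; rewrite in_itv/= => /andP[cw wz].
have := fmax z (sub z _); rewrite lexx ltW// => /(_ isT).
rewrite -subr_le0 fE leNgt => /negP; apply.
rewrite mulr_gt0 ?subr_gt0//.
have -> : f1 w = g w * (w - c) by rewrite -gE f10 subr0.
rewrite mulr_gt0 ?subr_gt0//; apply: dP => /=.
rewrite ltr0_norm ?subr_lt0// opprB (le_lt_trans _ zd)// lerB// ltW//.
Qed.

(** One-sided, because the maximum over a space-time box may be attained at its final time. *)
Lemma left_derivative_at_max (f : R -> R) (a s c : R) : s < c ->
  is_derive c (1:R) f a -> (forall t, s <= t <= c -> f t <= f c) -> 0 <= a.
Proof.
move=> sc /is_derive1_caratheodory [g [gE gc g0]] fmax.
rewrite leNgt; apply/negP => a0.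
have : \forall z \near c, g z < 0.
  by have := gc; rewrite /prop_for /continuous_at g0 => /cvgr_lt; apply.
move=> [d /= d0 dP].
pose z := Num.max s (c - d / 2).
have zc : z < c by rewrite gt_max sc ltrBlDr ltrDl divr_gt0.
have sz : s <= z by rewrite le_max lexx.
have := fmax z; rewrite sz ltW// => /(_ isT).
rewrite -subr_le0 gE leNgt => /negP; apply.
rewrite nmulr_rgt0 ?subr_lt0//; apply: dP => /=.
rewrite gtr0_norm ?subr_gt0// ltrBlDr -ltrBlDl lt_max; apply/orP; right; lra.
Qed.

Lemma is_derive_subZ (f g : R -> R) (x a b k : R) :
  is_derive x (1:R) f a -> is_derive x (1:R) g b ->
  is_derive x (1:R) (fun y => f y - k * g y) (a - k * b).
Proof. by move=> df dg; exact: is_deriveB df (is_deriveZ k dg). Qed.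

(* The barrier d exp(L (t - S)) (1 + y^2) is a strict supersolution, and it
   dominates the bounded function f for large y. *)
Lemma maximum_principle (S T gamma b0 B M : R)
    (f ft fx fxx b : R -> R -> R) :
  S <= T -> 0 <= gamma ->
  (forall t y, S < t -> t <= T ->
    [/\ is_derive t (1:R) (f^~ y) (ft t y),
        (forall z, is_derive z (1:R) (f t) (fx t z)),
        is_derive y (1:R) (fx t) (fxx t y),
        ft t y + b t y * fx t y = gamma * fxx t y & `|b t y| <= b0]) ->
  (forall t y, S <= t -> t <= T ->
     {for (t, y), continuous (fun p : R * R => f p.1 p.2)}) ->
  (forall t y, S <= t -> t <= T -> f t y <= B) ->
  (forall y, f S y <= M) ->
  forall t y, S <= t -> t <= T -> f t y <= M.
Proof.
move=> ST g0 pde fc fB fM ts ys Sts tsT.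
have b00 : 0 <= Num.max b0 0 by rewrite le_max lexx orbT.
(* At the maximum of [v] the equation and [2 |y| <= 1 + y^2] give [L (1 + y^2) <= 2 gamma + max(b0,
   0) (1 + y^2)], which this [L] violates by at least [1 + y^2]. *)
pose L := 2 * gamma + Num.max b0 0 + 1.
have L0 : 0 < L by rewrite ltr_wpDl// addr_ge0// mulr_ge0.
rewrite leNgt; apply/negP => fs.
pose E t := expR (L * (t - S)).
pose psi t y := E t * (1 + y ^+ 2).
have E0 t : 0 < E t by exact: expR_gt0.
have psi0 t y : 0 < psi t y by rewrite mulr_gt0// ltr_pwDl// sqr_ge0.
(* The barrier uses up half of the excess of [f] over [M] at [(ts, ys)], so [v] still exceeds [M]
   there. *)
pose d := (f ts ys - M) / (2 * psi ts ys).
have d0 : 0 < d by rewrite divr_gt0 ?subr_gt0// mulr_gt0.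
pose v (p : R * R) := f p.1 p.2 - d * psi p.1 p.2.
have vs : M < v (ts, ys).
  have -> : v (ts, ys) = M + (f ts ys - M) / 2.
    by rewrite /v /d /=; field; rewrite gt_eqF.
  by rewrite ltrDl divr_gt0// subr_gt0.
(* Since [|B - M| / d < X <= 1 + X^2], the barrier outweighs [B - M] from [X] on, and the maximum
   over the box stays off the lateral sides. *)
pose X := Num.max (`|ys| + 1) (`|B - M| / d + 1).
have X1 : 1 <= X by rewrite le_max lerDr normr_ge0.
have X0 : 0 <= X := le_trans ler01 X1.
have ysX : `|ys| < X by rewrite lt_max ltrDl ltr01.
have BX : B - M < d * (1 + X ^+ 2).
  rewrite (le_lt_trans (ler_norm _))// -ltr_pdivrMl// mulrC.
  apply: (@lt_le_trans _ _ X); first by rewrite lt_max ltrDl ltr01 orbT.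
  by nra.
pose K := `[S, T] `*` `[- X, X] : set (R * R).
have cK : compact K by apply: compact_setX; exact: segment_compact.
have Ks : K (ts, ys).
  split; rewrite /= in_itv/= ?Sts//.
  by move: ysX; rewrite ltr_norml => /andP[/ltW -> /ltW ->].
have cE : continuous E.
  move=> t; apply: (@continuous_comp R R R (fun t => L * (t - S)) expR).
    by apply: cvgM; [exact: cvg_cst|apply: cvgB; [exact: cvg_id|exact: cvg_cst]].
  exact: continuous_expR.
have cv : {within K, continuous v}.
  apply: continuous_in_subspaceT => -[t y] /set_mem[/=].
  rewrite in_itv/= => /andP[St tT] _.
  apply: cvgB; first exact: fc.
  apply: cvgM; first exact: cvg_cst.
  apply: cvgM.
    apply: (@continuous_comp (R * R)%type R R fst E); last exact: cE.
    exact: cvg_fst.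
  apply: cvgD; first exact: cvg_cst.
  apply: (@continuous_comp (R * R)%type R R snd (fun y => y ^+ 2)).
    exact: cvg_snd.
  exact: exprn_continuous.
have [[t1 y1] /set_mem[/= t1I y1I] vmax] :=
  compact_EVT_max (ex_intro _ _ Ks) cK cv.
have v1 : M < v (t1, y1) by apply: lt_le_trans vs _; apply: vmax; exact/mem_set.
move: t1I y1I; rewrite !in_itv/= => /andP[St1 t1T] /andP[y1l y1r].
have E1 t : S <= t -> 1 <= E t.
  by move=> St; rewrite -[leLHS]expR0 ler_expR mulr_ge0 ?subr_ge0// ltW.
have St1' : S < t1.
  rewrite lt_neqAle St1 andbT; apply/eqP => tE; move: v1; rewrite /v/= -tE.
  have := fM y1; have := mulr_gt0 d0 (psi0 S y1); lra.
have vX y : X <= `|y| -> v (t1, y) < M.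
  move=> Xy; rewrite /v/=.
  have : d * (1 + X ^+ 2) <= d * psi t1 y.
    rewrite ler_pM2l// /psi.
    have : 1 + X ^+ 2 <= 1 + y ^+ 2.
      rewrite lerD2l -(real_normK (num_real y)) lerXn2r// ?nnegrE//.
    by move=> H; apply: le_trans H _; rewrite ler_peMl ?E1// addr_ge0// sqr_ge0.
  have := fB t1 y St1 t1T; lra.
have y1l' : - X < y1.
  rewrite lt_neqAle y1l andbT; apply/eqP => yE.
  have := vX y1; rewrite -yE normrN (ger0_norm X0) lexx => /(_ isT).
  by rewrite yE ltNge ltW.
have y1r' : y1 < X.
  rewrite lt_neqAle y1r andbT; apply/eqP => yE.
  have := vX y1; rewrite yE (ger0_norm X0) lexx => /(_ isT).
  by rewrite -yE ltNge ltW.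
have [dt dx dxx eqn bb] := pde t1 y1 St1' t1T.
have dpx z : is_derive z (1:R) (psi t1) (E t1 * (2 * z)).
  have d1 : is_derive z (1:R) (fun z : R => 1 + z ^+ 2) (2 * z).
    by apply: is_derive_eq; rewrite /GRing.scale/=; ring.
  by apply: (is_derive_eq (is_deriveZ (E t1) d1)).
have dpxx : is_derive y1 (1:R) (fun z => E t1 * (2 * z)) (E t1 * 2).
  have d1 : is_derive y1 (1:R) (fun z : R => 2 * z) 2.
    by apply: is_derive_eq; rewrite /GRing.scale/=; ring.
  by apply: (is_derive_eq (is_deriveZ (E t1) d1)).
have dpt : is_derive t1 (1:R) (psi^~ y1) (L * psi t1 y1).
  have d1 : is_derive t1 (1:R) E (E t1 * L).
    have d2 : is_derive t1 (1:R) (fun t => L * (t - S)) L.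
      by apply: is_derive_eq; rewrite /GRing.scale/=; ring.
    exact: (@is_derive1_comp R expR (fun t => L * (t - S)) t1 _ _ (is_derive_expR _) d2).
  have d3 : is_derive t1 (1:R) ((1 + y1 ^+ 2) \*: E) ((1 + y1 ^+ 2) * (E t1 * L)).
    by apply: (is_derive_eq (is_deriveZ (1 + y1 ^+ 2) d1)).
  have -> : psi^~ y1 = (1 + y1 ^+ 2) \*: E.
    by apply/funext => t; rewrite /psi mulrC.
  by apply: (is_derive_eq d3); rewrite /psi; ring.
have [vx vxx] := @second_derivative_at_max (fun y => v (t1, y))
    (fun z => fx t1 z - d * (E t1 * (2 * z))) (fxx t1 y1 - d * (E t1 * 2))
    (- X) X y1 (introT andP (conj y1l' y1r'))
    (fun y _ => is_derive_subZ d (dx y) (dpx y)) (is_derive_subZ d dxx dpxx)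
    (fun y yI => vmax (t1, y) (mem_set (conj (introT andP (conj St1 t1T))
       (introT andP (conj (ltW (proj1 (andP yI))) (ltW (proj2 (andP yI)))))))).
have dvt := is_derive_subZ d dt dpt.
have vt : 0 <= ft t1 y1 - d * (L * psi t1 y1).
  apply: (@left_derivative_at_max (fun t => v (t, y1)) _ S t1 St1').
  move=> t /andP[St tt1]; apply: vmax; apply/mem_set; split => /=.
    by rewrite in_itv/= St (le_trans tt1).
  by rewrite in_itv/= y1l.
pose c := d * E t1.
have c0 : 0 < c by rewrite mulr_gt0.
have H1 : L * (1 + y1 ^+ 2) * c <= ft t1 y1 by move: vt; rewrite /psi /c; lra.
have H2 : fx t1 y1 = c * (2 * y1) by move: vx; rewrite /c; lra.
have H3 : gamma * fxx t1 y1 <= gamma * (2 * c).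
  by rewrite ler_wpM2l//; move: vxx; rewrite /c; lra.
have H4 : - (b t1 y1 * fx t1 y1) <= c * (Num.max b0 0 * (1 + y1 ^+ 2)).
  have -> : - (b t1 y1 * fx t1 y1) = c * (- (b t1 y1 * (2 * y1))).
    by rewrite H2; ring.
  rewrite ler_pM2l// (le_trans (ler_norm _))// normrN normrM.
  apply: ler_pM => //; first by rewrite (le_trans bb)// le_max lexx.
  by rewrite ler_norml; have := sqr_ge0 (1 - y1); have := sqr_ge0 (1 + y1); nra.
have H5 : L * (1 + y1 ^+ 2) * c <= gamma * (2 * c) + c * (Num.max b0 0 * (1 + y1 ^+ 2)).
  by lra.
have y20 := sqr_ge0 y1.
have : c * (L * (1 + y1 ^+ 2)) <= c * (2 * gamma + Num.max b0 0 * (1 + y1 ^+ 2)).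
  by lra.
rewrite ler_pM2l// /L.
have : 0 <= gamma * y1 ^+ 2 by rewrite mulr_ge0.
by lra.
Qed.

End MaximumPrinciple.

(** * Bounds for the traffic density *)

Section TrafficBound.
Context {R : realType}.
Local Notation mu := (@lebesgue_measure R).

Lemma ae_le_continuous_at (h : R -> R) (c y : R) : {for y, continuous h} ->
  {ae mu, forall y, h y <= c} -> h y <= c.
Proof.
move=> ch [N [mN N0 hN]]; rewrite leNgt; apply/negP => cy.
have [d /= d0 dP] : \forall z \near y, c < h z by exact: cvgr_gt ch _ cy.
have sub : `]y - d, y + d[ `<=` N.
  move=> z; rewrite /= in_itv/= => zI; apply: hN => /=; apply/negP.
  by rewrite -ltNge; apply: dP; rewrite /= distrC ltr_distl.
pose p := y - d; pose q := y + d.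
have : (mu `]p, q[ <= 0)%E by rewrite -N0; apply: le_measure; rewrite ?inE.
rewrite lebesgue_measure_itv/= lte_fin ifT; last first.
  by rewrite /p /q ltrBlDr -addrA ltrDl addr_gt0.
by rewrite -EFinB lee_fin /p /q; lra.
Qed.

Lemma ae_le_continuous (h : R -> R) (c : R) : continuous h ->
  {ae mu, forall y, h y <= c} -> forall y, h y <= c.
Proof. by move=> ch hc y; apply: ae_le_continuous_at => //; exact: ch. Qed.

Lemma ae_le_Lnormy (f : R -> R) (e : R) : ('N[mu]_+oo[EFin \o f] <= e%:E)%E ->
  {ae mu, forall y, `|f y| <= e}.
Proof.
(* The norm of exponent [+oo] unfolds to an essential supremum under the condition that the whole
   space has positive measure. *)
have mT : (0 < mu setT)%E.
  have : (mu `[0%R, 1%R] <= mu setT)%E by apply: le_measure; rewrite ?inE.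
  apply: lt_le_trans.
  by rewrite lebesgue_measure_itv/= lte_fin ltr01 sube0 lte_fin.
rewrite unlock ifT//.
by move=> /ess_supP; apply: filterS.
Qed.

Variables (vf gamma : R) (rho0 : R -> R) (rho : R -> R -> R).
Hypotheses (gamma_gt0 : 0 < gamma) (sol : traffic_solution vf gamma rho0 rho).

Lemma traffic_derive (t y : R) : 0 < t ->
  [/\ is_derive t (1:R) (rho^~ y) (Dt rho t y),
      is_derive y (1:R) (rho t) (Dx rho t y) &
      is_derive y (1:R) (Dx rho t) (Dx (Dx rho) t y)].
Proof.
move=> t0; have [sm _ _ _] := sol.
have [d1 d2 _] := sm [::] t y t0; have [_ d3 _] := sm [:: false] t y t0.
have D (f : R -> R) z : derivable f z 1 -> is_derive z (1:R) f (derive1 f z).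
  by rewrite derive1E => /derivableP.
by split; [exact: D d1|exact: D d2|exact: D d3].
Qed.

Lemma traffic_continuous (w : seq bool) (t y : R) : 0 < t ->
  {for (t, y), continuous (fun p : R * R => pderiv w rho p.1 p.2)}.
Proof. by move=> t0; have [sm _ _ _] := sol; have [] := sm w t y t0. Qed.

Lemma continuous_slice (f : R -> R -> R) (t y : R) :
  {for (t, y), continuous (fun p : R * R => f p.1 p.2)} ->
  {for y, continuous (f t)}.
Proof.
move=> cf; apply: (@continuous_comp R (R * R)%type R (fun z : R => (t, z))
  (fun p => f p.1 p.2)); last exact: cf.
by apply: (@cvg_pair _ _ _ _ (nbhs t) (nbhs y)); [exact: cvg_cst|exact: cvg_id].
Qed.

Lemma traffic_slice_continuous (w : seq bool) (t : R) : 0 < t ->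
  continuous (pderiv w rho t).
Proof.
by move=> t0 y; exact: (@continuous_slice (pderiv w rho) t y (@traffic_continuous w t y t0)).
Qed.

Lemma traffic_Linfty_near (t e : R) : 0 <= t -> 0 < e -> exists2 d : R, 0 < d &
  forall s, 0 <= s -> `|t - s| < d ->
    {ae mu, forall y, `|rho s y - rho t y| <= e}.
Proof.
move=> t0 e0; have [_ [_ cL] _ _] := sol.
have : \forall s \near within [set s : R | 0 <= s] (nbhs t),
   ('N[mu]_+oo[EFin \o (rho s \- rho t)%R] < e%:E)%E.
  have := cL t t0 [set x | x < e%:E]%E; rewrite /fmap/=; apply.
  exact: (open_nbhs_nbhs (conj (@open_ereal_lt_ereal R e%:E) (e0 : (0%:E < e%:E)%E))).
move=> [d /= d0 dP]; exists d => // s s0 st.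
by apply: ae_le_Lnormy; apply/ltW/dP.
Qed.

(** Joint continuity gives no bound on a whole line. Continuity in time with values in L^oo does so
    almost everywhere, and continuity in space then everywhere. *)
Lemma traffic_locally_bounded (t : R) : 0 < t -> exists B d : R, 0 < d /\
  forall s y, 0 < s -> `|t - s| < d -> `|rho s y| <= B.
Proof.
move=> t0; have [_ [L _] _ _] := sol.
have [_ Lt] := L t (ltW t0).
have cr s : 0 < s -> continuous (rho s).
  exact: (@traffic_slice_continuous [::]).
have [B BP] : exists B : R, {ae mu, forall y, `|rho t y| <= B}.
  exists (fine 'N[mu]_+oo[EFin \o rho t]); apply: ae_le_Lnormy.
  by rewrite fineK// ge0_fin_numE// Lnorm_ge0.
have [d d0 dP] := traffic_Linfty_near (ltW t0) ltr01.
exists (B + 1), d; split => // s y s0 st; move: y.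
apply: ae_le_continuous.
  move=> y; apply: (@continuous_comp R R R (rho s) Num.norm); first exact: cr.
  exact: norm_continuous.
have := dP s (ltW s0) st; apply: filterS2 BP => y H1 H2.
have -> : rho s y = rho t y + (rho s y - rho t y) by rewrite subrKC.
by apply: le_trans (ler_normD _ _) _; exact: lerD.
Qed.

Lemma traffic_bounded (S T : R) : 0 < S -> exists B : R,
  forall t y, S <= t -> t <= T -> `|rho t y| <= B.
Proof.
move=> S0.
(* Compactness of [[S, T]] makes the local bounds uniform, along the filter of bounds tending to
   [+oo]. *)
have := @segment_compact R S T.
move/compact_near_coveringP => /(_ R (pinfty_nbhs R)
  (fun B t => 0 < t -> forall y, `|rho t y| <= B)) H.
have [t|M [_ MP]] := H _.
  rewrite /= in_itv/= => /andP[St tT].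
  have t0 := lt_le_trans S0 St.
  have [B [d [d0 BP]]] := traffic_locally_bounded t0.
  exists (ball t d, [set x | B < x]).
    split => /=; first exact: nbhsx_ballx.
    by exists B; split => //; exact: num_real.
  move=> [s C] [/= sd BC] s0 y; apply: le_trans (ltW BC); exact: BP.
exists (M + 1) => t y St tT; have := MP (M + 1) _ t.
rewrite ltrDl ltr01 /= in_itv/= St tT => /(_ isT isT); apply.
exact: lt_le_trans St.
Qed.

(** The factor [k] serves the upper bound with [k = 1] and the lower one with [k = -1]. The maximum
    principle cannot start at time 0, where [rho] need not be continuous; it starts at a small [S]
    with [M + e]. *)
Lemma traffic_bound (k M : R) : (forall y, k * rho0 y <= M) ->
  forall t y, 0 <= t -> k * rho t y <= M.
Proof.
move=> r0M t y; rewrite le_eqVlt => /predU1P[<-|t0].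
  by have [_ _ _ ->] := sol.
apply/ler_addgt0Pr => e e0.
have k10 : 0 < `|k| + 1 by rewrite ltr_wpDl.
have [d d0 dP] := traffic_Linfty_near (lexx 0) (divr_gt0 e0 k10).
pose S := Num.min t (d / 2).
have S0 : 0 < S by rewrite lt_min t0 divr_gt0.
have St : S <= t by rewrite ge_min lexx.
have SM : forall y, k * rho S y <= M + e.
  apply: ae_le_continuous.
    move=> z; apply: cvgM; first exact: cvg_cst.
    exact: (@traffic_slice_continuous [::] S S0 z).
  have := dP S (ltW S0); have [_ _ _ r0] := sol.
  have -> : `|0 - S| < d.
    rewrite sub0r normrN gtr0_norm// gt_min; apply/orP; right; lra.
  move=> /(_ isT); apply: filterS => z; rewrite r0 => H.
  have -> : k * rho S z = k * rho0 z + k * (rho S z - rho0 z) by ring.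
  rewrite lerD// (le_trans (ler_norm _))// normrM.
  apply: le_trans (ler_wpM2l (normr_ge0 k) H) _.
  by rewrite mulrA ler_pdivrMr// mulrC ler_pM2l// lerDl.
have [B BP] := traffic_bounded t S0.
have [_ _ pde _] := sol.
(* With [vf (1 - 2 rho)] regarded as a given bounded coefficient, [k rho] solves a linear
   equation. *)
apply: (@maximum_principle R S t gamma (`|vf| * (1 + 2 * B)) (`|k| * B) (M + e)
  (fun t y => k * rho t y) (fun t y => k * Dt rho t y) (fun t y => k * Dx rho t y)
  (fun t y => k * Dx (Dx rho) t y) (fun t y => vf * (1 - 2 * rho t y))) => //.
- exact: ltW.
- move=> s z Ss st; have s0 := lt_trans S0 Ss.
  have [d1 _ d3] := traffic_derive z s0.
  split.
  + by apply: (is_derive_eq (is_deriveZ k d1)).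
  + by move=> z'; have [_ d2 _] := traffic_derive z' s0; by apply: (is_derive_eq (is_deriveZ k d2)).
  + by apply: (is_derive_eq (is_deriveZ k d3)).
  + have := pde s z s0 => H.
    have -> : gamma * (k * Dx (Dx rho) s z) = k * (gamma * Dx (Dx rho) s z) by ring.
    by rewrite -H; ring.
  + rewrite normrM ler_wpM2l// (le_trans (ler_normB _ _))// normr1 lerD2l normrM.
    by rewrite ger0_norm// ler_pM2l// BP// ltW.
- move=> s z Ss st; apply: cvgM; first exact: cvg_cst.
  exact: (@traffic_continuous [::] s z (lt_le_trans S0 Ss)).
- move=> s z Ss st; rewrite (le_trans (ler_norm _))// normrM ler_wpM2l//.
  exact: BP.
Qed.

End TrafficBound.

(** * The moving domain between two consecutive probes *)

Section MovingDomain.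
Context {R : realType}.
Local Notation mu := (@lebesgue_measure R).
Local Notation mu2 := (mu \x mu)%E.

Lemma integrable_itv_cc (a b : R) (f : R -> R) :
  mu.-integrable `]a, b[ (EFin \o f) -> mu.-integrable `[a, b] (EFin \o f).
Proof.
move=> fi; have mf := measurable_int mu fi.
have mf' : measurable_fun `[a, b] (EFin \o f).
  by move/measurable_EFinP : mf => /(measurable_fun_itv_cc) /measurable_EFinP.
apply/integrableP; split => //.
have mab : measurable_fun `]a, b] (EFin \o f).
  by apply: measurable_funS mf' => //; exact: subset_itv_oc_cc.
have mn (I : set R) : measurable_fun I (EFin \o f) ->
  measurable_fun I (fun x => `|(EFin \o f) x|)%E by exact: measurableT_comp.
rewrite -integral_itv_obnd_cbnd; last exact: mn.
rewrite -integral_itv_bndo_bndc; last exact: mn.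
by case/integrableP : fi.
Qed.

Lemma L2_integrable (a b : R) (f : R -> R) : L2 mu `]a, b[ f ->
  mu.-integrable `[a, b] (EFin \o f).
Proof.
move=> [mf f2]; apply: integrable_itv_cc.
have fin : (mu `]a, b[ < +oo)%E.
  by rewrite lebesgue_measure_itv/=; case: ifP => // _; rewrite -EFinB ltry.
have i2 : mu.-integrable `]a, b[ (EFin \o (fun x => f x ^+ 2)).
  apply/integrableP; split; first exact/measurable_EFinP/measurable_funX.
  move: f2; congr (_ < _)%E; apply: eq_integral => x _ /=.
  by rewrite ger0_norm// sqr_ge0.
have i1 : mu.-integrable `]a, b[ (EFin \o (fun x => 1 + f x ^+ 2)).
  by apply: integrableRD => //; exact: (integrable_cst 1).
apply: le_integrable i1 => //; first exact/measurable_EFinP.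
move=> x _ /=; rewrite lee_fin [leRHS]ger0_norm ?addr_ge0 ?sqr_ge0//.
have := sqr_ge0 (`|f x| - 1); rewrite sqrrB real_normK ?num_real//.
by have := sqr_ge0 (f x); have := normr_ge0 (f x); lra.
Qed.

Lemma H2_primitive (a b : R) (h h1 h2 : R -> R) : H2 a b h h1 h2 ->
  primitive a b h h1 /\ primitive a b h1 h2.
Proof.
by move=> [_ L1 L2_ E1 E2]; split; split => //; exact: L2_integrable.
Qed.

Variables (vf gamma : R) (rho0 : R -> R) (rho : R -> R -> R).
Hypotheses (vf_gt0 : 0 < vf) (gamma_gt0 : 0 < gamma).
Hypothesis sol : traffic_solution vf gamma rho0 rho.
Hypothesis rho0_range : forall y, 0 <= rho0 y <= 1.

Lemma traffic_range (t y : R) : 0 <= t -> 0 <= rho t y <= 1.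
Proof.
move=> t0; rewrite -[rho t y]mul1r.
rewrite (traffic_bound gamma_gt0 sol (k := 1) (M := 1))// ?andbT; last first.
  by move=> z; rewrite mul1r; case/andP: (rho0_range z).
have := @traffic_bound R vf gamma rho0 rho gamma_gt0 sol (-1) 0 _ t y t0.
rewrite mulN1r oppr_le0 mul1r; apply => z.
by rewrite mulN1r oppr_le0; case/andP: (rho0_range z).
Qed.

Lemma continuous_within_itv (x : R -> R) (a b : R) : 0 <= a ->
  {within [set t : R | 0 <= t], continuous x} ->
  {within `[a, b], continuous x}.
Proof.
move=> a0; apply: continuous_subspaceW => t.
by rewrite /= in_itv/= => /andP[at_ _]; exact: le_trans at_.
Qed.

Lemma trajectory_increment (x0 : R) (x : R -> R) :
  probe_trajectory vf rho x0 x ->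
  forall s t : R, 0 <= s -> s <= t -> 0 <= x t - x s <= vf * (t - s).
Proof.
move=> [cx dx _] s t s0 st.
have [||z zI ->] := @MVT_segment R x (fun t => vf * (1 - rho t (x t))) s t st.
- move=> z; rewrite in_itv/= => /andP[sz _]; apply: dx; exact: le_lt_trans sz.
- exact: continuous_within_itv.
move: zI; rewrite in_itv/= => /andP[sz zt].
have /andP[r0 r1] := traffic_range (x z) (le_trans s0 sz).
rewrite mulr_ge0 ?subr_ge0// ?mulr_ge0 ?subr_ge0// ?(ltW vf_gt0)//=.
by rewrite ler_wpM2r ?subr_ge0// ger_pMr// gerBl.
Qed.

Variables (xl xr : R) (l r : R -> R).
Hypotheses (l_traj : probe_trajectory vf rho xl l)
           (r_traj : probe_trajectory vf rho xr r).

Let l_mono (s t : R) : 0 <= s -> s <= t -> l s <= l t.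
Proof.
by move=> s0 st; have /andP[] := trajectory_increment l_traj s0 st; rewrite subr_ge0.
Qed.

Let r_mono (s t : R) : 0 <= s -> s <= t -> r s <= r t.
Proof.
by move=> s0 st; have /andP[] := trajectory_increment r_traj s0 st; rewrite subr_ge0.
Qed.

(** The time [S] is excluded so that a slab starting at 0 stays where the equations and the H^2
    regularity hold. *)
Definition slab (S T : R) : set (R * R) :=
  [set p | (S < p.1 <= T) && (l p.1 < p.2 < r p.1)].

Definition on_slab (S T : R) (g : R -> R -> R) (p : R * R) : R :=
  if (S < p.1 <= T) && (l p.1 < p.2 < r p.1) then g p.1 p.2 else 0.

Lemma on_slabE (S T : R) g : on_slab S T g = (fun p => g p.1 p.2) \_ (slab S T).
Proof.
apply/funext => p; rewrite /on_slab patchE; case: ifPn => [pS|/negP pS].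
  by rewrite ifT// inE.
by rewrite ifF//; apply/negP; rewrite inE.
Qed.

Lemma slab_tube (S T : R) T' : 0 <= S -> T < T' ->
  slab S T `<=` tube l r `&` [set p | p.1 < T'].
Proof.
move=> S0 TT' p /andP[/andP[Sp pT] lpr]; split => /=; last exact: le_lt_trans TT'.
by split => //; exact: le_lt_trans Sp.
Qed.

Lemma measurable_trajectory (x0 : R) (x : R -> R) (S T : R) :
  probe_trajectory vf rho x0 x -> 0 <= S -> measurable_fun `]S, T] x.
Proof.
move=> [cx _ _] S0; apply: subspace_continuous_measurable_fun => //.
apply: continuous_subspaceW cx => t /=; rewrite in_itv/= => /andP[St _].
exact: le_trans (ltW St).
Qed.

Lemma measurable_slab (S T : R) : 0 <= S -> measurable (slab S T).
Proof.
move=> S0.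
pose D := `]S, T] `*` [set: R] : set (R * R).
have mD : measurable D by exact: measurableX.
have mfst (f : R -> R) : measurable_fun `]S, T] f ->
    measurable_fun D (fun p => f p.1).
  move=> mf; apply: (@measurable_comp _ _ _ _ _ _ `]S, T]) => //.
    by move=> _ [p [pD _] <-].
  exact: measurable_funS (@measurable_fst _ _ _ _).
have mlt := measurable_fun_ltr (mfst l (measurable_trajectory l_traj S0))
   (measurable_funS measurableT (@subsetT _ D) (@measurable_snd _ _ R R)).
have mrt := measurable_fun_ltr
   (measurable_funS measurableT (@subsetT _ D) (@measurable_snd _ _ R R))
   (mfst r (measurable_trajectory r_traj S0)).
have -> : slab S T = (D `&` (fun p => l p.1 < p.2) @^-1` [set true]) `&`
    (D `&` (fun p => p.2 < r p.1) @^-1` [set true]).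
  apply/seteqP; split => p; rewrite /slab /D /= in_itv/=.
    by move=> /andP[-> /andP[-> ->]].
  by move=> [[[-> _] ->] [_ ->]].
by apply: measurableI; [exact: mlt|exact: mrt].
Qed.

Lemma slab_finite (S T : R) : 0 <= S -> (mu2 (slab S T) < +oo)%E.
Proof.
move=> S0.
have sub : slab S T `<=` `[0, T] `*` `[l 0, r T].
  move=> p /andP[/andP[Sp pT] /andP[lp pr]]; have p0 := le_trans S0 (ltW Sp).
  split; rewrite /= in_itv/=; first by rewrite p0.
  by rewrite (le_trans (l_mono (lexx 0) p0) (ltW lp)) (le_trans (ltW pr))// r_mono.
have mB : measurable (`[0, T] `*` `[l 0, r T] : set (R * R)) by exact: measurableX.
apply: (@le_lt_trans _ _ (mu2 (`[0, T] `*` `[l 0, r T]))).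
  by apply: le_measure; rewrite ?inE//; exact: measurable_slab.
rewrite product_measure1E//=.
by rewrite !lebesgue_measure_itv/=; case: ifP => _; case: ifP => _;
  rewrite ?mul0e ?mule0 ?ltry// -!EFinB -EFinM ltry.
Qed.

(** A slab has finite measure, so constants may be added to a square integrable majorant. *)
Lemma on_slab_integrable (S T : R) (g h : R -> R -> R) (C : R) : 0 <= S ->
  measurable_fun (slab S T) (fun p => g p.1 p.2) ->
  L2 mu2 (slab S T) (fun p => h p.1 p.2) ->
  (forall t y, S < t -> t <= T -> l t < y < r t ->
     `|g t y| <= C * (1 + h t y ^+ 2)) ->
  mu2.-integrable setT (EFin \o on_slab S T g).
Proof.
move=> S0 mg [mh h2] gh.
have mQ := measurable_slab T S0; have fQ := slab_finite T S0.
have i2 : mu2.-integrable (slab S T) (EFin \o (fun p => h p.1 p.2 ^+ 2)).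
  apply/integrableP; split; first exact/measurable_EFinP/measurable_funX.
  move: h2; congr (_ < _)%E; apply: eq_integral => x _ /=.
  by rewrite ger0_norm// sqr_ge0.
have i1 : mu2.-integrable (slab S T)
    (EFin \o (fun p => C * (1 + h p.1 p.2 ^+ 2))).
  by apply: integrableRZ => //; apply: integrableRD => //; exact: (integrable_cst 1).
rewrite on_slabE -restrict_EFin; have H := @integrable_mkcond _ _ R mu2 (slab S T) (EFin \o (fun p : R * R => g p.1 p.2)) mQ.
apply: (proj1 H).
apply: le_integrable i1 => //; first exact/measurable_EFinP.
move=> p pQ /=; rewrite lee_fin; have /andP[/andP[Sp pT] pI] := pQ.
by apply: le_trans (gh _ _ Sp pT pI) _; exact: ler_norm.
Qed.

Lemma L2loc_slab (S T : R) (h : R -> R -> R) : 0 <= S -> S <= T ->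
  L2loc_tube l r h -> L2 mu2 (slab S T) (fun p => h p.1 p.2).
Proof.
move=> S0 ST hL; have T1 : 0 < T + 1 by rewrite ltr_wpDl// (le_trans S0).
have [mh h2] := hL _ T1.
have sub := slab_tube S0 (ltr_pwDr ltr01 (lexx T)).
have mQ := measurable_slab T S0.
have mtube : measurable (tube l r `&` [set p | p.1 < T + 1]).
  have -> : tube l r `&` [set p | p.1 < T + 1]
      = slab 0 (T + 1) `&` ((fun p : R * R => p.1) @^-1` `]-oo, (T + 1)[).
    apply/seteqP; split => p; rewrite /slab /tube /= in_itv/=.
      by move=> [[-> ->] pT]; rewrite pT (ltW pT).
    by move=> [/andP[/andP[-> _] ->] ->].
  apply: measurableI; first exact: measurable_slab.
  rewrite -[X in measurable X]setTI.
  by apply: measurable_fst => //; exact: measurable_itv.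
split; first exact: measurable_funS mh.
apply: le_lt_trans h2; apply: ge0_subset_integral => //.
  exact/measurable_EFinP/measurable_funX.
by move=> p _; rewrite lee_fin sqr_ge0.
Qed.

End MovingDomain.

(** * Lateral traces and slices of the observer *)

Section Observer.
Context {R : realType}.
Local Notation mu := (@lebesgue_measure R).
Local Notation mu2 := (mu \x mu)%E.

Variables (vf gamma : R) (rho0 : R -> R) (rho : R -> R -> R).
Hypotheses (vf_gt0 : 0 < vf) (gamma_gt0 : 0 < gamma).
Hypothesis sol : traffic_solution vf gamma rho0 rho.
Hypothesis rho0_range : forall y, 0 <= rho0 y <= 1.
Variables (xl xr : R) (l r : R -> R) (dM : R).
Hypotheses (l_traj : probe_trajectory vf rho xl l)
           (r_traj : probe_trajectory vf rho xr r).
Hypothesis lr : forall t : R, 0 <= t -> 0 <= r t - l t <= dM.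
Variables (u ut ux uxx : R -> R -> R).
Hypotheses (L2ut : L2loc_tube l r ut) (L2ux : L2loc_tube l r ux).
Hypothesis H2u : forall t : R, 0 < t -> H2 (l t) (r t) (u t) (ux t) (uxx t).
Hypothesis ftcu : forall s t y : R, 0 <= s -> s <= t ->
  (forall tau, s <= tau -> tau <= t -> l tau < y < r tau) ->
  u t y - u s y = \int[mu]_(tau in `[s, t]) ut tau y.
Hypothesis trace_l : forall t : R, 0 < t -> u t (l t) = rho t (l t).
Hypothesis trace_r : forall t : R, 0 < t -> u t (r t) = rho t (r t).

Let le_lr (t : R) : 0 <= t -> l t <= r t.
Proof. by move=> /lr /andP[]; rewrite subr_ge0. Qed.

Let incr_l := trajectory_increment vf_gt0 gamma_gt0 sol rho0_range l_traj.
Let incr_r := trajectory_increment vf_gt0 gamma_gt0 sol rho0_range r_traj.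

Lemma H2_sqr_integrable (t : R) : 0 < t ->
  mu.-integrable `[l t, r t] (EFin \o (fun y => ux t y ^+ 2)).
Proof.
move=> t0; have [_ pux] := H2_primitive (H2u t0).
apply: continuous_integrable_itv.
have cux := primitive_continuous (le_lr (ltW t0)) pux.
exact: within_continuousM.
Qed.

(** Written over the whole line through the extension by 0, it is a marginal of an integrable
    function of the plane, hence integrable in time. *)
Definition slab_energy (T t : R) : R :=
  \int[mu]_y on_slab l r 0 T (fun s y => ux s y ^+ 2) (t, y).

Lemma slab_energyE (T t : R) : 0 < t -> t <= T ->
  slab_energy T t = \int[mu]_(y in `[l t, r t]) ux t y ^+ 2.
Proof.
move=> t0 tT; have i2 := H2_sqr_integrable t0.
rewrite /slab_energy (@Rintegral_setT_patch R `]l t, r t[ _ (fun y => ux t y ^+ 2))//.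
- rewrite -Rintegral_itv_obnd_cbnd ?Rintegral_itv_bndo_bndc//.
    by apply: integrableS i2 => //; exact: subset_itv_oo_cc.
  by apply: integrableS i2 => //; exact: subset_itv_oc_cc.
- by move=> y; rewrite /= in_itv/= /on_slab/= t0 tT => ->.
- by move=> y; rewrite /= in_itv/= /on_slab/= => /negP/negbTE ->; rewrite andbF.
Qed.

Lemma slab_energy_integrable (T : R) : 0 <= T ->
  mu.-integrable `[0, T] (EFin \o slab_energy T).
Proof.
move=> T0.
have i2 : mu2.-integrable setT (EFin \o on_slab l r 0 T (fun s y => ux s y ^+ 2)).
  have L := L2loc_slab l_traj r_traj (lexx 0) T0 L2ux.
  apply: (on_slab_integrable vf_gt0 gamma_gt0 sol rho0_range l_traj r_traj
    (h := ux) (C := 1)) => //.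
  - by case: L => mux _; exact: measurable_funX.
  - by move=> t y _ _ _; rewrite mul1r ger0_norm ?sqr_ge0// lerDr.
have iF := integrable_fubini_F i2.
have iF' : mu.-integrable `[0, T] (fubini_F mu (EFin \o on_slab l r 0 T (fun s y => ux s y ^+ 2))).
  exact: integrableS iF.
apply: eq_integrable iF' => // t; rewrite inE/= in_itv/= => /andP[t0 tT].
rewrite /slab_energy /Rintegral /fubini_F/= fineK//.
have [t0'|t0'] := ltP 0 t; last first.
  rewrite (eq_integral (cst 0%E)) ?integral0// => y _.
  by rewrite /on_slab/= ltNge t0'.
apply: integrable_fin_num => //.
have := H2_sqr_integrable t0'.
move=> i.
have i' : mu.-integrable `]l t, r t[ (EFin \o (fun y => ux t y ^+ 2)).
  by apply: integrableS i => //; exact: subset_itv_oo_cc.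
have I := proj1 (@integrable_mkcond _ _ R mu `]l t, r t[
  (EFin \o (fun y => ux t y ^+ 2)) (measurable_itv _)) i'.
apply: eq_integrable I => // y _.
by rewrite patchE /on_slab/= t0' tT/= mem_setE in_itv/=; case: ifP.
Qed.

(** The Cauchy-Schwarz inequality on [[y, z]]. *)
Lemma trace_distance (T t y z : R) : 0 < t -> t <= T ->
  l t <= y -> y <= z -> z <= r t ->
  (u t z - u t y) ^+ 2 <= (z - y) * slab_energy T t.
Proof.
move=> t0 tT ly yz zr; have [pu pux] := H2_primitive (H2u t0).
have [iux uE] := pu; rewrite uE//.
have i2 := H2_sqr_integrable t0.
apply: le_trans (sqr_Rintegral_le yz _ _) _.
- exact: integrable_itvS iux.
- exact: integrable_itvS i2.
rewrite ler_wpM2l ?subr_ge0// slab_energyE//.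
have ly' := le_trans ly yz.
rewrite (Rintegral_itv_split ly' zr i2).
have i3 := integrable_itvS (lexx (l t)) zr i2.
rewrite (Rintegral_itv_split ly yz i3).
rewrite -addrA addrC -addrA lerDl addr_ge0//;
  by apply: Rintegral_ge0 => *; exact: sqr_ge0.
Qed.

(** A slice begins where [r] passes [y]. As [r] moves at speed at most [vf],
    [r t - y <= vf (t - a)], and [small_near_left] applies to the distance from [u] to its trace. *)
Lemma trace_limit_r (a b y : R) : 0 <= a -> a < b -> r a <= y ->
  (forall t, a < t < b -> l t < y < r t) ->
  forall e : R, 0 < e ->
  exists2 t, a < t < b & `|u t y - rho t (r t)| <= e.
Proof.
move=> a0 ab ray P e e0.
have b0 : 0 <= b := le_trans a0 (ltW ab).
have iX := integrable_itvS a0 (lexx b) (slab_energy_integrable b0).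
apply: (small_near_left ab vf_gt0 iX) => // t tab.
have /andP[at_ tb] := tab; have t0 := le_lt_trans a0 at_.
have /andP[ly yr] := P t tab.
rewrite real_normK ?num_real// -trace_r// -sqrrN opprB.
apply: le_trans (trace_distance t0 (ltW tb) (ltW ly) (ltW yr) (lexx _)) _.
rewrite ler_wpM2r//; first by apply: Rintegral_ge0 => z _; rewrite /on_slab; case: ifP => // _; exact: sqr_ge0.
have /andP[_ H] := incr_r a0 (ltW at_); apply: le_trans H.
by rewrite lerB.
Qed.

Lemma trace_limit_l (a b y : R) : 0 <= a -> a < b -> y <= l b ->
  (forall t, a < t < b -> l t < y < r t) ->
  forall e : R, 0 < e ->
  exists2 t, a < t < b & `|u t y - rho t (l t)| <= e.
Proof.
move=> a0 ab ylb P e e0.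
have b0 : 0 <= b := le_trans a0 (ltW ab).
have iX := integrable_itvS a0 (lexx b) (slab_energy_integrable b0).
apply: (small_near_right ab vf_gt0 iX) => // t tab.
have /andP[at_ tb] := tab; have t0 := le_lt_trans a0 at_.
have /andP[ly yr] := P t tab.
rewrite real_normK ?num_real// -trace_l//.
apply: le_trans (trace_distance t0 (ltW tb) (lexx _) (ltW ly) (ltW yr)) _.
rewrite ler_wpM2r//; first by apply: Rintegral_ge0 => z _; rewrite /on_slab; case: ifP => // _; exact: sqr_ge0.
have /andP[_ H] := incr_l (ltW t0) (ltW tb); apply: le_trans H.
by rewrite lerB.
Qed.

Lemma eq_Rintegral_itv_oc (p q : R) (f g : R -> R) :
  mu.-integrable `[p, q] (EFin \o g) -> (forall t, p < t <= q -> f t = g t) ->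
  \int[mu]_(t in `[p, q]) f t = \int[mu]_(t in `[p, q]) g t.
Proof.
move=> ig fg.
have ig' : mu.-integrable `]p, q] (EFin \o g).
  by apply: integrableS ig => //; exact: subset_itv_oc_cc.
have if' : mu.-integrable `]p, q] (EFin \o f).
  by apply: eq_integrableR ig' => // t; rewrite /= in_itv/= => /fg ->.
rewrite -!Rintegral_itv_obnd_cbnd//; apply: eq_Rintegral => t.
by rewrite inE/= in_itv/=; exact: fg.
Qed.

Lemma on_slab_ut_integrable (S T : R) : 0 <= S -> S <= T ->
  mu2.-integrable setT (EFin \o on_slab l r S T ut).
Proof.
move=> S0 ST; have L := L2loc_slab l_traj r_traj S0 ST L2ut.
apply: (on_slab_integrable vf_gt0 gamma_gt0 sol rho0_range l_traj r_traj
    (h := ut) (C := 1)) => //; first by case: L.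
move=> t y _ _ _; rewrite mul1r.
have := sqr_ge0 (`|ut t y| - 1); rewrite sqrrB real_normK ?num_real//.
by have := sqr_ge0 (ut t y); have := normr_ge0 (ut t y); lra.
Qed.

(** The increment formula holds on every slice, but Fubini's theorem gives integrability of [ut] in
    time only for almost every [y]. *)
Lemma ae_time_primitive (S T : R) : 0 <= S -> S <= T ->
  {ae mu, forall y, forall p q, S <= p -> p <= q -> q <= T ->
    (forall t, p <= t <= q -> l t < y < r t) ->
    primitive p q (u^~ y) (fun t => on_slab l r S T ut (t, y))}.
Proof.
move=> S0 ST.
have := ae_integrable2 (on_slab_ut_integrable S0 ST).
apply: filterS => y iy p q Sp pq qT P.
have ipq : mu.-integrable `[p, q] (EFin \o (fun t => on_slab l r S T ut (t, y))).
  exact: integrableS iy.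
split => // a b pa ab bq.
rewrite ftcu//; first last.
- move=> t at_ tb; apply: P; by rewrite (le_trans pa) ?(le_trans tb).
- exact: le_trans (le_trans S0 Sp) pa.
apply: eq_Rintegral_itv_oc; first exact: integrable_itvS ipq.
move=> t /andP[at_ tb].
have St : S < t by exact: le_lt_trans (le_trans Sp pa) at_.
rewrite /on_slab/= St (le_trans tb (le_trans bq qT))/= P//.
by rewrite (le_trans pa (ltW at_)) (le_trans tb).
Qed.

(** The equation holds almost everywhere in the plane. On almost every time section it replaces [g],
    which contains [ut], by [J], which contains only space derivatives and can be integrated by
    parts at every positive time. *)
Lemma ae_inner_le0 (S T : R) (g J : R -> R -> R) : 0 <= S ->
  mu2.-integrable setT (EFin \o on_slab l r S T g) ->
  {ae mu2, forall p, slab l r S T p -> g p.1 p.2 = J p.1 p.2} ->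
  (forall t, S < t -> t <= T -> mu.-integrable `[l t, r t] (EFin \o J t) /\
    \int[mu]_(y in `[l t, r t]) J t y <= 0) ->
  {ae mu, forall t, S < t -> t <= T ->
    \int[mu]_(y in `]l t, r t[) g t y <= 0}.
Proof.
move=> S0 ig gJ HJ.
have ig1 := ae_integrable1 ig.
have := @ae_section R (fun t y => slab l r S T (t, y) -> g t y = J t y).
have gJ' : {ae mu2, forall p, slab l r S T (p.1, p.2) -> g p.1 p.2 = J p.1 p.2}.
  by apply: (@filterS _ _ (ae_filter_ringOfSetsType _)) gJ => -[].
move=> /(_ gJ'); apply: filterS2 ig1 => t igt gJt St tT.
have [iJ J0] := HJ t St tT.
have iJ' : mu.-integrable `]l t, r t[ (EFin \o J t).
  by apply: integrableS iJ => //; exact: subset_itv_oo_cc.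
have igt' : mu.-integrable `]l t, r t[ (EFin \o g t).
  have : mu.-integrable `]l t, r t[ (EFin \o (fun y => on_slab l r S T g (t, y))).
    exact: integrableS igt.
  by apply: eq_integrableR => // y; rewrite /= in_itv/= /on_slab/= St tT => ->.
suff -> : \int[mu]_(y in `]l t, r t[) g t y = \int[mu]_(y in `[l t, r t]) J t y by [].
have -> : \int[mu]_(y in `[l t, r t]) J t y = \int[mu]_(y in `]l t, r t[) J t y.
  rewrite -Rintegral_itv_obnd_cbnd ?Rintegral_itv_bndo_bndc//.
  by apply: integrableS iJ => //; exact: subset_itv_oc_cc.
rewrite /Rintegral; congr fine; apply: ae_eq_integral => //.
- exact: (measurable_int mu igt').
- exact: (measurable_int mu iJ').
apply: filterS gJt => y H; rewrite /= in_itv/= => yI; congr EFin; apply: H.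
by rewrite /slab/= St tT yI.
Qed.

End Observer.

(** * The maximum principle for the observer *)

Section TruncationFacts.
Context {R : realType}.
Variables (k sg : R).
Hypothesis sg2 : sg ^+ 2 = 1.

Lemma normr_sg : `|sg| = 1.
Proof. by have /eqP := sg2; rewrite sqrf_eq1 => /orP[] /eqP ->; rewrite ?normrN normr1. Qed.

Lemma excess_ge0 v : 0 <= excess k sg v. Proof. exact: pos_ge0. Qed.

Lemma excess_eq0 v : sg * (k - v) <= 0 -> excess k sg v = 0.
Proof. exact: pos0. Qed.

Lemma theta_ge0 (z : R) : 0 <= z -> 0 <= theta z.
Proof.
by rewrite le_eqVlt => /predU1P[<-|/theta_gt0/ltW//]; rewrite theta0.
Qed.

Lemma Theta_ge0 (z : R) : 0 <= z -> 0 <= Theta z.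
Proof.
by rewrite le_eqVlt => /predU1P[<-|/Theta_gt0/ltW//]; rewrite Theta0.
Qed.

Lemma normr_theta_excess v : `|- sg * theta (excess k sg v)| <= 1.
Proof.
rewrite normrM normrN normr_sg mul1r ger0_norm; first exact/theta_le1/excess_ge0.
exact/theta_ge0/excess_ge0.
Qed.

Lemma is_derive_Theta_excess (v : R) :
  is_derive v (1:R) (Theta \o excess k sg) (- sg * theta (excess k sg v)).
Proof. exact: (is_derive_excess k sg v (@is_derive_Theta R) theta0). Qed.

Lemma continuous_theta_excess : continuous (fun v => - sg * theta (excess k sg v)).
Proof.
move=> v; apply: cvgM; first exact: cvg_cst.
apply: (@continuous_comp R R R (excess k sg) theta); first exact: continuous_excess.
exact: is_derive_continuous (is_derive_theta _).
Qed.

(** Turns closeness of [u] to a boundary trace, whose excess is 0, into smallness of the energy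
    density. *)
Lemma Theta_excess_lipschitz v w :
  `|Theta (excess k sg v) - Theta (excess k sg w)| <= `|v - w|.
Proof.
have cT (p q : R) : {within `[p, q], continuous (Theta \o excess k sg)}.
  by apply: derivable_within_continuous => x _; have [] := is_derive_Theta_excess x.
have H (p q : R) : p <= q ->
    `|Theta (excess k sg q) - Theta (excess k sg p)| <= `|q - p|.
  move=> pq; have [x _] := MVT_segment pq (fun x _ => is_derive_Theta_excess x) (cT p q).
  move=> /= ->; rewrite normrM ler_piMl//; exact: normr_theta_excess.
have [vw|/ltW wv] := leP v w; last exact: H.
by rewrite distrC [leRHS]distrC; exact: H.
Qed.

End TruncationFacts.

Section ObserverBound.
Context {R : realType}.
Local Notation mu := (@lebesgue_measure R).
Local Notation mu2 := (mu \x mu)%E.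

Variables (vf gamma : R) (rho0 : R -> R) (rho : R -> R -> R).
Hypotheses (vf_gt0 : 0 < vf) (gamma_gt0 : 0 < gamma).
Hypothesis sol : traffic_solution vf gamma rho0 rho.
Hypothesis rho0_range : forall y, 0 <= rho0 y <= 1.
Variables (xl xr : R) (l r : R -> R) (dM : R).
Hypotheses (l_traj : probe_trajectory vf rho xl l)
           (r_traj : probe_trajectory vf rho xr r).
Hypothesis lr : forall t : R, 0 <= t -> 0 <= r t - l t <= dM.
Variables (c : R) (u ut ux uxx : R -> R -> R).
Hypotheses (L2u : L2loc_tube l r u) (L2ut : L2loc_tube l r ut)
  (L2ux : L2loc_tube l r ux).
Hypothesis H2u : forall t : R, 0 < t -> H2 (l t) (r t) (u t) (ux t) (uxx t).
Hypothesis ftcu : forall s t y : R, 0 <= s -> s <= t ->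
  (forall tau, s <= tau -> tau <= t -> l tau < y < r tau) ->
  u t y - u s y = \int[mu]_(tau in `[s, t]) ut tau y.
Hypothesis pde : {ae mu2, forall p, tube l r p ->
  ut p.1 p.2 + vf * (1 - 2 * u p.1 p.2) * ux p.1 p.2 = gamma * uxx p.1 p.2}.
Hypothesis trace_l : forall t : R, 0 < t -> u t (l t) = rho t (l t).
Hypothesis trace_r : forall t : R, 0 < t -> u t (r t) = rho t (r t).
Hypothesis init : forall y, l 0 < y < r 0 -> u 0 y = c.

Let le_lr (t : R) : 0 <= t -> l t <= r t.
Proof. by move=> /lr /andP[]; rewrite subr_ge0. Qed.

Let incr_l := trajectory_increment vf_gt0 gamma_gt0 sol rho0_range l_traj.
Let incr_r := trajectory_increment vf_gt0 gamma_gt0 sol rho0_range r_traj.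

Lemma measurable_on_segment (a b : R) (f : R -> R) :
  {within `[a, b], continuous f} ->
  measurable_fun setT (fun y => if a < y < b then f y else 0).
Proof.
move=> cf; have mf := subspace_continuous_measurable_fun (measurable_itv _) cf.
have mf' : measurable_fun `]a, b[ f.
  by apply: measurable_funS mf => //; exact: subset_itv_oo_cc.
have -> : (fun y => if a < y < b then f y else 0) = f \_ `]a, b[.
  by apply/funext => y; rewrite patchE mem_setE in_itv/=; case: ifP.
exact: (proj1 (measurable_restrictT _ _)).
Qed.

(** The energy of the excess is zero initially, does not grow and is nonnegative, so its density
    vanishes almost everywhere, hence at every interior point by continuity; [Theta] is positive on
    positive excesses. *)
Lemma observer_bound (k sg : R) : sg ^+ 2 = 1 ->
  (forall t y, 0 <= t -> sg * (k - rho t y) <= 0) -> sg * (k - c) <= 0 ->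
  forall t y, 0 < t -> l t <= y <= r t -> sg * (k - u t y) <= 0.
Proof.
move=> sg2 rhok ck T y0 T0.
have [pu pux] := H2_primitive (H2u T0).
have cu := primitive_continuous (le_lr (ltW T0)) pu.
move=> /andP[]; rewrite le_eqVlt => /predU1P[<- _|ly0].
  by rewrite trace_l//; apply: rhok; exact: ltW.
rewrite le_eqVlt => /predU1P[->|y0r].
  by rewrite trace_r//; apply: rhok; exact: ltW.
pose G t y := Theta (excess k sg (u t y)).
pose g t y := - sg * theta (excess k sg (u t y)) * ut t y.
pose J t y := - sg * theta (excess k sg (u t y)) *
  (gamma * uxx t y - vf * (1 - 2 * u t y) * ux t y).
have T0' := ltW T0.
have Lu := L2loc_slab l_traj r_traj (lexx 0) T0' L2u.
have Lut := L2loc_slab l_traj r_traj (lexx 0) T0' L2ut.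
have cth := @continuous_theta_excess R k sg.
(* Because [theta] is at most 1, [|g| <= |ut|], and integrability extends down to time 0. *)
have ig : mu2.-integrable setT (EFin \o on_slab l r 0 T g).
  apply: (on_slab_integrable vf_gt0 gamma_gt0 sol rho0_range l_traj r_traj
    (h := ut) (C := 1)) => //.
    apply: measurable_funM; last by case: Lut.
    apply: (measurableT_comp (continuous_measurable_fun cth)).
    by case: Lu.
  move=> t y _ _ _; rewrite mul1r normrM.
  apply: le_trans (ler_wpM2r (normr_ge0 _) (@normr_theta_excess R k sg sg2 _)) _.
  rewrite mul1r.
  have := sqr_ge0 (`|ut t y| - 1); rewrite sqrrB real_normK ?num_real//.
  by have := sqr_ge0 (ut t y); have := normr_ge0 (ut t y); lra.
have slices : {ae mu, forall y,
    [/\ forall p q, 0 <= p -> p <= q -> q <= T ->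
          (forall t, p <= t <= q -> l t < y < r t) ->
          G q y - G p y = \int[mu]_(t in `[p, q]) on_slab l r 0 T g (t, y),
        forall a b, 0 <= a -> a < b -> b <= T -> r a <= y ->
          (forall t, a < t < b -> l t < y < r t) ->
          forall e : R, 0 < e -> exists2 t, a < t < b & `|G t y| <= e &
        forall a b, 0 <= a -> a < b -> b <= T -> y <= l b ->
          (forall t, a < t < b -> l t < y < r t) ->
          forall e : R, 0 < e -> exists2 t, a < t < b & `|G t y| <= e]}.
  have := ae_time_primitive vf_gt0 gamma_gt0 sol rho0_range l_traj r_traj L2ut ftcu (lexx 0) T0'.
  apply: filterS => y py; split.
  - move=> p q p0 pq qT P.
    have := primitive_comp pq (is_derive_Theta_excess k sg) cth (py p q p0 pq qT P).
    move=> [_ /(_ p q (lexx _) pq (lexx _))]; rewrite /= -/(G q y) -/(G p y) => ->.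
    apply: eq_Rintegral => t _; rewrite /on_slab/=.
    by case: ifP => // _; rewrite mulr0.
  - move=> a b a0 ab bT ray P e e0.
    have [t tab H] := trace_limit_r vf_gt0 gamma_gt0 sol rho0_range l_traj
      r_traj lr L2ux H2u trace_r a0 ab ray P e0.
    exists t => //; apply: le_trans H.
    have -> : G t y = Theta (excess k sg (u t y)) - Theta (excess k sg (rho t (r t))).
      rewrite [X in _ - Theta X]excess_eq0 ?Theta0 ?subr0//; apply: rhok.
      by case/andP: tab => /ltW/(le_trans a0).
    exact: (@Theta_excess_lipschitz R k sg sg2).
  - move=> a b a0 ab bT ylb P e e0.
    have [t tab H] := trace_limit_l vf_gt0 gamma_gt0 sol rho0_range l_traj
      r_traj lr L2ux H2u trace_l a0 ab ylb P e0.
    exists t => //; apply: le_trans H.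
    have -> : G t y = Theta (excess k sg (u t y)) - Theta (excess k sg (rho t (l t))).
      rewrite [X in _ - Theta X]excess_eq0 ?Theta0 ?subr0//; apply: rhok.
      by case/andP: tab => /ltW/(le_trans a0).
    exact: (@Theta_excess_lipschitz R k sg sg2).
have inner : {ae mu, forall t, 0 < t -> t <= T ->
    \int[mu]_(y in `]l t, r t[) g t y <= 0}.
  apply: (ae_inner_le0 (lexx 0) ig (J := J)).
    apply: (@filterS _ _ (ae_filter_ringOfSetsType _)) pde => p H pS.
    have [pt _] := slab_tube (lexx 0) (ltr_pwDr ltr01 (lexx T)) pS.
    by rewrite /g /J -H//; congr (_ * _); ring.
  move=> t t0 _; have [put puxt] := H2_primitive (H2u t0).
  apply: (truncation_integrand_le0 sg2 vf gamma_gt0 (le_lr (ltW t0)) put puxt).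
  - by rewrite trace_l//; apply: rhok; exact: ltW.
  - by rewrite trace_r//; apply: rhok; exact: ltW.
pose Gz t y := if l t < y < r t then G t y else 0.
have Gz0 : Gz 0 = cst 0.
  apply/funext => y; rewrite /Gz; case: ifP => // yI.
  by rewrite /G init// excess_eq0// Theta0.
have cGT : {within `[l T, r T], continuous (G T)}.
  move=> y; apply: (@continuous_comp (subspace `[l T, r T]) R R (u T) (Theta \o excess k sg)).
    exact: cu.
  exact: is_derive_continuous (is_derive_Theta_excess k sg _).
have mGT : measurable_fun setT (Gz T) by exact: measurable_on_segment.
have [cl _ _] := l_traj; have [cr _ _] := r_traj.
have := @energy_le R 0 T l r G g T0' _ _ _ _ ig slices inner.
rewrite -/(Gz 0) -/(Gz T) Gz0 => H.
have {H} H : (\int[mu]_y (Gz T y)%:E <= 0)%E.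
  apply: le_trans (H _ _ _ _ _ _) _ => //.
  - move=> s t s0 st _; have /andP[H' _] := incr_l s0 st; by rewrite -subr_ge0.
  - move=> s t s0 st _; have /andP[H' _] := incr_r s0 st; by rewrite -subr_ge0.
  - exact: continuous_within_itv.
  - exact: continuous_within_itv.
  - exact: integrable0.
  - by rewrite integral0_eq// => y _; rewrite -[X in X%:E]/(Gz 0 y) Gz0.
have Gz_ge0 y : 0 <= Gz T y.
  by rewrite /Gz; case: ifP => // _; exact/Theta_ge0/excess_ge0.
have ae0 : {ae mu, forall y, Gz T y <= 0}.
  have mE : measurable_fun setT (EFin \o Gz T) by exact/measurable_EFinP.
  have /(ae_eq_integral_abs mu measurableT mE) : (\int[mu]_y `|(EFin \o Gz T) y| = 0)%E.
    apply/eqP; rewrite eq_le integral_ge0 ?andbT//.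
    apply: le_trans H; rewrite le_eqVlt; apply/orP; left; apply/eqP.
    by apply: eq_integral => y _ /=; rewrite ger0_norm.
  by apply: filterS => y /(_ I) /= -[->].
have cGz : {for y0, continuous (Gz T)}.
  rewrite /prop_for /continuous_at; apply/cvgrPdist_lt => e e0.
  have y0I : l T <= y0 <= r T by rewrite !ltW.
  have [d d0 dP] := within_itv_dist y0I cGT e0.
  near=> y.
  have yI : l T < y < r T.
    apply/andP; split; near: y; [exact: lt_nbhsr|exact: lt_nbhsl].
  rewrite /Gz ly0 y0r yI /=; apply: dP.
    by case/andP: yI => /ltW -> /ltW ->.
  by near: y; exists d.
have := ae_le_continuous_at cGz ae0; rewrite /Gz ly0 y0r/= => G0.
rewrite leNgt; apply/negP => pk.
move: G0; rewrite leNgt => /negP; apply; apply: Theta_gt0.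
by rewrite /excess posE// ltW.
Unshelve. all: by end_near. Qed.

End ObserverBound.

(** * Decay of the weighted energy *)

Section LyapunovDecay.
Context {R : realType}.
Local Notation mu := (@lebesgue_measure R).
Local Notation mu2 := (mu \x mu)%E.

Variables (vf gamma : R) (rho0 : R -> R) (rho : R -> R -> R).
Hypotheses (vf_gt0 : 0 < vf) (gamma_gt0 : 0 < gamma).
Hypothesis sol : traffic_solution vf gamma rho0 rho.
Hypothesis rho0_range : forall y, 0 <= rho0 y <= 1.
Variables (xl xr : R) (l r : R -> R) (dM : R).
Hypotheses (l_traj : probe_trajectory vf rho xl l)
           (r_traj : probe_trajectory vf rho xr r).
Hypothesis lr : forall t : R, 0 <= t -> 0 <= r t - l t <= dM.
Variables (c : R) (u ut ux uxx : R -> R -> R).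
Hypotheses (L2u : L2loc_tube l r u) (L2ut : L2loc_tube l r ut)
  (L2ux : L2loc_tube l r ux).
Hypothesis H2u : forall t : R, 0 < t -> H2 (l t) (r t) (u t) (ux t) (uxx t).
Hypothesis ftcu : forall s t y : R, 0 <= s -> s <= t ->
  (forall tau, s <= tau -> tau <= t -> l tau < y < r tau) ->
  u t y - u s y = \int[mu]_(tau in `[s, t]) ut tau y.
Hypothesis pde : {ae mu2, forall p, tube l r p ->
  ut p.1 p.2 + vf * (1 - 2 * u p.1 p.2) * ux p.1 p.2 = gamma * uxx p.1 p.2}.
Hypothesis trace_l : forall t : R, 0 < t -> u t (l t) = rho t (l t).
Hypothesis trace_r : forall t : R, 0 < t -> u t (r t) = rho t (r t).
Hypothesis init : forall y, l 0 < y < r 0 -> u 0 y = c.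

Let le_lr (t : R) : 0 <= t -> l t <= r t.
Proof. by move=> /lr /andP[]; rewrite subr_ge0. Qed.

Let incr_l := trajectory_increment vf_gt0 gamma_gt0 sol rho0_range l_traj.
Let incr_r := trajectory_increment vf_gt0 gamma_gt0 sol rho0_range r_traj.

Variables (xi beta p0 p1 rm rM : R).
Hypotheses (beta_gt0 : 0 < beta) (xi_gt0 : 0 < xi) (p0_gt0 : 0 < p0).
Hypothesis lmi : forall rb : R, rm <= rb <= rM -> forall p q : R,
  (Psi11 vf gamma rm rM p0 p1 xi rb + 2 * xi * beta) * p ^+ 2
  + 2 * (p1 - 2 * vf * rb) * p * q
  + (- 2 + p0 * (dM ^+ 2 / (gamma * pi ^+ 2)) * expR (xi * gamma^-1 * dM))
    * q ^+ 2 <= 0.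
Hypothesis rho_range : forall t y : R, 0 <= t -> rm <= rho t y <= rM.
Hypothesis u_range : forall t y : R, 0 < t -> l t <= y <= r t -> rm <= u t y <= rM.
Hypotheses (rm_ge0 : 0 <= rm) (rM_le1 : rM <= 1).

Local Notation s := (xi * gamma^-1).
Local Notation kappa := (2 * xi * gamma^-1 * beta).

(* The factor [expR (kappa * t)] absorbs the decay rate, so that the weighted
   energy only has to be nonincreasing. *)
Definition weight (t y : R) := expR (kappa * t) * expR (s * (y - l t)).

Definition error_density (t y : R) := weight t y * (rho t y - u t y) ^+ 2.

Definition lyapunov (t : R) : \bar R :=
  (\int[mu]_y (if l t < y < r t then error_density t y else 0)%:E)%E.

Let s_ge0 : 0 <= s.
Proof. by rewrite mulr_ge0 ?invr_ge0 ?(ltW xi_gt0) ?(ltW gamma_gt0). Qed.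

Let kappa_ge0 : 0 <= kappa.
Proof.
by rewrite !mulr_ge0 ?invr_ge0 ?(ltW xi_gt0) ?(ltW gamma_gt0) ?(ltW beta_gt0).
Qed.

Lemma weight_ge (t y : R) : 0 <= t -> l t <= y -> expR (kappa * t) <= weight t y.
Proof.
move=> t0 ly; rewrite /weight ler_peMr ?expR_ge0// one_le_expR//.
by rewrite mulr_ge0 ?subr_ge0.
Qed.

Lemma weight_le (t y T : R) : 0 <= t -> t <= T -> y <= r t ->
  weight t y <= expR (kappa * T) * expR (s * dM).
Proof.
move=> t0 tT yr; apply: ler_pM; rewrite ?expR_ge0// ler_expR ler_wpM2l//.
by have /andP[_ H] := lr t0; apply: le_trans H; rewrite lerB.
Qed.

Lemma traffic_box_bound (w : seq bool) (S T a b : R) : 0 < S ->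
  exists2 C : R, 0 < C &
    forall t y, S <= t <= T -> a <= y <= b -> `|pderiv w rho t y| <= C.
Proof.
move=> S0; pose K := `[S, T] `*` `[a, b] : set (R * R).
have cK : compact K by apply: compact_setX; exact: segment_compact.
have cf : {within K, continuous (fun p : R * R => pderiv w rho p.1 p.2)}.
  apply: continuous_in_subspaceT => -[t y] /set_mem[/=].
  rewrite in_itv/= => /andP[St tT] _.
  exact: (@traffic_continuous R vf gamma rho0 rho sol w t y (lt_le_trans S0 St)).
have := compact_bounded (continuous_compact cf cK).
move=> /ex_strict_bound_gt0 [C C0 CP]; exists C => // t y tI yI.
by apply/ltW/CP; exists (t, y).
Qed.

Lemma error_le1 (t y : R) : 0 < t -> l t <= y <= r t -> `|rho t y - u t y| <= 1.
Proof.
move=> t0 yI; have /andP[h1 h2] := rho_range y (ltW t0).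
have /andP[h3 h4] := u_range t0 yI; have h5 := rm_ge0; have h6 := rM_le1.
by rewrite ler_norml; apply/andP; split; lra.
Qed.

Lemma measurable_on_fst (S T : R) (f : R -> R) : 0 <= S ->
  measurable_fun `]S, T] f -> measurable_fun (slab l r S T) (fun p => f p.1).
Proof.
move=> S0 mf; apply: (@measurable_comp _ _ _ _ _ _ `]S, T]) => //.
  by move=> _ [p /andP[pI _] <-]; rewrite /= in_itv.
exact: measurable_funS (@measurable_fst _ _ _ _).
Qed.

Lemma open_positive_time : open [set p : R * R | 0 < p.1].
Proof.
have -> : [set p : R * R | 0 < p.1] = fst @^-1` [set x : R | 0 < x] by [].
by apply: open_comp; [move=> p _; exact: cvg_fst|exact: open_gt].
Qed.

Lemma measurable_traffic (w : seq bool) :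
  measurable_fun [set p : R * R | 0 < p.1] (fun p => pderiv w rho p.1 p.2).
Proof.
apply: continuous_measurable_prod; first exact: open_positive_time.
move=> [t y] /= t0.
exact: (@traffic_continuous R vf gamma rho0 rho sol w t y t0).
Qed.

Lemma continuous_time_slice (f : R -> R -> R) (x : R -> R) (t : R) :
  {for (t, x t), continuous (fun p : R * R => f p.1 p.2)} ->
  {for t, continuous x} -> {for t, continuous (fun t => f t (x t))}.
Proof.
move=> cf cx; apply: (@continuous_comp R (R * R)%type R (fun t : R => (t, x t))
  (fun p => f p.1 p.2)); last exact: cf.
by apply: (@cvg_pair _ _ _ _ (nbhs t) (nbhs (x t))); [exact: cvg_id|exact: cx].
Qed.

Lemma measurable_traffic_trajectory (x0 : R) (x : R -> R) (S T : R) : 0 <= S ->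
  probe_trajectory vf rho x0 x -> measurable_fun `]S, T] (fun t => rho t (x t)).
Proof.
move=> S0 [_ dx _].
have m : measurable_fun (`]0, +oo[%classic : set R) (fun t => rho t (x t)).
  apply: open_continuous_measurable_fun; first exact: interval_open.
  move=> t; rewrite inE/= in_itv/= andbT => t0.
  apply: (@continuous_time_slice rho x).
    exact: (@traffic_continuous R vf gamma rho0 rho sol [::] t (x t) t0).
  exact: is_derive_continuous (dx t t0).
apply: measurable_funS m => // t; rewrite /= !in_itv/= andbT => /andP[St _].
exact: le_lt_trans St.
Qed.

(** The product rule applied to [error_density]. The first factor is the logarithmic derivative of
    the weight, whose origin [l t] moves with speed [vf * (1 - rho t (l t))]. *)
Definition error_density_dt (t y : R) :=
  (kappa - s * (vf * (1 - rho t (l t)))) * weight t y * (rho t y - u t y) ^+ 2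
  + 2 * weight t y * (rho t y - u t y) * (Dt rho t y - ut t y).

Lemma error_density_dt_integrable (S T : R) : 0 < S -> S <= T ->
  mu2.-integrable setT (EFin \o on_slab l r S T error_density_dt).
Proof.
move=> S0 ST; have S0' := ltW S0.
have Lu := L2loc_slab l_traj r_traj S0' ST L2u.
have Lut := L2loc_slab l_traj r_traj S0' ST L2ut.
have [C C0 CP] := traffic_box_bound [:: true] T (l S) (r T) S0.
pose W1 := expR (kappa * T) * expR (s * dM).
have W10 : 0 < W1 by rewrite mulr_gt0// expR_gt0.
(* With the weight at most [W1] and the error at most 1, the two terms are bounded by
   [W1 (kappa + s vf)] and [2 W1 (C + 1 + ut^2)]. *)
apply: (on_slab_integrable vf_gt0 gamma_gt0 sol rho0_range l_traj r_traj
  (h := ut) (C := W1 * (kappa + s * vf + 2 * C + 2))) => //.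
- have sub : slab l r S T `<=` [set p : R * R | 0 < p.1].
    by move=> p /andP[/andP[Sp _] _]; exact: lt_trans Sp.
  have mo := open_measurable_prod open_positive_time.
  have mr : measurable_fun (slab l r S T) (fun p => rho p.1 p.2).
    exact: measurable_funS mo sub (measurable_traffic [::]).
  have mrt : measurable_fun (slab l r S T) (fun p => Dt rho p.1 p.2).
    exact: measurable_funS mo sub (measurable_traffic [:: true]).
  have [mu' _] := Lu; have [mut _] := Lut.
  have ml : measurable_fun (slab l r S T) (fun p => l p.1).
    exact: (@measurable_on_fst S T l S0' (measurable_trajectory l_traj S0')).
  have mrl : measurable_fun (slab l r S T) (fun p => rho p.1 (l p.1)).
    apply: (@measurable_on_fst S T (fun t => rho t (l t)) S0').
    exact: measurable_traffic_trajectory l_traj.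
  have m1 : measurable_fun (slab l r S T) (fun p : R * R => p.1).
    exact: measurable_funS (@measurable_fst _ _ _ _).
  have m2 : measurable_fun (slab l r S T) (fun p : R * R => p.2).
    exact: measurable_funS (@measurable_snd _ _ _ _).
  have mW : measurable_fun (slab l r S T) (fun p => weight p.1 p.2).
    apply: measurable_funM; apply: measurableT_comp => //.
      exact: measurable_funM.
    apply: measurable_funM => //; exact: measurable_funB.
  have me : measurable_fun (slab l r S T) (fun p => rho p.1 p.2 - u p.1 p.2).
    exact: measurable_funB.
  apply: measurable_funD.
    apply: measurable_funM; last exact: measurable_funX.
    apply: measurable_funM => //; apply: measurable_funB => //.
    apply: measurable_funM => //; apply: measurable_funM => //.
    exact: measurable_funB.
  apply: measurable_funM; last exact: measurable_funB.
  apply: measurable_funM => //; exact: measurable_funM.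
- move=> t y St tT /andP[ly yr].
  have t0 := lt_trans S0 St.
  have lyr : l t <= y <= r t by rewrite !ltW.
  have e1 := error_le1 t0 lyr.
  have Wle : weight t y <= W1 by exact: weight_le (ltW t0) tT (ltW yr).
  have W0 : 0 <= weight t y by rewrite mulr_ge0 ?expR_ge0.
  have rt : `|Dt rho t y| <= C.
    apply: (CP t y); rewrite ?(ltW St) ?tT//.
    have /andP[H1 _] := incr_l S0' (ltW St); have /andP[H2' _] := incr_r (ltW t0) tT.
    by apply/andP; split; lra.
  have k1 : `|kappa - s * (vf * (1 - rho t (l t)))| <= kappa + s * vf.
    have /andP[r0 r1] := traffic_range gamma_gt0 sol rho0_range (l t) (ltW t0).
    apply: le_trans (ler_normB _ _) _; rewrite (ger0_norm kappa_ge0) lerD2l.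
    rewrite normrM (ger0_norm s_ge0) ler_wpM2l// normrM (gtr0_norm vf_gt0).
    by rewrite ler_piMr ?(ltW vf_gt0)// ger0_norm ?subr_ge0// gerBl.
  have esq : (rho t y - u t y) ^+ 2 <= 1.
    by rewrite -real_normK ?num_real// expr_le1.
  have uts : `|ut t y| <= 1 + ut t y ^+ 2.
    have := sqr_ge0 (`|ut t y| - 1); rewrite sqrrB real_normK ?num_real//.
    by have := sqr_ge0 (ut t y); have := normr_ge0 (ut t y); lra.
  have ut2 := sqr_ge0 (ut t y).
  rewrite /error_density_dt; move: (weight t y) Wle W0 => W Wle W0.
  have T1 : `|(kappa - s * (vf * (1 - rho t (l t)))) * W *
      (rho t y - u t y) ^+ 2| <= (kappa + s * vf) * W1.
    rewrite normrM normrM (ger0_norm W0) (ger0_norm (sqr_ge0 _)).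
    rewrite -[leRHS]mulr1; apply: ler_pM => //; first by rewrite mulr_ge0.
      by rewrite sqr_ge0.
    by apply: ler_pM.
  have T2 : `|2 * W * (rho t y - u t y) * (Dt rho t y - ut t y)|
      <= 2 * W1 * (C + (1 + ut t y ^+ 2)).
    rewrite normrM normrM normrM (ger0_norm W0) (ger0_norm (ler0n R 2)).
    apply: ler_pM => //; first by rewrite !mulr_ge0.
      rewrite -[leRHS]mulr1; apply: ler_pM => //; first by rewrite mulr_ge0.
      by rewrite ler_pM2l.
    by apply: le_trans (ler_normB _ _) _; exact: lerD.
  apply: le_trans (ler_normD _ _) _; apply: le_trans (lerD T1 T2) _.
  have ksv : 0 <= kappa + s * vf by rewrite addr_ge0// mulr_ge0// ltW.
  have H1 : 0 <= W1 * ((kappa + s * vf) * ut t y ^+ 2).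
    by apply: mulr_ge0; [exact: ltW|exact: mulr_ge0].
  have H2' : 0 <= W1 * (C * ut t y ^+ 2).
    by apply: mulr_ge0; [exact: ltW|apply: mulr_ge0 => //; exact: ltW].
  move: (kappa + s * vf) H1 => k H1; lra.
Qed.

Lemma time_derivative_primitive (p q : R) (f df : R -> R) : 0 < p -> p <= q ->
  (forall t : R, 0 < t -> is_derive t (1:R) f (df t)) ->
  (forall t : R, 0 < t -> {for t, continuous df}) -> primitive p q f df.
Proof.
move=> pp0 pq d cd; apply: primitive_C1 => // t /andP[pt _].
  by apply: d; exact: lt_le_trans pt.
by apply: cd; exact: lt_le_trans pt.
Qed.

Lemma weight_primitive (p q y : R) : 0 < p -> p <= q ->
  primitive p q (weight^~ y)
    (fun t => (kappa - s * (vf * (1 - rho t (l t)))) * weight t y).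
Proof.
have [_ dl _] := l_traj.
have dW (t : R) : 0 < t -> is_derive t (1:R) (weight^~ y)
    ((kappa - s * (vf * (1 - rho t (l t)))) * weight t y).
  move=> t0; have dlt := dl t t0.
  have d1 : is_derive t (1:R) (fun t : R => kappa * t) kappa.
    by apply: is_derive_eq; rewrite /GRing.scale/=; ring.
  have d2 : is_derive t (1:R) (fun t : R => s * (y - l t)) (- (s * (vf * (1 - rho t (l t))))).
    by apply: is_derive_eq; rewrite /GRing.scale/=; ring.
  have e1 := @is_derive1_comp R expR (fun t => kappa * t) t _ _ (is_derive_expR _) d1.
  have e2 := @is_derive1_comp R expR (fun t => s * (y - l t)) t _ _ (is_derive_expR _) d2.
  apply: (is_derive_eq (is_deriveM e1 e2)).
  by rewrite /GRing.scale/= /weight; ring.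
move=> pp0 pq; apply: (time_derivative_primitive pp0 pq dW) => t t0.
apply: cvgM; last exact: is_derive_continuous (dW t t0).
apply: cvgB; first exact: cvg_cst.
apply: cvgM; first exact: cvg_cst.
apply: cvgM; first exact: cvg_cst.
apply: cvgB; first exact: cvg_cst.
apply: (@continuous_time_slice rho l).
  exact: (@traffic_continuous R vf gamma rho0 rho sol [::] t (l t) t0).
exact: is_derive_continuous (dl t t0).
Qed.

Lemma traffic_time_primitive (p q y : R) : 0 < p -> p <= q ->
  primitive p q (rho^~ y) (fun t => Dt rho t y).
Proof.
move=> pp0 pq; apply: (time_derivative_primitive pp0 pq) => t t0.
  by have [] := traffic_derive sol y t0.
apply: (@continuous_time_slice (Dt rho) (fun=> y)); last exact: cvg_cst.
exact: (@traffic_continuous R vf gamma rho0 rho sol [:: true] t y t0).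
Qed.

Lemma traffic_lipschitz (S T a b : R) : 0 < S -> exists2 C : R, 0 < C &
  forall t y z, S <= t <= T -> a <= y -> y <= z -> z <= b ->
    `|rho t z - rho t y| <= C * (z - y).
Proof.
move=> S0; have [C C0 CP] := traffic_box_bound [:: false] T a b S0.
exists C => // t y z tI ay yz zb.
have t0 : 0 < t by case/andP: tI => /(lt_le_trans S0).
have d x : is_derive x (1:R) (rho t) (Dx rho t x).
  by have [] := traffic_derive sol x t0.
have [|x xI ->] := @MVT_segment R (rho t) (Dx rho t) y z yz.
  by apply: derivable_within_continuous => x _; have [] := d x.
move: xI; rewrite in_itv/= => /andP[yx xz].
rewrite normrM (ger0_norm (x := z - y)) ?subr_ge0// ler_wpM2r ?subr_ge0//.
by apply: (CP t x tI); rewrite (le_trans ay yx) (le_trans xz zb).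
Qed.

(** Linear in [e], since one of the two error factors is at most 1. *)
Lemma error_density_le (t y e T : R) : 0 < t -> t <= T -> l t <= y <= r t ->
  `|rho t y - u t y| <= e ->
  `|error_density t y| <= expR (kappa * T) * expR (s * dM) * e.
Proof.
move=> t0 tT lyr e1; rewrite /error_density normrM.
have e0 : 0 <= e by exact: le_trans e1.
apply: ler_pM => //.
  rewrite ger0_norm ?mulr_ge0 ?expR_ge0//; apply: weight_le => //; first exact: ltW.
  by case/andP: lyr.
rewrite normrX expr2; apply: le_trans e1.
by rewrite ler_piMl// error_le1.
Qed.

Lemma error_density_continuous (t : R) : 0 < t ->
  {within `[l t, r t], continuous (error_density t)}.
Proof.
move=> t0; have [put _] := H2_primitive (H2u t0).
have cut := primitive_continuous (le_lr (ltW t0)) put.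
have crt : {within `[l t, r t], continuous (rho t)}.
  apply: continuous_subspaceT.
  exact: (@traffic_slice_continuous R vf gamma rho0 rho sol [::] t t0).
have cwt : {within `[l t, r t], continuous (weight t)}.
  apply: continuous_subspaceT => y.
  exact: is_derive_continuous (is_derive_exp_affine _ _ _ _).
have ce : {within `[l t, r t], continuous (fun y => rho t y - u t y)}.
  by move=> y; apply: (@cvgB _ _ _ (nbhs y)); [exact: crt|exact: cut].
exact: (within_continuousM cwt (within_continuousM ce ce)).
Qed.

Lemma lyapunov_nonincreasing (S T : R) : 0 < S -> S <= T ->
  (lyapunov T <= lyapunov S)%E.
Proof.
move=> S0 ST; have S0' := ltW S0; have T0 := lt_le_trans S0 ST.
have ig := error_density_dt_integrable S0 ST.
pose W1 := expR (kappa * T) * expR (s * dM).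
have W10 : 0 < W1 by rewrite mulr_gt0// expR_gt0.
have [C C0 CP] := traffic_lipschitz T (l S) (r T) S0.
have box (t y : R) : S <= t <= T -> l t <= y <= r t -> l S <= y <= r T.
  move=> /andP[St tT] /andP[ly yr].
  have /andP[H1 _] := incr_l S0' St.
  have /andP[H2' _] := incr_r (le_trans S0' St) tT.
  by apply/andP; split; lra.
have slices : {ae mu, forall y,
    [/\ forall p q, S <= p -> p <= q -> q <= T ->
          (forall t, p <= t <= q -> l t < y < r t) ->
          error_density q y - error_density p y
            = \int[mu]_(t in `[p, q]) on_slab l r S T error_density_dt (t, y),
        forall a b, S <= a -> a < b -> b <= T -> r a <= y ->
          (forall t, a < t < b -> l t < y < r t) ->
          forall e : R, 0 < e -> exists2 t, a < t < b & `|error_density t y| <= e &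
        forall a b, S <= a -> a < b -> b <= T -> y <= l b ->
          (forall t, a < t < b -> l t < y < r t) ->
          forall e : R, 0 < e -> exists2 t, a < t < b & `|error_density t y| <= e]}.
  have := ae_time_primitive vf_gt0 gamma_gt0 sol rho0_range l_traj r_traj L2ut ftcu S0' ST.
  apply: filterS => y py; split.
  - move=> p q Sp pq qT P; have pp0 := lt_le_trans S0 Sp.
    have pe := primitive_sqr pq (primitiveB (traffic_time_primitive y pp0 pq)
      (py p q Sp pq qT P)).
    have [iG GE] := primitiveM pq (weight_primitive y pp0 pq) pe.
    have := GE p q (lexx _) pq (lexx _).
    rewrite -/(error_density q y) -/(error_density p y) => ->.
    apply/esym; apply: (eq_Rintegral_itv_oc iG) => t /andP[pt tq].
    have St := le_lt_trans Sp pt; have tT := le_trans tq qT.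
    have tI : l t < y < r t by apply: P; rewrite (ltW pt).
    by rewrite /on_slab/= St tT tI/= /error_density_dt; ring.
  - move=> a b Sa ab bT ray P e e0; have a0 := lt_le_trans S0 Sa.
    have d0 : 0 < e / (2 * W1) / (C * vf).
      by apply: divr_gt0; [apply: divr_gt0 => //|]; exact: mulr_gt0.
    have e20 : 0 < e / (2 * W1) by rewrite divr_gt0// mulr_gt0.
    (* Near the boundary the error splits into a variation of [rho], at most [C vf (t - a)], and the
       distance of [u] to its trace. Shortening the interval keeps the first below [e / (2 W1)]; the
       second is made as small by the choice of [t]. *)
    pose b' := Num.min b (a + e / (2 * W1) / (C * vf)).
    have ab' : a < b' by rewrite lt_min ab ltrDl.
    have P' t : a < t < b' -> l t < y < r t.
      by rewrite lt_min => /andP[at_ /andP[tb _]]; apply: P; rewrite at_.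
    have [t tab H] := trace_limit_r vf_gt0 gamma_gt0 sol rho0_range l_traj
      r_traj lr L2ux H2u trace_r (ltW a0) ab' ray P' e20.
    move: tab; rewrite lt_min => /andP[at_ /andP[tb tab]].
    have tabb : a < t < b by rewrite at_.
    have t0 := lt_trans a0 at_.
    have tT := le_trans (ltW tb) bT.
    have St := le_trans Sa (ltW at_).
    exists t => //; have /andP[ly yr] := P t tabb.
    have lyr : l t <= y <= r t by rewrite !ltW.
    have -> : e = W1 * (e / W1) by rewrite mulrC divfK ?gt_eqF.
    apply: error_density_le => //.
    have STt : S <= t <= T by rewrite St.
    have /andP[ly' _] := box t y STt lyr.
    have lrr : l t <= r t <= r t by rewrite le_lr ?lexx// ltW.
    have /andP[_ rr'] := box t (r t) STt lrr.
    have H1 := CP t y (r t) STt ly' (ltW yr) rr'.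
    have /andP[_ Hr] := incr_r (ltW a0) (ltW at_).
    have H2' : C * (r t - y) <= e / (2 * W1).
      have : C * (r t - y) <= C * (vf * (t - a)).
        by rewrite ler_pM2l//; apply: le_trans Hr; rewrite lerB.
      move=> H2'; apply: le_trans H2' _; rewrite mulrA mulrC.
      by rewrite -ler_pdivlMr ?mulr_gt0// lerBlDl ltW.
    have -> : rho t y - u t y = - (rho t (r t) - rho t y) - (u t y - rho t (r t)).
      by ring.
    apply: le_trans (ler_normB _ _) _; rewrite normrN.
    have -> : e / W1 = e / (2 * W1) + e / (2 * W1) by field; rewrite gt_eqF.
    by apply: lerD => //; exact: le_trans H2'.
  - move=> a b Sa ab bT ylb P e e0; have a0 := lt_le_trans S0 Sa.
    have b0 := lt_trans a0 ab.
    have d0 : 0 < e / (2 * W1) / (C * vf).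
      by apply: divr_gt0; [apply: divr_gt0 => //|]; exact: mulr_gt0.
    have e20 : 0 < e / (2 * W1) by rewrite divr_gt0// mulr_gt0.
    pose a' := Num.max a (b - e / (2 * W1) / (C * vf)).
    have ab' : a' < b by rewrite gt_max ab ltrBlDr ltrDl.
    have aa' : a <= a' by rewrite le_max lexx.
    have P' t : a' < t < b -> l t < y < r t.
      by rewrite gt_max => /andP[/andP[at_ _] tb]; apply: P; rewrite at_.
    have [t tab H] := trace_limit_l vf_gt0 gamma_gt0 sol rho0_range l_traj
      r_traj lr L2ux H2u trace_l (le_trans (ltW a0) aa') ab' ylb P' e20.
    move: tab; rewrite gt_max => /andP[/andP[at_ tab] tb].
    have tabb : a < t < b by rewrite at_.
    have t0 := lt_trans a0 at_.
    have tT := le_trans (ltW tb) bT.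
    have St := le_trans Sa (ltW at_).
    exists t => //; have /andP[ly yr] := P t tabb.
    have lyr : l t <= y <= r t by rewrite !ltW.
    have -> : e = W1 * (e / W1) by rewrite mulrC divfK ?gt_eqF.
    apply: error_density_le => //.
    have STt : S <= t <= T by rewrite St.
    have /andP[_ yr'] := box t y STt lyr.
    have lll : l t <= l t <= r t by rewrite le_lr ?lexx// ltW.
    have /andP[ll' _] := box t (l t) STt lll.
    have H1 := CP t (l t) y STt ll' (ltW ly) yr'.
    have /andP[_ Hl] := incr_l (ltW t0) (ltW tb).
    have H2' : C * (y - l t) <= e / (2 * W1).
      have : C * (y - l t) <= C * (vf * (b - t)).
        by rewrite ler_pM2l//; apply: le_trans Hl; rewrite lerB.
      move=> H2'; apply: le_trans H2' _; rewrite mulrA mulrC.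
      by rewrite -ler_pdivlMr ?mulr_gt0// lerBlDl -lerBlDr ltW.
    have -> : rho t y - u t y = (rho t y - rho t (l t)) - (u t y - rho t (l t)).
      by ring.
    apply: le_trans (ler_normB _ _) _.
    have -> : e / W1 = e / (2 * W1) + e / (2 * W1) by field; rewrite gt_eqF.
    by apply: lerD => //; exact: le_trans H2'.
have inner : {ae mu, forall t, S < t -> t <= T ->
    \int[mu]_(y in `]l t, r t[) error_density_dt t y <= 0}.
  have [_ _ rpde _] := sol.
  pose J t y := (kappa - s * (vf * (1 - rho t (l t)))) * weight t y * (rho t y - u t y) ^+ 2
    + 2 * weight t y * (rho t y - u t y)
      * ((gamma * Dx (Dx rho) t y - vf * (1 - 2 * rho t y) * Dx rho t y)
        - (gamma * uxx t y - vf * (1 - 2 * u t y) * ux t y)).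
  apply: (ae_inner_le0 S0' ig (J := J)).
    apply: (@filterS _ _ (ae_filter_ringOfSetsType _)) pde => p H pS.
    have [pt _] := slab_tube S0' (ltr_pwDr ltr01 (lexx T)) pS.
    have p10 : 0 < p.1 by case: pt.
    have E1 := H pt; have E2 := rpde p.1 p.2 p10.
    by rewrite /error_density_dt /J -E1 -E2; congr (_ + _ * _); ring.
  move=> t St _; have t0 := lt_trans S0 St.
  have [put puxt] := H2_primitive (H2u t0).
  have lrt := le_lr (ltW t0).
  have drho y := traffic_derive sol y t0.
  have prho : primitive (l t) (r t) (rho t) (Dx rho t).
    apply: primitive_C1 => // y _; first by have [] := drho y.
    exact: (@traffic_slice_continuous R vf gamma rho0 rho sol [:: false] t t0 y).
  have prhox : primitive (l t) (r t) (Dx rho t) (Dx (Dx rho) t).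
    have d2 y : is_derive y (1:R) (Dx rho t) (Dx (Dx rho) t y).
      by have [] := drho y.
    apply: (primitive_C1 lrt (fun y _ => d2 y)) => y _.
    exact: (@traffic_slice_continuous R vf gamma rho0 rho sol [:: false; false] t t0 y).
  have /andP[_ lrd] := lr (ltW t0).
  apply: (lyapunov_integrand_le0 vf_gt0 gamma_gt0 xi_gt0 p0_gt0
    (expR_gt0 (kappa * t)) lmi lrt lrd prho prhox put puxt).
  - by move=> y _; apply: rho_range; exact: ltW.
  - by move=> y yI; have /andP[] := u_range t0 yI.
  - exact: trace_l.
  - exact: trace_r.
have cG := error_density_continuous.
apply: (@energy_le R S T l r error_density error_density_dt ST _ _ _ _ ig slices inner).
- by move=> a b Sa ab _; have /andP[H _] := incr_l (le_trans S0' Sa) ab; rewrite -subr_ge0.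
- by move=> a b Sa ab _; have /andP[H _] := incr_r (le_trans S0' Sa) ab; rewrite -subr_ge0.
- by have [cl _ _] := l_traj; exact: continuous_within_itv.
- by have [cr _ _] := r_traj; exact: continuous_within_itv.
- have iG := continuous_integrable_itv (cG S S0).
  have iG' : mu.-integrable `]l S, r S[ (EFin \o error_density S).
    by apply: integrableS iG => //; exact: subset_itv_oo_cc.
  have I := proj1 (@integrable_mkcond _ _ R mu `]l S, r S[
    (EFin \o error_density S) (measurable_itv _)) iG'.
  apply: eq_integrable I => // y _.
  by rewrite patchE /= mem_setE in_itv/=; case: ifP.
- exact: measurable_on_segment (cG T T0).
Qed.

Hypothesis rho0_measurable : measurable_fun setT rho0.

(** A sequence, so that the exceptional null sets of all its times have a null union. *)
Lemma small_times (T : R) : 0 < T -> exists sn : nat -> R, forall n,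
  [/\ 0 < sn n, sn n <= T, sn n <= n.+1%:R^-1 &
      {ae mu, forall y, `|rho (sn n) y - rho 0 y| <= n.+1%:R^-1}].
Proof.
move=> T0.
suff H n : exists t : R, [/\ 0 < t, t <= T, t <= n.+1%:R^-1 &
    {ae mu, forall y, `|rho t y - rho 0 y| <= n.+1%:R^-1}].
  by have [sn snP] := choice H; exists sn.
have n0 : 0 < n.+1%:R^-1 :> R by rewrite invr_gt0.
have [d d0 dP] := traffic_Linfty_near sol (lexx 0) n0.
exists (Num.min T (Num.min n.+1%:R^-1 (d / 2))).
have t0 : 0 < Num.min T (Num.min n.+1%:R^-1 (d / 2)).
  by rewrite !lt_min T0 n0 divr_gt0.
split => //; [by rewrite ge_min lexx|by rewrite !ge_min lexx orbT|].
apply: dP; first exact: ltW.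
rewrite sub0r normrN gtr0_norm// !gt_min; apply/orP; right; apply/orP; right.
by rewrite ltr_pdivrMr// ltr_pMr// ltr1n.
Qed.

Lemma ae_neq (a : R) : {ae mu, forall y, y <> a}.
Proof.
exists [set a]; split => //; first exact: lebesgue_measure_set1.
by move=> y /= /contrapT.
Qed.

(** Away from the two initial positions, membership in the moving interval is eventually constant.
    Inside, [rho] converges by the choice of times and [u] because it is a primitive in time on its
    slice. *)
Lemma error_density_cvg0 (T y : R) (sn : nat -> R) : 0 < T ->
  (forall n, [/\ 0 < sn n, sn n <= T & sn n <= n.+1%:R^-1]) ->
  (forall n, `|rho (sn n) y - rho 0 y| <= n.+1%:R^-1) ->
  y <> l 0 -> y <> r 0 ->
  (forall p q, 0 <= p -> p <= q -> q <= T ->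
    (forall t, p <= t <= q -> l t < y < r t) ->
    primitive p q (u^~ y) (fun t => on_slab l r 0 T ut (t, y))) ->
  (if l (sn n) < y < r (sn n) then error_density (sn n) y else 0) @[n --> \oo]
    --> (if l 0 < y < r 0 then error_density 0 y else 0).
Proof.
move=> T0 snP rhoP yl yr py.
have sn0 n : 0 <= sn n by have [/ltW] := snP n.
have small (e : R) : 0 < e -> \forall n \near \oo, sn n < e.
  move=> e0; have := near_infty_natSinv_lt (PosNum e0); apply: filterS => n.
  by apply: le_lt_trans; have [] := snP n.
have sncvg : sn n @[n --> \oo] --> (0 : R).
  apply/cvgrPdist_lt => e e0; have := small e e0; apply: filterS => n.
  by rewrite sub0r normrN ger0_norm.
have smallv (e : R) : 0 < e -> \forall n \near \oo, vf * sn n < e.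
  move=> e0; have := small _ (divr_gt0 e0 vf_gt0); apply: filterS => n.
  by rewrite ltr_pdivlMr// mulrC.
have li n : 0 <= l (sn n) - l 0 <= vf * sn n.
  by have := incr_l (lexx 0) (sn0 n); rewrite subr0.
have ri n : 0 <= r (sn n) - r 0 <= vf * sn n.
  by have := incr_r (lexx 0) (sn0 n); rewrite subr0.
have [yl0|ly0|/yl//] := ltgtP y (l 0).
  rewrite /=; apply: cvg_near_cst; near=> n.
  rewrite ifF//; apply/negP => /andP[H _].
  by have /andP[H' _] := li n; lra.
have [y0r|ry0|/yr//] := ltgtP y (r 0); last first.
  rewrite andbF; apply: cvg_near_cst.
  have := smallv (y - r 0); rewrite subr_gt0 => /(_ ry0); apply: filterS => n H.
  rewrite ifF//; apply/negP => /andP[_ H1].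
  by have /andP[_ H2'] := ri n; lra.
rewrite /=.
have y0l : 0 < y - l 0 by rewrite subr_gt0.
have ev : \forall n \near \oo, l (sn n) < y < r (sn n).
  have := smallv _ y0l; apply: filterS => n H.
  have /andP[_ H1] := li n; have /andP[H2' _] := ri n.
  by apply/andP; split; lra.
have lcvg : l (sn n) @[n --> \oo] --> l 0.
  apply/cvgrPdist_lt => e e0; have := smallv _ e0; apply: filterS => n H.
  have /andP[H1 H2'] := li n.
  by rewrite distrC ger0_norm//; exact: le_lt_trans H.
have rcvg : rho (sn n) y @[n --> \oo] --> rho 0 y.
  apply/cvgrPdist_lt => e e0; have := near_infty_natSinv_lt (PosNum e0).
  by apply: filterS => n; rewrite distrC; apply: le_lt_trans.
have ucvg : u (sn n) y @[n --> \oo] --> u 0 y.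
  (* At speed at most [vf], the left probe has covered at most half of its distance to [y] by time
     [d], so the slice is inside the domain on [[0, d]]. *)
  pose d := Num.min T ((y - l 0) / (2 * vf)).
  have d0 : 0 < d by rewrite lt_min T0 divr_gt0// mulr_gt0.
  have P t : 0 <= t <= d -> l t < y < r t.
    move=> /andP[t0]; rewrite le_min => /andP[tT td].
    have /andP[_ H1] := incr_l (lexx 0) t0; have /andP[H2' _] := incr_r (lexx 0) t0.
    have H3 : vf * t <= (y - l 0) / 2.
      rewrite mulrC -ler_pdivlMr//; apply: le_trans td _.
      by rewrite invfM mulrA.
    by rewrite subr0 in H1; apply/andP; split; lra.
  have dT : d <= T by rewrite ge_min lexx.
  have pu := py 0 d (lexx _) (ltW d0) dT P.
  have cu := primitive_continuous (ltW d0) pu.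
  apply/cvgrPdist_lt => e e0.
  have [|d' d'0 dP] := within_itv_dist _ cu (x := 0) e0; first by rewrite lexx ltW.
  have H1 := small _ d0; have H2' := small _ d'0.
  near=> n; apply: dP.
    by rewrite sn0 ltW//; near: n.
  by rewrite sub0r normrN ger0_norm//; near: n.
have main : error_density (sn n) y @[n --> \oo] --> error_density 0 y.
  apply: cvgM; last first.
    have ec : rho (sn n) y - u (sn n) y @[n --> \oo] --> rho 0 y - u 0 y.
      exact: cvgB.
    exact: (cvgM ec ec).
  rewrite /weight; apply: cvgM.
    apply: (@cvg_comp _ _ _ (fun n => kappa * sn n) expR _ (nbhs (kappa * 0))).
      by apply: cvgM => //; exact: cvg_cst.
    exact: continuous_expR.
  apply: (@cvg_comp _ _ _ (fun n => s * (y - l (sn n))) expR _ (nbhs (s * (y - l 0)))).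
    apply: cvgM; first exact: cvg_cst.
    by apply: cvgB => //; exact: cvg_cst.
  exact: continuous_expR.
apply: cvg_trans main; apply: near_eq_cvg.
by apply: filterS ev => n ->.
Unshelve. all: by end_near. Qed.

Lemma lyapunov_le_initial (T : R) : 0 < T -> (lyapunov T <= lyapunov 0)%E.
Proof.
move=> T0; have T0' := ltW T0.
have [sn snP] := small_times T0.
have sn_pos n : 0 < sn n by have [] := snP n.
have snT n : sn n <= T by have [] := snP n.
pose W1 := expR (kappa * T) * expR (s * dM).
have W10 : 0 <= W1 by rewrite mulr_ge0 ?expR_ge0.
pose Gz t y := if l t < y < r t then error_density t y else 0.
(* A majorant valid at all times up to [T]: both probes move to the right, and the error is at most
   1. *)
pose g y := if l 0 <= y <= r T then W1 else 0.
have ig : mu.-integrable setT (EFin \o g).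
  have fin : (mu `[l 0, r T] < +oo)%E.
    by rewrite lebesgue_measure_itv/=; case: ifP => // _; rewrite -EFinB ltry.
  have iW : mu.-integrable `[l 0, r T] (EFin \o (fun=> W1)).
    exact: (integrable_cst W1).
  have I := proj1 (@integrable_mkcond _ _ R mu `[l 0, r T]
    (EFin \o (fun=> W1)) (measurable_itv _)) iW.
  apply: eq_integrable I => // y _.
  by rewrite patchE /g /= mem_setE in_itv/=; case: ifP.
have mGz n : measurable_fun setT (EFin \o Gz (sn n)).
  apply/measurable_EFinP.
  exact: (measurable_on_segment (error_density_continuous (sn_pos n))).
(* At time 0 the density need not be continuous; its measurability comes from that of [rho0], the
   observer being constant there. *)
have mGz0 : measurable_fun setT (EFin \o Gz 0).
  apply/measurable_EFinP.
  have -> : Gz 0 = (fun y => weight 0 y * (rho0 y - c) ^+ 2) \_ `]l 0, r 0[.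
    apply/funext => y; rewrite patchE mem_setE in_itv/= /Gz.
    case: ifP => // yI; have [_ _ _ r0] := sol.
    by rewrite /error_density r0 init.
  apply: (proj1 (measurable_restrictT _ _)) => //.
  apply: measurable_funS measurableT (@subsetT _ _) _.
  apply: measurable_funM.
    apply: continuous_measurable_fun => y.
    exact: is_derive_continuous (is_derive_exp_affine _ _ _ _).
  apply: measurable_funX; apply: measurable_funB => //.
have cvg : {ae mu, forall y, setT y -> (EFin \o Gz (sn n)) y @[n --> \oo] --> (EFin \o Gz 0) y}.
  have all_n : {ae mu, forall y, forall n, `|rho (sn n) y - rho 0 y| <= n.+1%:R^-1}.
    by apply: ae_foralln => n; have [] := snP n.
  have prim := ae_time_primitive vf_gt0 gamma_gt0 sol rho0_range l_traj r_traj
    L2ut ftcu (lexx 0) T0'.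
  have nb : {ae mu, forall y, y <> l 0 /\ y <> r 0}.
    by have := ae_neq (l 0); apply: filterS2 (ae_neq (r 0)).
  move: nb; apply: filterS3 all_n prim => y H1 H2' [H3 H4] _.
  apply: cvg_EFin; first by near=> n.
  apply: (@error_density_cvg0 T) => // n.
  by have [] := snP n.
have bnd : {ae mu, forall y n, setT y -> (`|(EFin \o Gz (sn n)) y| <= (EFin \o g) y)%E}.
  apply: aeW => y n _; rewrite /= lee_fin /Gz /g.
  have sn0 := sn_pos n.
  case: ifP => [/andP[ly yr]|_]; last first.
    by rewrite normr0; case: ifP.
  have /andP[H1 _] := incr_l (lexx 0) (ltW sn0).
  have /andP[H2' _] := incr_r (ltW sn0) (snT n).
  rewrite ifT; last by apply/andP; split; lra.
  have lyr : l (sn n) <= y <= r (sn n) by rewrite !ltW.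
  have := error_density_le sn0 (snT n) lyr (error_le1 sn0 lyr).
  by rewrite mulr1.
have [_ _ H] := @dominated_convergence _ _ R mu setT measurableT
  (fun n => EFin \o Gz (sn n)) (EFin \o Gz 0) (EFin \o g) mGz mGz0 cvg ig bnd.
rewrite -[leRHS](cvg_lim _ H)//; apply: lime_ge.
  by apply/cvg_ex; eexists; exact: H.
by near=> n; exact: lyapunov_nonincreasing.
Unshelve. all: by end_near. Qed.

End LyapunovDecay.

(** * The matrix inequality as a quadratic form, and the conclusion *)

Lemma LMI_quadratic (R : realType)
    (vf gamma rho_min rho_max dM beta p0 p1 xi rb p q : R) :
  neg_semidefinite (Psi vf gamma rho_min rho_max dM beta p0 p1 xi rb) ->
  (Psi11 vf gamma rho_min rho_max p0 p1 xi rb + 2 * xi * beta) * p ^+ 2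
  + 2 * (p1 - 2 * vf * rb) * p * q
  + (- 2 + p0 * (dM ^+ 2 / (gamma * pi ^+ 2)) * expR (xi * gamma^-1 * dM))
    * q ^+ 2 <= 0.
Proof.
move=> [_ /(_ (\col_i (if i == 0 then p else q)))].
rewrite !mxE !big_ord_recl big_ord0 !mxE !big_ord_recl !big_ord0 !mxE /=.
apply: le_trans; rewrite le_eqVlt; apply/orP; left; apply/eqP.
move: (Psi11 _ _ _ _ _ _ _ _) (expR _) (dM ^+ 2 / _) => P E D; ring.
Qed.

Lemma LMI_quadratic_segment (R : realType)
    (vf gamma rho_min rho_max dM beta p0 p1 xi : R) :
  neg_semidefinite (Psi vf gamma rho_min rho_max dM beta p0 p1 xi rho_max) ->
  neg_semidefinite (Psi vf gamma rho_min rho_max dM beta p0 p1 xi rho_min) ->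
  forall rb : R, rho_min <= rb <= rho_max -> forall p q : R,
  (Psi11 vf gamma rho_min rho_max p0 p1 xi rb + 2 * xi * beta) * p ^+ 2
  + 2 * (p1 - 2 * vf * rb) * p * q
  + (- 2 + p0 * (dM ^+ 2 / (gamma * pi ^+ 2)) * expR (xi * gamma^-1 * dM))
    * q ^+ 2 <= 0.
Proof.
move=> nM nm rb /andP[mb bM] p q.
have := LMI_quadratic p q nM; have := LMI_quadratic p q nm.
rewrite /Psi11; set C := (- 2 + _) * q ^+ 2; move: C => C Hm HM.
(* The slope of the form in [rb]: its sign tells at which end of the segment the form is largest. *)
pose b := - (8 / 3) * vf * xi * p ^+ 2 - 4 * vf * p * q.
have [b0|b0] := leP 0 b.
  have H : 0 <= b * (rho_max - rb) by apply: mulr_ge0 => //; rewrite subr_ge0.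
  by rewrite /b in H; lra.
have H : b * (rb - rho_min) <= 0 by rewrite nmulr_rle0 ?subr_ge0.
by rewrite /b in H; lra.
Qed.

(** The norm is taken over the closed interval and the energy over the open one, where the observer
    is specified at time 0; the ends form a null set. *)
Lemma integral_segment_patch (R : realType) (a b : R) (f : R -> R) :
  measurable_fun `]a, b[ f ->
  (\int[@lebesgue_measure R]_(y in `[a, b]) (f y)%:E
    = \int[@lebesgue_measure R]_y (if a < y < b then f y else 0)%:E)%E.
Proof.
move=> mf; have mf' : measurable_fun `[a, b] (EFin \o f).
  by move/(measurable_fun_itv_cc) : mf => /measurable_EFinP.
have mab : measurable_fun `]a, b] (EFin \o f).
  by apply: measurable_funS mf' => //; exact: subset_itv_oc_cc.
rewrite -integral_itv_obnd_cbnd; last exact: mab.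
rewrite -integral_itv_bndo_bndc; last exact/measurable_EFinP.
rewrite integral_mkcond; apply: eq_integral => y _.
by rewrite patchE mem_setE in_itv/=; case: ifP.
Qed.

Lemma inf_sup_range (R : realType) (f : R -> R) (y : R) :
  (forall y, 0 <= f y <= 1) ->
  inf (range f) <= f y <= sup (range f) /\ sup (range f) <= 1.
Proof.
move=> f01.
have lb : has_lbound (range f) by exists 0 => _ [z _ <-]; case/andP: (f01 z).
have ub : has_ubound (range f) by exists 1 => _ [z _ <-]; case/andP: (f01 z).
split; first by rewrite ge_inf ?ub_le_sup//; exists y.
by apply: ge_sup; [exists (f y), y|move=> _ [z _ <-]; case/andP: (f01 z)].
Qed.

Theorem theorem1 (R : realType) (vf gamma : R) (rho0 : R -> R)
    (rho : R -> R -> R) (N : nat) (x0 : nat -> R) (x : nat -> R -> R)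
    (rhohat_ : nat -> R -> R -> R) (rhohat : R -> R -> R)
    (rho_min rho_max dM : R)
    (vf_gt0 : 0 < vf) (gamma_gt0 : 0 < gamma)
    (rho0_Linfty : Linfty rho0)
    (rho0_range : forall y, 0 <= rho0 y <= 1)
    (rho_sol : traffic_solution vf gamma rho0 rho)
    (x0_lt : forall i, (1 <= i < N)%N -> x0 i < x0 i.+1)
    (x_traj : forall i, (1 <= i <= N)%N -> probe_trajectory vf rho (x0 i) (x i))
    (rhohat_sol : forall i, (1 <= i < N)%N ->
       observer_solution vf gamma rho (rho0 (x0 i)) (x i) (x i.+1) (rhohat_ i))
    (rhohatE : forall (i : nat) (t y : R), (1 <= i < N)%N -> 0 <= t ->
       x i t <= y <= x i.+1 t -> rhohat t y = rhohat_ i t y)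
    (rho_minE : rho_min = inf (range rho0))
    (rho_maxE : rho_max = sup (range rho0))
    (rho_min_gt0 : 0 < rho_min)
    (dM_gt0 : 0 < dM)
    (dM_bound : forall (i : nat) (t : R), (1 <= i < N)%N -> 0 <= t ->
       0 <= x i.+1 t - x i t <= dM)
    (LMI : exists beta xi p0 p1 : R,
       [/\ 0 < beta, 0 < xi, 0 < p0,
           neg_semidefinite
             (Psi vf gamma rho_min rho_max dM beta p0 p1 xi rho_max) &
           neg_semidefinite
             (Psi vf gamma rho_min rho_max dM beta p0 p1 xi rho_min)]) :
  let eps := fun t y => rho t y - rhohat t y in
  forall i, (1 <= i < N)%N ->
    exists alpha K : R,
      [/\ 0 < alpha, 1 <= K &
          forall t : R, 0 <= t ->
            (L2norm (x i t) (x i.+1 t) (eps t)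
              <= K%:E * L2norm (x i 0%R) (x i.+1 0%R) (eps 0%R)
                 * (expR (- alpha * t)%R)%:E)%E].
Proof.
move=> eps i iN.
have [beta [xi [p0 [p1 [beta0 xi0 p00 nM nm]]]]] := LMI.
have lmi := LMI_quadratic_segment nM nm.
set l := x i; set r := x i.+1.
have /andP[i1 iN'] := iN.
have l_traj : probe_trajectory vf rho (x0 i) l.
  by apply: x_traj; rewrite i1 ltnW.
have r_traj : probe_trajectory vf rho (x0 i.+1) r by exact: x_traj.
have lr (t : R) : 0 <= t -> 0 <= r t - l t <= dM by exact: dM_bound.
set u := rhohat_ i.
set c := rho0 (x0 i).
have [ut [ux [uxx [[utx [utxx [[L2u L2ux _] [L2ut _ _] H2u _ ftcu]]] pde
  trace_l trace_r init]]]] := rhohat_sol i iN.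
rewrite -/l -/r -/u in L2u L2ux L2ut H2u ftcu pde trace_l trace_r init.
have rho0_I y : rho_min <= rho0 y <= rho_max.
  by rewrite rho_minE rho_maxE; have [] := inf_sup_range y rho0_range.
have rM1 : rho_max <= 1 by rewrite rho_maxE; have [] := inf_sup_range 0 rho0_range.
have rm0 := ltW rho_min_gt0.
have rho_I (t y : R) : 0 <= t -> rho_min <= rho t y <= rho_max.
  move=> t0; apply/andP; split.
    rewrite -lerN2 -mulN1r; apply: (traffic_bound gamma_gt0 rho_sol) => // z.
    by rewrite mulN1r lerN2; case/andP: (rho0_I z).
  rewrite -[rho t y]mul1r; apply: (traffic_bound gamma_gt0 rho_sol) => // z.
  by rewrite mul1r; case/andP: (rho0_I z).
have u_I (t y : R) : 0 < t -> l t <= y <= r t -> rho_min <= u t y <= rho_max.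
  (* Used twice: with [sg = 1] at [rho_min], then with [sg = -1] at [rho_max]. *)
  have B := observer_bound vf_gt0 gamma_gt0 rho_sol rho0_range l_traj r_traj lr
    L2u L2ut L2ux H2u ftcu pde trace_l trace_r init.
  move=> t0 yI; have /andP[c1 c2] := rho0_I (x0 i); apply/andP; split.
    have b1 (t' y' : R) : 0 <= t' -> 1 * (rho_min - rho t' y') <= 0.
      by move=> t'0; rewrite mul1r subr_le0; case/andP: (rho_I t' y' t'0).
    have b2 : 1 * (rho_min - c) <= 0 by rewrite mul1r subr_le0.
    by have := B rho_min 1 (expr1n _ _) b1 b2 t y t0 yI; rewrite mul1r subr_le0.
  have b1 (t' y' : R) : 0 <= t' -> -1 * (rho_max - rho t' y') <= 0.
    by move=> t'0; rewrite mulN1r opprB subr_le0; case/andP: (rho_I t' y' t'0).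
  have b2 : -1 * (rho_max - c) <= 0 by rewrite mulN1r opprB subr_le0.
  have sq : (-1) ^+ 2 = 1 :> R by rewrite sqrrN expr1n.
  by have := B rho_max (-1) sq b1 b2 t y t0 yI; rewrite mulN1r opprB subr_le0.
have decay := lyapunov_le_initial vf_gt0 gamma_gt0 rho_sol rho0_range l_traj
  r_traj lr L2u L2ut L2ux H2u ftcu pde trace_l trace_r init beta0 xi0 p00 lmi
  rho_I u_I rm0 rM1 (proj1 rho0_Linfty).
pose s := xi * gamma^-1.
pose kappa := 2 * xi * gamma^-1 * beta.
have s0 : 0 < s by rewrite mulr_gt0// invr_gt0.
have kappa0 : 0 < kappa by rewrite !mulr_gt0// invr_gt0.
(* The energy decays at rate [kappa] and its weight varies by a factor of at most [expR (s * dM)] in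
   space; the norm is a square root, which halves both exponents. *)
exists (kappa / 2), (expR (s * dM / 2)); split.
- by rewrite divr_gt0.
- by apply: one_le_expR; rewrite divr_ge0// mulr_ge0 ?ltW.
move=> t t0.
pose I t := (\int[@lebesgue_measure R]_(y in `[l t, r t]) ((eps t y) ^+ 2)%:E)%E.
have I0 t' : (0 <= I t')%E.
  by apply: integral_ge0 => y _; rewrite lee_fin sqr_ge0.
suff main : (I t <= (expR (s * dM) * expR (- (kappa * t)))%:E * I 0%R)%E.
  rewrite /L2norm -/(I t) -/(I 0%R).
  have C0 : 0 <= expR (s * dM) * expR (- (kappa * t)) by rewrite mulr_ge0 ?expR_ge0.
  apply: le_trans (_ : sqrte ((expR (s * dM) * expR (- (kappa * t)))%:E * I 0%R) <= _)%E.
    by rewrite lee_sqrt ?mule_ge0.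
  rewrite sqrteM ?lee_fin//=.
  have -> : expR (s * dM) * expR (- (kappa * t))
      = (expR (s * dM / 2) * expR (- (kappa / 2) * t)) ^+ 2.
    rewrite exprMn -!expRM_natl; congr (expR _ * expR _); first by field.
    by field.
  rewrite sqrtr_sqr ger0_norm ?mulr_ge0 ?expR_ge0// EFinM.
  by rewrite muleAC.
have Ibar t' : 0 <= t' ->
    I t' = (\int[@lebesgue_measure R]_(y in `[l t', r t'])
      ((rho t' y - u t' y) ^+ 2)%:E)%E.
  move=> t'0; apply: eq_integral => y; rewrite inE/= in_itv/= => yI.
  by rewrite /eps (rhohatE i)// .
have me t' : 0 <= t' -> measurable_fun `]l t', r t'[ (fun y => rho t' y - u t' y).
  rewrite le_eqVlt => /predU1P[<-|t'0].
    have [_ _ _ r0] := rho_sol.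
    have m0 : measurable_fun `]l 0, r 0[ (fun y => rho0 y - c).
      apply: measurable_funB => //.
      exact: measurable_funS measurableT (@subsetT _ _) (proj1 rho0_Linfty).
    apply: eq_measurable_fun m0 => y; rewrite inE/= in_itv/= => yI.
    by rewrite r0 init.
  have [[mu' _] _ _ _ _] := H2u t' t'0.
  apply: measurable_funB => //.
  apply: measurable_funS measurableT (@subsetT _ _) _.
  apply: continuous_measurable_fun.
  exact: (@traffic_slice_continuous R vf gamma rho0 rho rho_sol [::] t' t'0).
have Ipatch t' : 0 <= t' ->
    I t' = (\int[@lebesgue_measure R]_y
      (if l t' < y < r t' then (rho t' y - u t' y) ^+ 2 else 0)%:E)%E.
  by move=> t'0; rewrite Ibar// integral_segment_patch//; exact: measurable_funX (me t' t'0).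
have mpatch t' (f : R -> R) : measurable_fun `]l t', r t'[ f ->
    measurable_fun setT (fun y => (if l t' < y < r t' then f y else 0)%:E).
  move=> mf; apply/measurable_EFinP.
  have -> : (fun y => if l t' < y < r t' then f y else 0) = f \_ `]l t', r t'[.
    by apply/funext => y; rewrite patchE mem_setE in_itv/=; case: ifP.
  exact: (proj1 (measurable_restrictT _ _)).
have mW t' : 0 <= t' ->
    measurable_fun `]l t', r t'[ (error_density gamma rho l u xi beta t').
  move=> t'0; apply: measurable_funM; last exact: measurable_funX (me t' t'0).
  apply: measurable_funS measurableT (@subsetT _ _) _.
  apply: continuous_measurable_fun => y.
  exact: is_derive_continuous (is_derive_exp_affine _ _ _ _).
have mE t' (t'0 : 0 <= t') := mpatch t' _ (measurable_funX 2 (me t' t'0)).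
have mpW t' (t'0 : 0 <= t') := mpatch t' _ (mW t' t'0).
have density_ge0 t' y : 0 <= error_density gamma rho l u xi beta t' y.
  by rewrite mulr_ge0 ?sqr_ge0// mulr_ge0 ?expR_ge0.
pose V := lyapunov gamma rho l r u xi beta.
(* At time 0 the weight is largest at the right end, at distance at most [dM] from the left one; at
   time [t] it is smallest at the left end, where it is [expR (kappa * t)]. *)
have V0 : (V 0%R <= (expR (s * dM))%:E * I 0%R)%E.
  rewrite Ipatch// -ge0_integralZl_EFin//; last 2 first.
  - by move=> y _; rewrite lee_fin; case: ifP => // _; exact: sqr_ge0.
  - exact: (mE 0 (lexx 0)).
  apply: ge0_le_integral => //.
  - by move=> y _; rewrite lee_fin; case: ifP.
  - exact: (mpW 0 (lexx 0)).
  - by apply: measurable_funeM; exact: (mE 0 (lexx 0)).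
  - move=> y _; rewrite -EFinM lee_fin; case: ifP => [/andP[ly yr]|]; last by rewrite mulr0.
    rewrite ler_wpM2r ?sqr_ge0//.
    have := weight_le gamma_gt0 lr beta0 xi0 (lexx 0) (lexx 0) (ltW yr).
    by rewrite mulr0 expR0 mul1r.
have Vt : ((expR (kappa * t))%:E * I t <= V t)%E.
  rewrite Ipatch// -ge0_integralZl_EFin//; last 2 first.
  - by move=> y _; rewrite lee_fin; case: ifP => // _; exact: sqr_ge0.
  - exact: (mE t t0).
  apply: ge0_le_integral => //.
  - move=> y _; rewrite -EFinM lee_fin mulr_ge0 ?expR_ge0//.
    by case: ifP => // _; exact: sqr_ge0.
  - by apply: measurable_funeM; exact: (mE t t0).
  - exact: (mpW t t0).
  - move=> y _; rewrite -EFinM lee_fin; case: ifP => [/andP[ly yr]|]; last by rewrite mulr0.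
    rewrite ler_wpM2r ?sqr_ge0//.
    exact: (weight_ge gamma_gt0 beta xi0 t0 (ltW ly)).
have VV : (V t <= V 0%R)%E.
  by move: t0; rewrite le_eqVlt => /predU1P[<-//|]; exact: decay.
have main : ((expR (kappa * t))%:E * I t <= (expR (s * dM))%:E * I 0%R)%E.
  exact: le_trans Vt (le_trans VV V0).
have -> : I t = ((expR (- (kappa * t)))%:E * ((expR (kappa * t))%:E * I t))%E.
  by rewrite muleA -EFinM -expRD addNr expR0 mul1e.
rewrite [expR (s * dM) * _]mulrC EFinM.
rewrite -(muleA (expR (- (kappa * t)))%:E); exact: lee_wpmul2l.
Qed.
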